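(* Let $\mathfrak{N}$ be a factorization structure and $f\in\mathscr{F}^{\mathfrak{N}}$. For any factorization structure $\mathfrak{M}$ with $\deg(\mathfrak{M})=\deg(\mathfrak{N})=\mathbf{m}$, we have $f\in\overline{\mathscr{F}^{\mathfrak{M}}}$ (closure in $\mathbb{P}^{\mathbf{m}}$) if and only if $\mathfrak{N}\prec\mathfrak{M}$. Furthermore, $\mathrm{codim}(\mathscr{F}^{\mathfrak{N}})>\mathrm{codim}(\mathscr{F}^{\mathfrak{M}})$ in $\mathbb{P}^{\mathbf{m}}$ if $\mathfrak{N}\prec\mathfrak{M}$ and $\mathfrak{N}\ne\mathfrak{M}$.
   Context: For nonzero $f\in\mathbb{C}[x_1,\ldots,x_\ell]$, $\deg(f)=(\deg_{x_1}f,\ldots,\deg_{x_\ell}f)$. $\mathbb{P}^{\mathbf{n}}$ is the vector space of polynomials of degree $\le\mathbf{n}$ (componentwise), topologized by the Euclidean norm of coefficient vectors; $\langle\mathbf{n}\rangle=\dim\mathbb{P}^{\mathbf{n}}$; $\mathscr{P}^{\mathbf{n}}$ is the set of polynomials of degree exactly $\mathbf{n}$. If $f$ has degree $\mathbf{m}$ and $f=\alpha f_1^{k_1}\cdots f_r^{k_r}$ with $\alpha\in\mathbb{C}\setminus\{0\}$, $f_j$ irreducible and pairwise coprime, $k_j\ge1$, $\mathbf{m}_j=\deg(f_j)$, then the factorization structure of $f$ is the formal product $\mathfrak{M}=\mathbf{m}_1^{k_1}\cdots\mathbf{m}_r^{k_r}$ (order irrelevant; the same $\mathbf{m}_j$ may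 occur more than once). A factorization structure is one that arises from some polynomial; $\deg(\mathfrak{M})=k_1\mathbf{m}_1+\cdots+k_r\mathbf{m}_r$. $\mathscr{F}^{\mathfrak{M}}$ is the set of all $f\in\mathscr{P}^{\mathbf{m}}$, $\mathbf{m}=\deg(\mathfrak{M})$, of the form $\alpha g_1^{k_1}\cdots g_r^{k_r}$ with $\alpha\in\mathbb{C}$ and $g_j\in\mathscr{P}^{\mathbf{m}_j}$ irreducible and pairwise coprime. It is a complex analytic manifold in $\mathbb{P}^{\mathbf{m}}$ with $\mathrm{codim}(\mathscr{F}^{\mathfrak{M}})=\langle\mathbf{m}\rangle-(\langle\mathbf{m}_1\rangle+\cdots+\langle\mathbf{m}_r\rangle+1-r)$. Embedding operations on a factorization structure: (1) degree combining: $\cdots\mathbf{n}_i^{k_i}\cdots\mathbf{n}_j^{k_j}\cdots\longrightarrow\cdots(\mathbf{n}_i+\mathbf{n}_j)^{k}\cdots$ where $k_i=k_j=k$, other components unchanged; (2) multiplicity splitting: $\cdots\mathbf{n}_i^{k_i}\cdots\longrightarrow\cdots\mathbf{n}_i^{\hat k_i}\,\mathbf{n}_i^{\tilde k_i}\cdots$ where $k_i=\hat k_i+\tilde k_i$ (with $\hat k_i,\tilde k_i\ge1$), other components unchanged. $\mathfrak{N}\prec\mathfrak{M}$ ($\mathfrak{N}$ is embedded in $\mathfrak{M}$) means $\mathfrak{N}=\mathfrak{M}$ or $\mathfrak{M}$ can be obtained by applying a sequence of embedding operations on $\mathfrak{N}$. *)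

(* Defs.v *)
From HB Require Import structures.
From mathcomp Require Import all_boot all_order all_algebra.
From mathcomp Require Import classical_sets reals topology normedtype derive.
From mathcomp Require Import complex.
From mathcomp Require mpoly.
Export -(notations) mpoly.

Set Implicit Arguments.
Unset Strict Implicit.
Unset Printing Implicit Defensive.

Import Order.TTheory GRing.Theory Num.Theory.
Import numFieldNormedType.Exports.

Local Open Scope ring_scope.
Local Open Scope classical_set_scope.

(* The notations of [mpoly] clash with those of the topology files. *)

(* R[i], packed as a [numClosedFieldType] so that its topology and its normed
   module structure over itself are inferred; [R[i]] itself carries none. *)
Definition Cplx (R : realType) : numClosedFieldType := R[i].

Section Polynomials.
Context {R : realType} {l : nat}.
Implicit Types (f g d : mpoly l (Cplx R)) (n : multinom l).

(* Only meaningful for f != 0. *)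
Definition multideg f : multinom l :=
  Multinom [tuple \max_(a <- msupp f) a i | i < l].

Definition irreducible f : Prop :=
  [/\ f != 0, f \isn't a GRing.unit
    & forall g d, f = g * d -> g \is a GRing.unit \/ d \is a GRing.unit].

Definition coprime_mpoly f g : Prop :=
  forall d, (exists a, f = a * d) -> (exists b, g = b * d) ->
    d \is a GRing.unit.

(* Exponents of the monomials of a polynomial of degree at most n. *)
Definition box n := {dffun forall i : 'I_l, 'I_(n i).+1}.

Definition box_mnm n (b : box n) : multinom l :=
  Multinom [tuple nat_of_ord (b i) | i < l].

Definition dimP n : nat := #|{: box n}|.

(* The space of polynomials of degree at most n is represented by its
   coefficient space C^(dimP n), whose library topology is that of the
   Euclidean norm; coefv is the coordinate map, injective on polynomials of
   degree at most n. *)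
Definition coefv n f : 'rV[Cplx R]_(dimP n) :=
  \row_(j < dimP n) mcoeff (box_mnm (enum_val j)) f.

End Polynomials.

(* A formal product m_1^k_1 ... m_r^k_r, as the list of its (m_j, k_j); lists
   that differ by a permutation stand for the same product. *)
Definition fproduct (l : nat) := seq (multinom l * nat).

Definition same_fproduct (l : nat) (N M : fproduct l) : Prop := perm_eq N M.

Definition degF (l : nat) (M : fproduct l) : multinom l :=
  \big[@mnm_add l/@mnm0 l]_(p <- M) mnm_muln p.1 p.2.

Section FactorizationStructures.
Context (R : realType) (l : nat).

Definition is_factorization (M : fproduct l) (f : mpoly l (Cplx R))
    (alpha : Cplx R) (g : 'I_(size M) -> mpoly l (Cplx R)) : Prop :=
  [/\ forall j, irreducible (g j) /\
        multideg (g j) = (tnth (in_tuple M) j).1,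
      forall i j, i != j -> coprime_mpoly (g i) (g j)
    & f = alpha *: \prod_j g j ^+ (tnth (in_tuple M) j).2].

Definition is_factstruct (M : fproduct l) : Prop :=
  exists f alpha g, [/\ f != 0, alpha != 0,
    (forall j, 0 < (tnth (in_tuple M) j).2)%N
    & is_factorization (M := M) f alpha g].

Definition factset (M : fproduct l) : set (mpoly l (Cplx R)) :=
  [set f | [/\ f != 0, multideg f = degF M
    & exists alpha g, is_factorization (M := M) f alpha g]].

End FactorizationStructures.

Arguments is_factstruct R {l} M.
Arguments factset R {l} M.

Section Embedding.
Context {l : nat}.

Variant embed_op (N M : fproduct l) : Prop :=
| DegreeCombining (a b : multinom l) (k : nat) (L : fproduct l) of
    perm_eq N ((a, k) :: (b, k) :: L) &
    perm_eq M ((mnm_add a b, k) :: L)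
| MultiplicitySplitting (a : multinom l) (k1 k2 : nat) (L : fproduct l) of
    (0 < k1)%N & (0 < k2)%N &
    perm_eq N ((a, (k1 + k2)%N) :: L) &
    perm_eq M ((a, k1) :: (a, k2) :: L).

Inductive embedded (N M : fproduct l) : Prop :=
| EmbeddedRefl of same_fproduct N M
| EmbeddedStep (N' : fproduct l) of embed_op N N' & embedded N' M.

End Embedding.

Section Submanifolds.
Context {K : numFieldType}.

(* S is an embedded complex analytic submanifold of dimension d: every point
   has an open neighbourhood U such that S `&` U is the homeomorphic image of
   an open subset of K^d under an immersion that is (for K = C) holomorphic,
   i.e. complex differentiable on an open set. *)
Definition submanifold_of_dim (n d : nat) (S : set 'rV[K]_n) : Prop :=
  forall p, S p ->
  exists (U : set 'rV[K]_n) (V : set 'rV[K]_d)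
         (phi : 'rV[K]_d -> 'rV[K]_n) (psi : 'rV[K]_n -> 'rV[K]_d),
  [/\ open U /\ U p, open V,
      forall x, V x -> differentiable phi x /\ injective ('d phi x),
      phi @` V = S `&` U
    & (forall x, V x -> psi (phi x) = x) /\ {within S `&` U, continuous psi}].

Definition has_codim (n : nat) (S : set 'rV[K]_n) (c : nat) : Prop :=
  exists2 d, submanifold_of_dim d S & (d + c = n)%N.

(* The codimension of a nonempty submanifold, which is unique (0 by
   convention if there is none). *)
Definition codim (n : nat) (S : set 'rV[K]_n) : nat :=
  xget 0%N [set c | has_codim S c].

End Submanifolds.

(* Main.v *)
Require Import Defs.
From HB Require Import structures.
From mathcomp Require Import all_boot all_order all_algebra.
From mathcomp Require Import ring zify.
From mathcomp Require Import boolp classical_sets functions filter reals topology normedtype.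
From mathcomp Require Import landau derive complex.

Set Implicit Arguments.
Unset Strict Implicit.
Unset Printing Implicit Defensive.

Import Order.TTheory GRing.Theory Num.Theory.
Import numFieldNormedType.Exports.

Local Open Scope ring_scope.
Local Open Scope classical_set_scope.

(** For a structure M = m_1^k_1 ... m_r^k_r let T(M) be the set of products
    alpha h_1^k_1 ... h_r^k_r in which h_j has degree exactly m_j but need not
    be irreducible ([exact_product]).  The theorem holds because T(M) is the
    closure of the stratum of M within the polynomials of degree m, and because
    membership of f in T(M) can be read off the factorization of f.

    The closure is contained in T(M).  Scale the factors so that their largest
    coefficient is 1.  Along an ultrafilter the coefficients of the factors
    converge, the limits are nonzero, and no factor loses degree since the
    degrees must still add up to m ([limit_of_products]).

    T(M) and embedding.  Polynomial rings over a field are factorial, so if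
    f = alpha f_1^a_1 ... f_s^a_s lies in T(M), then h_j is, up to a scalar, a
    product of powers f_i^c_ij, and comparing exponents and degrees gives
    a_i = sum_j c_ij k_j and m_j = sum_i c_ij n_i ([factorization_refinement]).
    Such a matrix c is a recipe for an embedding: split n_i^a_i into c_ij copies
    of n_i^k_j for each j, then combine the degrees that belong to the same j
    ([refinement_embedded]).  Conversely, each embedding operation maps T(N)
    into T(M) ([exact_product_embed]).

    Counting parameters.  Put D(M) = 1 + sum_j (<m_j> - 1) ([fparam]).  One has
    <a+b> - 1 >= (<a> - 1) + (<b> - 1), strictly unless a and b are multiples of
    the same variable.  The exception does not arise in the degree of an
    irreducible polynomial, because univariate irreducible polynomials over the
    complex numbers are linear.  So a matrix c as above forces D(N) <= D(M), and
    equality only for a permutation matrix ([factorization_rigid]).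

    The stratum of M is a submanifold of dimension D(M).  Its local parameters
    are the scalar alpha and the coefficients of the factors, one coefficient of
    each factor being pinned to 1.  All values near a given one stay in the
    stratum, since a polynomial close to f has a structure M' with f in T(M'),
    whence D(M) <= D(M') <= D(M); every nearby point of the stratum is a value
    by compactness and rigidity; the differential is injective since the factors
    are pairwise coprime.  The dimension is well defined because the velocities
    of curves in a submanifold form a vector space of that dimension, even for
    charts that are merely differentiable ([submanifold_tangent]).  Together
    with the inequality for D this proves the claim on codimensions.

    T(M) is contained in the closure.  It suffices to approximate each h_j by
    irreducible polynomials of the same degree n ([irreducible_dense]).  In an
    open set of polynomials of degree n choose one whose structure N has D(N) as
    large as possible.  All polynomials near it have structures M' with
    D(M') >= D(N), hence lie in the stratum of N, which therefore has dimension
    <n>; and D(N) = <n> leaves only N = n^1.  Small constant shifts then make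
    the approximating factors pairwise coprime. *)


(** * Factorial rings and the Gauss lemma *)

Section Divisibility.
Variable D : idomainType.
Implicit Types a b c p : D.

Definition divides a b : Prop := exists c, b = c * a.

Definition prime_elt p : Prop :=
  [/\ p != 0, p \isn't a GRing.unit
    & forall a b, divides p (a * b) -> divides p a \/ divides p b].

Definition irreducible_elt p : Prop :=
  [/\ p != 0, p \isn't a GRing.unit
    & forall a b, p = a * b -> a \is a GRing.unit \/ b \is a GRing.unit].

Definition prime_factored a : Prop :=
  exists2 u, u \is a GRing.unit
    & exists2 s : seq D, {in s, forall p, prime_elt p} & a = u * \prod_(p <- s) p.

Definition factorial_ring : Prop := forall a, a != 0 -> prime_factored a.

Lemma prime_factoredM a b :
  prime_factored a -> prime_factored b -> prime_factored (a * b).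
Proof.
move=> [u Uu [s sP ->]] [v Uv [t tP ->]]; exists (u * v); first by rewrite unitrM Uu.
exists (s ++ t); last by rewrite big_cat mulrACA.
by move=> p; rewrite mem_cat => /orP[/sP|/tP].
Qed.

Lemma divides_refl a : divides a a.
Proof. by exists 1; rewrite mul1r. Qed.

Lemma divides_mull a b c : divides a b -> divides a (c * b).
Proof. by case=> d ->; exists (c * d); rewrite mulrA. Qed.

Lemma divides_mulr a b c : divides a b -> divides a (b * c).
Proof. by rewrite mulrC; apply: divides_mull. Qed.

Lemma divides_trans a b c : divides a b -> divides b c -> divides a c.
Proof. by move=> ab [d ->]; apply: divides_mull. Qed.

Lemma dividesD a b c : divides a b -> divides a c -> divides a (b + c).
Proof. by move=> [d ->] [e ->]; exists (d + e); rewrite mulrDl. Qed.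

Lemma dividesBr a b c : divides a (b + c) -> divides a b -> divides a c.
Proof.
by move=> [d E] [e F]; exists (d - e); rewrite mulrBl -E -F addrC addKr.
Qed.

Lemma divides0 a : divides a 0.
Proof. by exists 0; rewrite mul0r. Qed.

Lemma divides_sum a (I : eqType) (r : seq I) (P : pred I) (F : I -> D) :
  (forall i, i \in r -> P i -> divides a (F i)) ->
  divides a (\sum_(i <- r | P i) F i).
Proof.
move=> H; rewrite big_seq_cond; apply: (big_ind (divides a)).
- exact: divides0.
- exact: dividesD.
- by move=> i /andP[]; apply: H.
Qed.

Lemma divides_unit a u : u \is a GRing.unit -> divides a u -> a \is a GRing.unit.
Proof. by move=> Uu [c E]; move: Uu; rewrite E unitrM => /andP[]. Qed.

Lemma prime_divides_prod p (I : eqType) (r : seq I) (F : I -> D) :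
  prime_elt p -> divides p (\prod_(i <- r) F i) ->
  exists2 i, i \in r & divides p (F i).
Proof.
move=> [_ nU pP]; elim: r => [|i r IH].
  by rewrite big_nil => /(divides_unit (unitr1 _)); rewrite (negPf nU).
rewrite big_cons => /pP[pi|/IH[j jr pj]]; first by exists i; rewrite ?mem_head.
by exists j; rewrite // in_cons jr orbT.
Qed.

Lemma prime_divides_exp p a n : prime_elt p -> divides p (a ^+ n) -> divides p a.
Proof.
move=> pp; rewrite -[n]card_ord -prodr_const.
by case/(prime_divides_prod pp).
Qed.

Lemma prime_irreducible p : prime_elt p -> irreducible_elt p.
Proof.
move=> [p0 nU pP]; split=> // a b E.
have /pP[] : divides p (a * b) by rewrite -E; apply: divides_refl.
- move=> [c Ec]; right; apply/unitrP; exists c; split.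
  + by apply: (mulfI p0); rewrite mulr1 [RHS]E Ec; ring.
  + by apply: (mulfI p0); rewrite mulr1 [RHS]E Ec; ring.
- move=> [c Ec]; left; apply/unitrP; exists c; split.
  + by apply: (mulfI p0); rewrite mulr1 [RHS]E Ec; ring.
  + by apply: (mulfI p0); rewrite mulr1 [RHS]E Ec; ring.
Qed.

Lemma prime_mulu p u : u \is a GRing.unit -> prime_elt p -> prime_elt (u * p).
Proof.
move=> Uu [p0 nU pP]; split.
- by rewrite mulf_neq0 //; apply: contraTneq Uu => ->; rewrite unitr0.
- by rewrite unitrM (negPf nU) andbF.
- have dE a : divides (u * p) a <-> divides p a.
    split=> [[c ->]|[c ->]]; first by exists (c * u); rewrite mulrA.
    by exists (c / u); rewrite mulrA divrK.
  by move=> a b /dE /pP[]/dE; [left|right].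
Qed.

(** An irreducible element is associate to the only prime factor it can have. *)
Lemma factorial_irreducible_prime p :
  factorial_ring -> irreducible_elt p -> prime_elt p.
Proof.
move=> UF [p0 nU pI]; have [u Uu [[|q s] sP E]] := UF p p0.
  by move: nU; rewrite E big_nil mulr1 Uu.
have pq : prime_elt q by apply: sP; rewrite mem_head.
rewrite big_cons mulrCA mulrC in E.
have [Uq|Uq] := pI _ _ E; first by rewrite E; apply: prime_mulu.
by case: pq => _; rewrite Uq.
Qed.

Lemma prod_exp_neq0 (I : finType) (f : I -> D) (k : I -> nat) :
  (forall i, f i != 0) -> \prod_i f i ^+ k i != 0.
Proof. by move=> f0; apply/prodf_neq0 => i _; rewrite expf_neq0. Qed.

End Divisibility.


Section GaussLemma.
Variable D : idomainType.
Hypothesis UFD : factorial_ring D.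
Implicit Types (f g h : {poly D}) (c p : D).

Lemma divides_polyC c f : divides c%:P f <-> forall i, divides c f`_i.
Proof.
split=> [[g ->] i|H]; first by rewrite coefMC; exists g`_i.
rewrite -[f]coefK poly_def; apply: divides_sum => i _ _.
by have [d ->] := H i; exists (d *: 'X^i); rewrite [RHS]mulrC mul_polyC scalerA mulrC.
Qed.

Lemma divides_polyC_consE c f a :
  divides c%:P (f * 'X + a%:P) <-> divides c%:P f /\ divides c a.
Proof.
split=> [/divides_polyC H|[cf [d ->]]].
  split; first by apply/divides_polyC => i; have := H i.+1; rewrite coefD coefMX coefC addr0.
  by have := H 0; rewrite coefD coefMX coefC add0r.
by apply: dividesD; [exact: divides_mulr | exists d%:P; rewrite polyCM].
Qed.

(** Induction on both polynomials through their constant terms, so that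
    divisibility by p never has to be decided. *)
Lemma prime_polyC p : prime_elt p -> prime_elt p%:P.
Proof.
move=> [p0 nU pP]; split; first by rewrite polyC_eq0.
  by rewrite poly_unitE coefC /= (negPf nU) andbF.
elim/poly_ind => [|f a IHf] g; first by left; apply: divides0.
elim/poly_ind: g => [|g b IHg]; first by right; apply: divides0.
move=> H; have : divides p (a * b).
  by move/divides_polyC: H => /(_ 0); rewrite coef0M !coefD !coefMX !coefC !add0r.
case/pP => [pa|pb].
- have: divides p%:P (f * (g * 'X + b%:P) * 'X + 0%:P).
    rewrite addr0; move: H; rewrite mulrDl addrC -mulrAC => /dividesBr; apply.
    by apply: divides_mulr; have [d ->] := pa; exists d%:P; rewrite polyCM.
  case/divides_polyC_consE => /IHf [H1|]; last by right.
  by left; apply/divides_polyC_consE.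
- have: divides p%:P ((f * 'X + a%:P) * g * 'X + 0%:P).
    rewrite addr0; move: H; rewrite [_ * (_ + b%:P)]mulrDr addrC mulrA => /dividesBr; apply.
    by apply: divides_mull; have [d ->] := pb; exists d%:P; rewrite polyCM.
  case/divides_polyC_consE => /IHg [|H1]; first by left.
  by right; apply/divides_polyC_consE.
Qed.

Definition primitive f := forall p, prime_elt p -> ~ divides p%:P f.

(** The prime factors of c stay prime as constant polynomials, and none of them
    divides the primitive f, so they can be cancelled one by one. *)
Lemma primitive_divides f g c :
  primitive f -> c != 0 -> divides f (c%:P * g) -> divides f g.
Proof.
move=> fP /UFD[u Uu [s sP ->]] {c}.
elim: s sP => [|q s IH] sP.
  rewrite big_nil mulr1 => -[h E]; exists (u^-1%:P * h).
  by rewrite -mulrA -E mulrA -polyCM mulVr // mul1r.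
have qP : prime_elt q by apply: sP; rewrite mem_head.
rewrite big_cons mulrCA polyCM -mulrA => -[h E].
have [_ _ qI] := prime_polyC qP; case: (qI h f).
- by rewrite -E; apply: divides_mulr; apply: divides_refl.
- move=> [k Ek]; apply: IH => [r rs|]; first by apply: sP; rewrite in_cons rs orbT.
  exists k; apply: (@mulfI _ q%:P); first by case: (prime_polyC qP).
  by rewrite E Ek; ring.
- by move=> /(fP q qP).
Qed.

(** Pulling a prime out of f removes one prime factor from its leading
    coefficient, which bounds the number of steps. *)
Lemma primitive_part f : f != 0 ->
  exists2 c, c != 0 & exists2 g, primitive g & f = c%:P * g.
Proof.
move=> f0; have lf0 : lead_coef f != 0 by rewrite lead_coef_eq0.
have {lf0} [u Uu [s sP Es]] := UFD lf0.
have [n] := ubnP (size s); elim: n => // n IH in f u s f0 Uu sP Es *.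
move=> lt_sn; have [fP|] := pselect (primitive f).
  by exists 1; rewrite ?oner_eq0 //; exists f; rewrite // mul1r.
move=> /existsNP[p /not_implyP[pp /contrapT[g E]]].
have p0 : p != 0 by case: pp.
have g0 : g != 0 by apply: contraNneq f0 => g0; rewrite E g0 mul0r.
have lE : lead_coef f = p * lead_coef g by rewrite E lead_coefM lead_coefC mulrC.
have [q qs pq] : exists2 q, q \in s & divides p q.
  apply: prime_divides_prod => //; exists (u^-1 * lead_coef g).
  by rewrite -[LHS](mulKr Uu) -Es lE mulrAC mulrA.
have [v vE] := pq; have [_ nU qI] := prime_irreducible (sP _ qs).
case: (qI _ _ vE); last by case: pp => _ /negPf ->.
move=> Uv; have {}Es : lead_coef g = (u * v) * \prod_(r <- rem q s) r.
  apply: (mulfI p0); rewrite -lE Es (perm_big _ (perm_to_rem qs)) big_cons {1}vE.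
  by rewrite !mulrA; congr (_ * _); ring.
have ltn : (size (rem q s) < n)%N by rewrite size_rem //; case: (s) qs lt_sn.
have Uuv : u * v \is a GRing.unit by rewrite unitrM Uu.
have [c c0 [h hP Eh]] := IH g _ _ g0 Uuv (fun r rs => sP r (mem_rem rs)) Es ltn.
exists (p * c); first by rewrite mulf_neq0.
by exists h; rewrite // E Eh polyCM; ring.
Qed.

Lemma irreducible_primitive f :
  (1 < size f)%N -> irreducible_elt f -> primitive f.
Proof.
move=> sf [f0 nU fI] p pp [g E]; have [_ pU _] := prime_polyC pp.
have [Ug|] := fI _ _ E; last by rewrite (negPf pU).
move: Ug sf; rewrite poly_unitE => /andP[/size_poly1P[c _ Ec] _].
by rewrite E Ec -polyCM size_polyC; case: (_ != 0).
Qed.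

(** Pseudo-division replaces the field of fractions: a Bezout combination of f
    and a equals their gcd up to constants of D, and if f does not divide a this
    gcd is itself a constant.  Multiplying by b gives that f divides a constant
    multiple of b, and the constant can be dropped as f is primitive. *)
Lemma irreducible_prime_poly f :
  (1 < size f)%N -> irreducible_elt f -> prime_elt f.
Proof.
move=> sf fI; have fP := irreducible_primitive sf fI; case: fI => f0 nU fI.
split=> // a b fab; have [fa|nfa] := pselect (divides f a); first by left.
right; have g0 : gcdp f a != 0 by rewrite gcdp_eq0 negb_and f0.
have [e e0 [h hP Eh]] := primitive_part g0.
have hdiv x : gcdp f a %| x -> divides h x.
  move=> /Pdiv.Idomain.dvdpP[[c q] /= c0 E].
  apply: (primitive_divides hP c0); rewrite mul_polyC E Eh.
  by apply: divides_mull; apply: divides_mull; apply: divides_refl.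
(* h, the primitive part of the gcd, is not associate to f, so it is a unit. *)
have [q Eq] := hdiv f (dvdp_gcdl _ _).
have Uh : h \is a GRing.unit.
  have [Uq|//] := fI _ _ Eq; case: nfa.
  apply: divides_trans (hdiv a (dvdp_gcdr _ _)).
  by exists q^-1; rewrite Eq mulKr.
move: Uh; rewrite poly_unitE => /andP[/size_poly1P[d d0 Ed] _].
have [u /eqpP[[c1 c2] /andP[/= c10 c20] E]] := Bezoutp f a.
apply: (@primitive_divides _ _ (c2 * (e * d)) fP); first by rewrite !mulf_neq0.
rewrite !polyCM -Ed -Eh !mul_polyC -E -scalerAl mulrDl -mulrA.
rewrite -mul_polyC mulrDr; apply: dividesD; apply: divides_mull.
  by apply: divides_mull; apply: divides_mulr; apply: divides_refl.
by rewrite -?mulrA; apply: divides_mull.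
Qed.

Lemma factorial_poly : factorial_ring {poly D}.
Proof.
move=> f f0; have [c c0 [g gP Ef]] := primitive_part f0.
have g0 : g != 0 by apply: contraNneq f0 => g0; rewrite Ef g0 mulr0.
rewrite {}Ef; apply: prime_factoredM.
  have [u Uu [s sP ->]] := UFD c0; exists u%:P.
    by rewrite poly_unitE size_polyC coefC Uu (contraTneq _ Uu) // => ->; rewrite unitr0.
  exists (map (@polyC D) s); last by rewrite polyCM rmorph_prod big_map.
  by move=> _ /mapP[p ps ->]; apply: prime_polyC; apply: sP.
have [n] := ubnP (size g); elim: n => // n IH in g gP g0 *.
rewrite ltnS => sg; have [Ug|nUg] := boolP (g \is a GRing.unit).
  by exists g => //; exists [::]; rewrite ?big_nil ?mulr1.
have szC h k : h * k = g -> h \isn't a GRing.unit -> (1 < size h)%N.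
  move=> E nUh; rewrite ltnNge; apply/negP => /size1_polyC Eh.
  have h0 : h`_0 != 0 by apply: contraNneq g0 => h0; rewrite -E Eh h0 mul0r.
  have [u Uu [[|p s] sP Es]] := UFD h0.
    move: nUh; rewrite Eh poly_unitE size_polyC h0 coefC /= Es big_nil mulr1.
    by rewrite Uu.
  have /gP := sP p (mem_head _ _); apply; rewrite -E Eh Es big_cons.
  apply: divides_mulr; rewrite mulrCA polyCM.
  by apply: divides_mulr; apply: divides_refl.
have [gI|] := pselect (irreducible_elt g).
  exists 1; rewrite ?unitr1 //; exists [:: g]; last by rewrite big_seq1 mul1r.
  move=> _ /[!inE]/eqP->; apply: irreducible_prime_poly => //.
  by apply: (szC g 1); rewrite ?mulr1.
move=> /not_and3P[||]; [by rewrite g0|by rewrite nUg|].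
move=> /existsNP[h /existsNP[k /not_implyP[E /not_orP[/negP nUh /negP nUk]]]].
have sh := szC _ _ (esym E) nUh; have sk := szC _ _ (etrans (mulrC _ _) (esym E)) nUk.
have h0 : h != 0 by apply: contraNneq g0 => h0; rewrite E h0 mul0r.
have k0 : k != 0 by apply: contraNneq g0 => k0; rewrite E k0 mulr0.
move: sg; rewrite E size_mul // => sg.
apply: prime_factoredM; apply: IH => //.
- by move=> p /gP np /(@divides_mulr _ _ _ k); rewrite -E.
- by lia.
- by move=> p /gP np /(@divides_mull _ _ _ h); rewrite -E.
- by lia.
Qed.

End GaussLemma.

(** The isomorphism between polynomials in n+1 variables and univariate
    polynomials over those in n variables carries the induction on n. *)
Section FactorialTransfer.
Variables (A B : idomainType) (f : {rmorphism A -> B}).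
Hypotheses (f_inj : injective f) (f_surj : forall b, exists a, f a = b).

Lemma unit_transfer a : (f a \is a GRing.unit) = (a \is a GRing.unit).
Proof.
apply/idP/idP; last exact: rmorph_unit.
move=> /unitrP[v [v1 v2]]; have [b Eb] := f_surj v; apply/unitrP; exists b.
by split; apply: f_inj; rewrite rmorphM Eb rmorph1.
Qed.

Lemma divides_transfer a b : divides (f a) (f b) <-> divides a b.
Proof.
split=> [[c E]|[c ->]]; last by exists (f c); rewrite rmorphM.
have [d Ed] := f_surj c; exists d; apply: f_inj.
by rewrite rmorphM Ed.
Qed.

Lemma prime_transfer a : prime_elt (f a) -> prime_elt a.
Proof.
move=> [a0 nU aP]; split.
- by apply: contraNneq a0 => ->; rewrite rmorph0.
- by rewrite -unit_transfer.
- move=> b c /divides_transfer; rewrite rmorphM => /aP[]/divides_transfer; by [left|right].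
Qed.

Lemma factorial_transfer : factorial_ring B -> factorial_ring A.
Proof.
move=> UB a a0; have fa0 : f a != 0 by rewrite -(rmorph0 f) (inj_eq f_inj).
have [u Uu [s sP E]] := UB _ fa0.
have [v Ev] := f_surj u; exists v; first by rewrite -unit_transfer Ev.
have [t Et] : exists t, s = [seq f x | x <- t].
  elim: (s) => [|x r [t ->]]; first by exists [::].
  by have [y <-] := f_surj x; exists (y :: t).
exists t; first by move=> p pt; apply/prime_transfer/sP; rewrite Et map_f.
by apply: f_inj; rewrite E rmorphM rmorph_prod Ev Et big_map.
Qed.

End FactorialTransfer.

Section MpolyFactorial.
Variable K : fieldType.
Local Notation widen := (widen_ord (leqnSn _)).

Lemma mpoly_unitP n (p : mpoly n K) :
  reflect (exists2 c, c != 0 & p = mpolyC n c) (p \is a GRing.unit).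
Proof.
apply: (iffP idP) => [/andP[/eqP E ]|[c c0 ->]].
  by rewrite unitfE => H; exists (mcoeff mnm0 p).
by apply/andP; rewrite mcoeffC eqxx mulr1 unitfE; split => //; apply/eqP.
Qed.
Lemma mcoeff_muni n (p : mpoly n.+1 K) i m :
  mcoeff m (muni p)`_i =
  mcoeff (Multinom [tuple if unlift ord_max j is Some k then m k else i | j < n.+1]) p.
Proof.
set M := Multinom _; rewrite muniE coef_sum raddf_sum /= [in RHS](mpolyE p) [in RHS]raddf_sum /=.
apply: eq_bigr => t _; rewrite coefZ coefXn !mcoeffZ mcoeffX.
have -> : (t == M) = (i == t ord_max) &&
    (Multinom [tuple t (widen j) | j < n] == m).
  apply/eqP/andP => [->|[/eqP Ei /eqP Em]].
    split; apply/eqP; first by rewrite /M mnmE unlift_none.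
    apply/mnmP => j; rewrite !mnmE.
    case: unliftP => [k Ek|/(congr1 val) /= E]; last by have := ltn_ord j; rewrite E ltnn.
    congr (m _); apply: val_inj; move/(congr1 val): Ek => /=.
    by rewrite /bump leqNgt ltn_ord.
  apply/mnmP => j; rewrite mnmE; case: unliftP => [k ->|-> //].
  rewrite -Em mnmE; congr (t _); apply: val_inj => /=.
  by rewrite /bump leqNgt ltn_ord.
case: eqP => _ /=; last by rewrite mulr0 mcoeff0 mulr0.
by rewrite mulr1 mcoeffZ mcoeffX.
Qed.

Lemma muni_inj n : injective (@muni n K).
Proof.
move=> p q E; apply/mpolyP => m.
have eM (r : mpoly n.+1 K) : mcoeff m r =
    mcoeff (Multinom [tuple m (widen j) | j < n]) (muni r)`_(m ord_max).
  rewrite mcoeff_muni; congr (mcoeff _ r); apply/mnmP => j; rewrite mnmE.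
  case: unliftP => [k ->|-> //]; rewrite mnmE; congr (m _); apply: val_inj => /=.
  by rewrite /bump leqNgt ltn_ord.
by rewrite !eM E.
Qed.

Lemma muni_mwiden n (p : mpoly n K) : muni (mwiden p) = p%:P.
Proof.
apply/polyP => i; apply/mpolyP => m; rewrite mcoeff_muni coefC.
rewrite (mwidenE (leqnn _)) raddf_sum /=.
have -> : mcoeff m (if i == 0%N then p else 0) = (i == 0%N)%:R * mcoeff m p.
  by case: eqP; rewrite ?mul1r // mcoeff0 mul0r.
rewrite [in RHS](mpolywE (leqnn (msize p))) raddf_sum /= mulr_sumr.
apply: eq_bigr => t _; rewrite !mcoeffZ !mcoeffX mulrCA; congr (_ * _).
rewrite -natrM mulnb; congr (nat_of_bool _)%:R.
apply/eqP/andP => [/mnmP E|[/eqP -> /eqP ->]].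
  split; apply/eqP.
    by have := E ord_max; rewrite mnmwiden_ordmax mnmE unlift_none.
  apply/mnmP => j; have := E (widen j); rewrite mnmwiden_widen mnmE.
  case: unliftP => [k Ek|/(congr1 val) /= F]; last by have := ltn_ord j; rewrite F ltnn.
  move=> ->; congr (m _); apply: val_inj; move/(congr1 val): Ek => /=.
  by rewrite /bump leqNgt ltn_ord.
apply/mnmP => j; rewrite mnmE; case: unliftP => [k ->|->].
  have -> : lift ord_max k = widen k.
    by apply: val_inj; rewrite /= /bump leqNgt ltn_ord.
  by rewrite mnmwiden_widen.
by rewrite mnmwiden_ordmax.
Qed.

Lemma muni_surj n (q : {poly mpoly n K}) : exists p, muni p = q.
Proof.
elim/poly_ind: q => [|q c [p <-]]; first by exists 0; rewrite muni0.
exists (p * mpolyX K (mnm1 ord_max) + mwiden c).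
rewrite muniD muniM muni_mwiden; congr (_ * _ + _).
rewrite muniE msuppX big_seq1 mcoeffX eqxx scale1r mnm1E eqxx expr1.
rewrite -[RHS]scale1r; congr (_ *: _); rewrite -mpolyX0; congr (mpolyX K _).
apply/mnmP => j; rewrite !mnmE; case: eqP => // /(congr1 val) /= F.
by have := ltn_ord j; rewrite -F ltnn.
Qed.

Lemma factorial_mpoly n : factorial_ring (mpoly n K).
Proof.
elim: n => [|n IH].
  move=> p p0; exists p; last by exists [::]; rewrite ?big_nil ?mulr1.
  have E : p = mpolyC 0 (mcoeff mnm0 p).
    apply/mpolyP => m; rewrite mcoeffC; have -> : m = mnm0 by apply/mnmP; case.
    by rewrite eqxx mulr1.
  by apply/mpoly_unitP; exists (mcoeff mnm0 p) => //; rewrite -(mpolyC_eq0 0) -E.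
exact: (@factorial_transfer _ _ (@muni n K) (@muni_inj n) (@muni_surj n) (factorial_poly IH)).
Qed.

End MpolyFactorial.

(** * Multidegrees *)

Section Multidegree.
Context {R : realType} {l : nat}.
Local Notation K := (Cplx R).
Local Notation mp := (mpoly l (Cplx R)).
Implicit Types (f g h p q : mp) (m n : multinom l).

Definition degle f n := forall a, mcoeff a f != 0 -> forall i, (a i <= n i)%N.

Lemma multidegE f i : multideg f i = (\max_(a <- msupp f) a i)%N.
Proof. by rewrite mnmE. Qed.

Lemma degle_multideg f : degle f (multideg f).
Proof.
move=> a; rewrite -mcoeff_msupp => af i; rewrite multidegE.
by rewrite (big_rem a af) /= leq_maxl.
Qed.

Lemma multideg_attained f i : f != 0 ->
  exists2 a, mcoeff a f != 0 & a i = multideg f i.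
Proof.
rewrite -msupp_eq0 multidegE => f0.
have : (0 < size (msupp f))%N by case: (msupp f) f0.
suff H (s : seq (multinom l)) : (0 < size s)%N -> exists2 a, a \in s & a i = (\max_(a <- s) a i)%N.
  by move=> /H[a ? ?]; exists a => //; rewrite -mcoeff_msupp.
elim: s => // a [|b s] IH _; first by exists a; rewrite ?mem_head // big_seq1.
have [//|c cs ci] := IH; rewrite big_cons -ci; case: (leqP (c i) (a i)) => H.
  by exists a; rewrite ?mem_head.
by exists c => //; rewrite inE cs orbT.
Qed.

Lemma multideg_le f n : degle f n -> forall i, (multideg f i <= n i)%N.
Proof.
move=> H i; have [->|f0] := eqVneq f 0; last first.
  by have [a /H ? <-] := multideg_attained i f0.
by rewrite multidegE msupp0 big_nil.
Qed.

(** Replacing x_i by x_i t is a ring morphism into the univariate polynomials in t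
    over an integral domain, where degrees add; the degree in t of the image of f
    is the degree of f in x_i. *)
Let var_split (i j : 'I_l) : {poly mp} := (mpolyX K (mnm1 j))%:P * 'X^(j == i).

Let split_poly i : mp -> {poly mp} :=
  mmap (polyC \o @mpolyC l K) (var_split i).

Let split_polyE i f :
  split_poly i f = \sum_(a <- msupp f) (mcoeff a f *: mpolyX K a) *: 'X^(a i).
Proof.
rewrite /split_poly /mmap; apply: eq_bigr => a _.
have -> : mmap1 (var_split i) a = mpolyX K a *: 'X^(a i).
  rewrite /mmap1 /var_split.
  under eq_bigr do rewrite exprMn -exprM -rmorphXn.
  rewrite big_split /= -rmorph_prod /= -mul_polyC; congr (_%:P * _).
    by rewrite [RHS]mpolyXE_id.
  by rewrite prodrXr (bigD1 i) //= eqxx mul1n big1 ?addn0 // => j /negPf->.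
by rewrite -!mul_polyC mulrA -polyCM mul_mpolyC.
Qed.

Let split_polyM i f g : split_poly i (f * g) = split_poly i f * split_poly i g.
Proof. exact: rmorphM. Qed.

Let size_split i f : f != 0 -> size (split_poly i f) = (multideg f i).+1.
Proof.
move=> f0; have cE k a : mcoeff a (split_poly i f)`_k = mcoeff a f * (a i == k)%:R.
  rewrite split_polyE coef_sum raddf_sum /=.
  rewrite [in RHS](mpolyE f) raddf_sum /= mulr_suml; apply: eq_bigr => b _.
  rewrite coefZ coefXn mulrC !mcoeffZ !mcoeffX.
  have [->|] := eqVneq b a.
    rewrite [k == _]eq_sym; case: eqP => _; last by rewrite mul0r mcoeff0 mulr0.
    by rewrite mul1r mcoeffZ mcoeffX eqxx !mulr1.
  move=> /negPf ba; rewrite !mulr0 mul0r.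
  by case: eqP => _; rewrite ?mul1r ?mul0r ?mcoeff0 // mcoeffZ mcoeffX ba mulr0.
apply/eqP; rewrite eqn_leq; apply/andP; split.
  apply/leq_sizeP => k lt; apply/mpolyP => a; rewrite cE mcoeff0.
  have [E|/eqP ne] := eqP; last by rewrite mulr0.
  rewrite mulr1; apply/eqP/negPn/negP => /degle_multideg/(_ i).
  by rewrite E; lia.
have [a af ai] := multideg_attained i f0.
rewrite ltnNge; apply/negP => /leq_sizeP/(_ _ (leqnn _))/mpolyP/(_ a)/eqP.
by rewrite cE ai eqxx mulr1 mcoeff0 (negPf af).
Qed.

Let split_morphism i : exists phi : mp -> {poly mp},
  (forall f g, phi (f * g) = phi f * phi g) /\
  (forall f, f != 0 -> size (phi f) = (multideg f i).+1).
Proof. by exists (split_poly i); split; [exact: split_polyM | exact: size_split]. Qed.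

Lemma multidegM f g : f != 0 -> g != 0 ->
  multideg (f * g) = mnm_add (multideg f) (multideg g).
Proof.
move=> f0 g0; apply/mnmP => i; rewrite mnmDE; apply: succn_inj.
have [phi [phiM size_phi]] := split_morphism i.
have nz h : h != 0 -> phi h != 0 by move=> h0; rewrite -size_poly_eq0 size_phi.
rewrite -(size_phi _ (mulf_neq0 f0 g0)) phiM size_mul ?nz //.
by rewrite (size_phi f f0) (size_phi g g0) addnS.
Qed.

Lemma multidegC (c : K) : multideg (mpolyC l c) = mnm0.
Proof.
apply/mnmP => i; rewrite multidegE mnm0E msuppC; case: ifP => _.
  by rewrite big_nil.
by rewrite big_seq1 mnm0E.
Qed.

Lemma multidegZ (c : K) f : c != 0 -> multideg (c *: f) = multideg f.
Proof.
by move=> c0; apply/mnmP => i; rewrite !multidegE (perm_big _ (msuppZ f c0)).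
Qed.

Lemma multidegX f k : f != 0 -> multideg (f ^+ k) = mnm_muln (multideg f) k.
Proof.
move=> f0; elim: k => [|k IH]; first by rewrite expr0 mulm0n -[1]/(mpolyC l 1) multidegC.
by rewrite exprS multidegM ?expf_neq0 // IH mulmS.
Qed.

Lemma multideg_prod (I : Type) (r : seq I) (P : pred I) (F : I -> mp) :
  (forall i, P i -> F i != 0) ->
  multideg (\prod_(i <- r | P i) F i) =
  \big[@mnm_add l/@mnm0 l]_(i <- r | P i) multideg (F i).
Proof.
move=> F0; suff [] : \prod_(i <- r | P i) F i != 0 /\ multideg (\prod_(i <- r | P i) F i) =
  \big[@mnm_add l/@mnm0 l]_(i <- r | P i) multideg (F i) by [].
apply: (big_rec2 (fun x y => x != 0 /\ multideg x = y)).
  by rewrite oner_neq0 -[1]/(mpolyC l 1) multidegC.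
by move=> i x y Pi [x0 <-]; rewrite mulf_neq0 ?F0 // multidegM ?F0.
Qed.

Lemma unit_mpolyP f : f \is a GRing.unit <-> exists2 c : K, c != 0 & f = mpolyC l c.
Proof. by split=> /mpoly_unitP. Qed.

Lemma multideg0_const f : multideg f = mnm0 -> f = mpolyC l (mcoeff mnm0 f).
Proof.
move=> E; apply/mpolyP => a; rewrite mcoeffC; have [->|a0] := eqVneq a mnm0.
  by rewrite mulr1.
rewrite mulr0; apply/eqP/negPn/negP => /degle_multideg H; case/eqP: a0.
by apply/mnmP => i; have := H i; rewrite E !mnm0E; lia.
Qed.

Lemma multideg0_unit f : f != 0 -> multideg f = mnm0 -> f \is a GRing.unit.
Proof.
move=> f0 /multideg0_const E; apply/unit_mpolyP; exists (mcoeff mnm0 f) => //.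
by apply: contraNneq f0 => E0; rewrite E E0 mpolyC0.
Qed.

Lemma irreducible_prime f : irreducible f -> prime_elt f.
Proof. by move=> fI; apply: factorial_irreducible_prime => //; apply: factorial_mpoly. Qed.

Lemma irreducible_neq0 f : irreducible f -> f != 0.
Proof. by case. Qed.

Lemma irreducible_deg_neq0 f : irreducible f -> multideg f != mnm0.
Proof.
by move=> [f0 nU _]; apply: contraNneq nU => /(multideg0_unit f0).
Qed.

Lemma irreducible_mulu f u : u \is a GRing.unit -> irreducible f -> irreducible (u * f).
Proof.
by move=> Uu /irreducible_prime/(prime_mulu Uu)/prime_irreducible.
Qed.

Lemma irreducible_scale f (c : K) : c != 0 -> irreducible f -> irreducible (c *: f).
Proof.
move=> c0; rewrite -mul_mpolyC; apply: irreducible_mulu.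
by apply/unit_mpolyP; exists c.
Qed.

Lemma irreducible_divides f g : irreducible f -> irreducible g ->
  divides f g -> exists2 c : K, c != 0 & g = c *: f.
Proof.
move=> [f0 nU _] [g0 _ gI] [h E]; have [/unit_mpolyP[c c0 Eh]|] := gI _ _ E.
  by exists c; rewrite // E Eh mul_mpolyC.
by rewrite (negPf nU).
Qed.

Lemma coprime_irreducible f g : irreducible f -> irreducible g ->
  coprime_mpoly f g <-> ~ divides f g.
Proof.
move=> fI gI; split=> [cop fg|nfg d [a Ea] [b Eb]].
  have := cop f (divides_refl f) fg.
  by case: fI => _ /negPf ->.
have [_ _ fI'] := fI; have [Ua|//] := fI' _ _ Ea; case: nfg.
exists (b / a); rewrite Eb Ea -mulrA mulKr //.
Qed.

End Multidegree.

(** * Counting the parameters of a factorization structure *)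

Section Dimension.
Context {l : nat}.
Implicit Types (a b m n : multinom l).

Local Open Scope nat_scope.

Lemma dimPE n : dimP n = \prod_(i < l) (n i).+1.
Proof.
rewrite /dimP /box card_dep_ffun foldrE big_map big_enum /=.
by apply: eq_bigr => i _; rewrite card_ord.
Qed.

Lemma dimP_gt0 n : 0 < dimP n.
Proof. by rewrite dimPE prodn_gt0. Qed.

(** The dimension of the projective space of polynomials of degree at most n,
    that is, the number of parameters of a factor up to scaling. *)
Definition projdim n := (dimP n).-1.

Lemma dimP_projdim n : dimP n = (projdim n).+1.
Proof. by rewrite /projdim prednK ?dimP_gt0. Qed.

Lemma projdim_gt0 n : n != mnm0 -> 0 < projdim n.
Proof.
move=> n0; have [i ni] : exists i, 0 < n i.
  apply: contrapT => /forallNP H; case/eqP: n0; apply/mnmP => i; rewrite mnm0E.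
  by apply/eqP; rewrite -leqn0 leqNgt; apply/negP/H.
rewrite /projdim -ltnS prednK ?dimP_gt0 // dimPE (bigD1 i) //=.
have : 0 < \prod_(j < l | j != i) (n j).+1 by rewrite prodn_cond_gt0.
by move: (n i) (\prod_(_ | _) _) ni => x y; nia.
Qed.

(** The induction step over the variables for the superadditivity of
    [projdim]. *)
Let box_step p q x y z : 0 < x -> 0 < y -> x + y <= z.+1 ->
  p.+1 * x + q.+1 * y <= ((p + q).+1 * z).+1.
Proof.
case: x y => [//|x] [//|y] _ _ H.
have {}H : (p + q).+1 * (x + y).+1 <= (p + q).+1 * z by rewrite leq_mul2l; lia.
nia.
Qed.

Let boxprod_super (P : pred 'I_l) a b :
  \prod_(i | P i) (a i).+1 + \prod_(i | P i) (b i).+1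
  <= (\prod_(i | P i) (a i + b i).+1).+1.
Proof.
suff [] : [/\ 0 < \prod_(i | P i) (a i).+1, 0 < \prod_(i | P i) (b i).+1 &
  \prod_(i | P i) (a i).+1 + \prod_(i | P i) (b i).+1
  <= (\prod_(i | P i) (a i + b i).+1).+1] by [].
apply: (big_rec3 (fun x y z : nat => [/\ 0 < x, 0 < y & x + y <= z.+1])) => //.
by move=> i x y z _ [x0 y0 H]; split; rewrite ?muln_gt0 // box_step.
Qed.

Lemma projdimD a b : projdim a + projdim b <= projdim (mnm_add a b).
Proof.
have := boxprod_super xpredT a b.
have -> : \prod_i (a i + b i).+1 = dimP (mnm_add a b).
  by rewrite dimPE; apply: eq_bigr => i _; rewrite mnmDE.
by rewrite -!dimPE !dimP_projdim; lia.
Qed.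

(** Exactly the case in which the product map on pairs of polynomials of
    degrees a and b loses dimensions. *)
Definition two_directions a b := exists i j, [/\ i != j, 0 < a i & 0 < b j].

Lemma projdimD_lt a b :
  two_directions a b -> projdim a + projdim b < projdim (mnm_add a b).
Proof.
move=> [i [j [ij ai bj]]]; rewrite -(ltn_add2r 2).
have -> : projdim a + projdim b + 2 = dimP a + dimP b by rewrite !dimP_projdim; lia.
have -> : projdim (mnm_add a b) + 2 = (dimP (mnm_add a b)).+1 by rewrite dimP_projdim; lia.
have split2 n : dimP n = (n j).+1 * ((n i).+1 * \prod_(k | (k != j) && (k != i)) (n k).+1).
  by rewrite dimPE (bigD1 j) //= (bigD1 i).
rewrite !split2 !mnmDE.
have := boxprod_super (fun k => (k != j) && (k != i)) a b.
have -> : \prod_(k | (k != j) && (k != i)) (a k + b k).+1 =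
          \prod_(k | (k != j) && (k != i)) (mnm_add a b k).+1.
  by apply: eq_bigr => k _; rewrite mnmDE.
have pos n : 0 < \prod_(k | (k != j) && (k != i)) (n k : nat).+1 by rewrite prodn_cond_gt0.
have := pos a; have := pos b.
set x := \prod_(k | _) (a k).+1; set y := \prod_(k | _) (b k).+1.
set z := \prod_(k | _) _; move: x y z => x y z.
move: (a i) (a j) (b i) (b j) ai bj => p q r s p0 s0 y0 x0 H.
have H1 := box_step p r x0 y0 H.
have H2 : 1 < p.+1 * x by nia.
have H3 : 0 < r.+1 * y by nia.
have := leq_mul (leqnn (q + s).+1) H1.
move: (p.+1 * x) (r.+1 * y) H2 H3 => [|[|x']] // [|y'] // _ _; nia.
Qed.

Lemma projdimMn n k : k * projdim n <= projdim (mnm_muln n k).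
Proof.
elim: k => [|k IH]; first by rewrite mul0n.
by rewrite mulSn mulmS; apply: leq_trans (projdimD _ _); rewrite leq_add2l.
Qed.

Lemma projdim_sum (I : Type) (r : seq I) (P : pred I) (F : I -> multinom l) :
  \sum_(i <- r | P i) projdim (F i) <=
  projdim (\big[@mnm_add l/@mnm0 l]_(i <- r | P i) F i).
Proof.
apply: (big_rec2 (fun x y => x <= projdim y)) => // i x y _ H.
by apply: leq_trans (projdimD _ _); rewrite leq_add2l.
Qed.

Lemma projdim_comb (I : Type) (r : seq I) (P : pred I) (F : I -> multinom l) (c : I -> nat) :
  \sum_(i <- r | P i) c i * projdim (F i) <=
  projdim (\big[@mnm_add l/@mnm0 l]_(i <- r | P i) mnm_muln (F i) (c i)).
Proof. by apply: leq_trans (projdim_sum _ _ _); apply: leq_sum => i _; apply: projdimMn. Qed.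

(** The property of degrees of irreducible polynomials on which all strict
    inequalities rest: it excludes the multiples, other than a single variable, of
    one variable. *)
Definition no_univariate_split m := forall a b, a != mnm0 -> b != mnm0 ->
  m = mnm_add a b -> two_directions a b.

Lemma mnm_add_eq0 a b : (mnm_add a b == mnm0) = (a == mnm0) && (b == mnm0).
Proof.
apply/eqP/andP => [/mnmP E|[/eqP -> /eqP ->]]; last by apply/mnmP => i; rewrite mnmDE !mnm0E.
by split; apply/eqP/mnmP => i; have := E i; rewrite mnmDE !mnm0E; lia.
Qed.

Lemma mnm_big_neq0 (I : finType) (F : I -> multinom l) i :
  F i != mnm0 -> \big[@mnm_add l/@mnm0 l]_j F j != mnm0.
Proof. by move=> Fi; rewrite (bigD1 i) //= mnm_add_eq0 negb_and Fi. Qed.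

(** Two or more factors, with repetition, have strictly fewer parameters than
    their product: set one factor aside and use the strict inequality for it and the
    product of the others. *)
Lemma projdim_comb_lt (I : finType) (F : I -> multinom l) (c : I -> nat) :
  (forall i, F i != mnm0) ->
  no_univariate_split (\big[@mnm_add l/@mnm0 l]_i mnm_muln (F i) (c i)) ->
  1 < \sum_i c i ->
  \sum_i c i * projdim (F i) <
  projdim (\big[@mnm_add l/@mnm0 l]_i mnm_muln (F i) (c i)).
Proof.
move=> F0 ind c2.
have [i ci] : exists i, 0 < c i.
  apply: contrapT => /forallNP H; move: c2; rewrite big1 // => i _.
  by apply/eqP; rewrite -leqn0 leqNgt; apply/negP/H.
pose c' j := c j - (j == i).
have cE j : c j = (j == i) + c' j by rewrite /c'; case: eqP => [->|]; lia.
have sE : \big[@mnm_add l/@mnm0 l]_j mnm_muln (F j) (c j) =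
    mnm_add (F i) (\big[@mnm_add l/@mnm0 l]_j mnm_muln (F j) (c' j)).
  apply/mnmP => k; rewrite mnmDE !mnm_sumE.
  rewrite [in RHS](bigD1 i) //= (bigD1 i) //= !mulmnE (cE i) eqxx mulnDr muln1 addnA.
  by congr addn; apply: eq_bigr => j /negPf ji; rewrite !mulmnE (cE j) ji.
have sE' : \sum_j c j * projdim (F j) = projdim (F i) + \sum_j c' j * projdim (F j).
  rewrite (bigD1 i) //= [in RHS](bigD1 i) //= (cE i) eqxx mulnDl mul1n addnA.
  by congr addn; apply: eq_bigr => j /negPf ji; rewrite (cE j) ji.
have [k ck] : exists k, 0 < c' k.
  apply: contrapT => /forallNP H; move: c2.
  under eq_bigr do rewrite cE; rewrite big_split /=.
  rewrite (bigD1 i) //= eqxx big1 => [|j /negPf ->//].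
  rewrite big1 // => j _; apply/eqP; rewrite -leqn0 leqNgt; exact/negP/H.
have r0 : \big[@mnm_add l/@mnm0 l]_j mnm_muln (F j) (c' j) != mnm0.
  apply: (@mnm_big_neq0 _ _ k); apply: contraNneq (F0 k) => /mnmP E.
  by apply/eqP/mnmP => x; have := E x; rewrite mulmnE mnm0E; nia.
rewrite sE'.
  apply: leq_ltn_trans (_ : projdim (F i) + projdim (\big[@mnm_add l/@mnm0 l]_j mnm_muln (F j) (c' j)) < _).
  by rewrite leq_add2l projdim_comb.
by rewrite [in X in _ < X]sE; apply: projdimD_lt; apply: ind => //.
Qed.

End Dimension.

Section Refinement.
Context {l : nat}.
Implicit Types (M N : fproduct l).
Local Open Scope nat_scope.

Definition fdeg M (j : 'I_(size M)) : multinom l := (tnth (in_tuple M) j).1.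
Definition fmul M (j : 'I_(size M)) : nat := (tnth (in_tuple M) j).2.

(** What remains of being realized by a polynomial in the combinatorial
    arguments. *)
Definition admissible M := forall j : 'I_(size M), 0 < fmul j /\ fdeg j != mnm0.

(** The dimension of the stratum of M: one parameter for the scalar, and those
    of each factor up to scaling. *)
Definition fparam M := (\sum_(j < size M) projdim (fdeg j)).+1.

(** The matrix of exponents when the factors of a product over M are written in
    terms of the irreducible factors of a polynomial with structure N. *)
Definition refinement N M (c : 'I_(size N) -> 'I_(size M) -> nat) : Prop :=
  (forall i, fmul i = \sum_j c i j * fmul j) /\
  (forall j, fdeg j = \big[@mnm_add l/@mnm0 l]_i mnm_muln (fdeg i) (c i j)).

Arguments refinement : clear implicits.

Lemma degFE M : degF M = \big[@mnm_add l/@mnm0 l]_(j < size M) mnm_muln (fdeg j) (fmul j).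
Proof. by rewrite /degF big_tnth. Qed.

(** Every row of c has a nonzero entry because the multiplicities of N are
    positive, and a column sums up factors of a single component of M. *)
Lemma refinement_fparam N M c : admissible N -> refinement N M c ->
  (fparam N <= fparam M)%N.
Proof.
move=> Np [cN cM]; rewrite ltnS.
apply: (@leq_trans (\sum_i \sum_j c i j * projdim (fdeg i))).
  apply: leq_sum => i _; rewrite -big_distrl /= leq_pmull //.
  have [k0 _] := Np i; move: k0; rewrite cN !lt0n.
  apply: contraNneq => s0; rewrite big1 // => j _.
    by move/eqP: s0; rewrite sum_nat_eq0 => /forallP/(_ j)/eqP ->.
rewrite exchange_big; apply: leq_sum => j _.
by rewrite cM projdim_comb.
Qed.

(** Equality of the parameter counts makes every inequality used in
    [refinement_fparam] an equality: rows then sum to 1, and columns have at most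
    one nonzero entry by the strict form of superadditivity. *)
Lemma refinement_rigid N M c : admissible N -> admissible M ->
  (forall j : 'I_(size M), no_univariate_split (fdeg j)) ->
  refinement N M c -> fparam N = fparam M ->
  exists s : 'I_(size M) -> 'I_(size N),
    [/\ bijective s, forall i j, c i j = (i == s j),
      forall j, fdeg j = fdeg (s j) & forall j, fmul j = fmul (s j)].
Proof.
move=> Np Mp Mi [cN cM] [E].
have row_ge1 i : 0 < \sum_j c i j.
  have [k0 _] := Np i; move: k0; rewrite cN !lt0n.
  apply: contraNneq => s0; rewrite big1 // => j _.
    by move/eqP: s0; rewrite sum_nat_eq0 => /forallP/(_ j)/eqP ->.
have le1 i : projdim (fdeg i) <= \sum_j c i j * projdim (fdeg i)
    ?= iff (projdim (fdeg i) == \sum_j c i j * projdim (fdeg i)).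
  by split=> //; rewrite -big_distrl /= leq_pmull.
have le2 j : \sum_i c i j * projdim (fdeg i) <= projdim (fdeg j)
    ?= iff (\sum_i c i j * projdim (fdeg i) == projdim (fdeg j)).
  by split=> //; rewrite cM projdim_comb.
have [L1 EL1] := leqif_sum (P := xpredT) (fun i _ => le1 i).
have [L2 EL2] := leqif_sum (P := xpredT) (fun j _ => le2 j).
rewrite exchange_big /= in L2 EL2.
have F1 : \sum_(i < size N) projdim (fdeg i) == \sum_i \sum_j c i j * projdim (fdeg i).
  by apply/eqP/anti_leq; rewrite L1 E L2.
have F2 : \sum_i \sum_j c i j * projdim (fdeg i) == \sum_(j < size M) projdim (fdeg j).
  by apply/eqP/anti_leq; rewrite L2 -E L1.
have row1 i : \sum_j c i j = 1.
  move: F1; rewrite EL1 => /forallP/(_ i)/eqP; rewrite -big_distrl /=.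
  have := projdim_gt0 (Np i).2; nia.
have col_le j : \sum_i c i j <= 1.
  rewrite leqNgt; apply/negP => H; move: F2; rewrite EL2 => /forallP/(_ j)/eqP.
  have := @projdim_comb_lt _ _ (fun i => fdeg i) (fun i => c i j) (fun i => (Np i).2).
  by rewrite -cM => /(_ (Mi j) H) /= lt eq; move: lt; rewrite eq ltnn.
have col_ex j : exists i, 0 < c i j.
  apply: contrapT => /forallNP H; have [_] := Mp j; rewrite cM; case/eqP.
  apply: big1 => i _; have -> : c i j = 0 by apply/eqP; rewrite -leqn0 leqNgt; apply/negP/H.
  by [].
have [s sP] := choice col_ex.
have cE i j : c i j = (i == s j).
  have := col_le j; rewrite (bigD1 (s j)) //=.
  have [->|ne] := eqVneq i (s j); first by have := sP j; lia.
  by rewrite (bigD1 i) //=; have := sP j; lia.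
have sinj : injective s.
  move=> j j' e; apply/eqP/negPn/negP => ne.
  have := row1 (s j); rewrite (bigD1 j) //= (bigD1 j') 1?eq_sym //= !cE e eqxx; lia.
have sM j : fmul j = fmul (s j).
  rewrite [RHS]cN (bigD1 j) //= cE eqxx mul1n big1 ?addn0 // => k kj.
  by rewrite cE (inj_eq sinj) eq_sym (negPf kj).
exists s; split=> //.
  have ssurj i : exists j, s j = i.
    apply: contrapT => /forallNP H; have := row1 i; rewrite big1 // => j _.
    by rewrite cE; case: eqP => // /esym/H.
  have [t tP] := choice ssurj; exists t => // j; exact/sinj/tP.
move=> j; rewrite cM (bigD1 (s j)) //= cE eqxx big1 => [|i /negPf ne].
  by rewrite mulm1n addm0.
by rewrite cE ne.
Qed.

Lemma perm_eq_reindex N M (s : 'I_(size M) -> 'I_(size N)) : bijective s ->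
  (forall j, fdeg j = fdeg (s j)) -> (forall j, fmul j = fmul (s j)) ->
  perm_eq N M.
Proof.
move=> sb Ed Em.
have E1 : N = [seq tnth (in_tuple N) i | i <- enum 'I_(size N)] by rewrite map_tnth_enum.
have E2 : M = [seq tnth (in_tuple N) i | i <- [seq s j | j <- enum 'I_(size M)]].
  rewrite -map_comp -[LHS](map_tnth_enum (in_tuple M)); apply: eq_map => j /=.
  apply/eqP; rewrite -pair_eqE /=; apply/andP; split; apply/eqP; [exact: Ed|exact: Em].
rewrite E1 E2; apply: perm_map; apply: uniq_perm.
- exact: enum_uniq.
- by rewrite map_inj_uniq ?enum_uniq //; apply: bij_inj.
- move=> i; rewrite mem_enum; apply/esym/mapP; have [t ts st] := sb.
  by exists (t i); rewrite ?mem_enum // st.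
Qed.

End Refinement.
Arguments refinement {l} N M c.

(** * Embedding chains and exact products *)

Section EmbeddingChains.
Context {l : nat}.
Implicit Types (M N L : fproduct l).

Lemma embedded_trans N M L : embedded N M -> embedded M L -> embedded N L.
Proof.
elim=> {N M} [N M NM|N M N' op _ IH] ML; last first.
  exact: EmbeddedStep op (IH ML).
elim: ML N NM => {M L} [M L ML|M L M' op ML _] N NM.
  by apply: EmbeddedRefl; apply: perm_trans ML.
apply: EmbeddedStep ML; case: op => [a b k P H1 H2|a k1 k2 P k10 k20 H1 H2].
  by apply: (DegreeCombining _ H2); apply: perm_trans H1.
by apply: (MultiplicitySplitting k10 k20 _ H2); apply: perm_trans H1.
Qed.

Lemma embedded_perm N M : perm_eq N M -> embedded N M.
Proof. exact: EmbeddedRefl. Qed.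

Lemma embedded_op N M : embed_op N M -> embedded N M.
Proof. by move=> op; apply: EmbeddedStep op _; apply: embedded_perm. Qed.

Lemma embedded_catl L N M : embedded N M -> embedded (L ++ N) (L ++ M).
Proof.
elim=> {N M} [N M NM|N M N' op _ IH]; first by apply: EmbeddedRefl; apply: perm_cat.
apply: EmbeddedStep IH; case: op => [a b k P H1 H2|a k1 k2 P k10 k20 H1 H2].
- apply: (@DegreeCombining _ _ _ a b k (L ++ P)).
  + by rewrite perm_sym (perm_catCA [:: _; _]) perm_cat // perm_sym.
  + by rewrite perm_sym (perm_catCA [:: _]) perm_cat // perm_sym.
- apply: (@MultiplicitySplitting _ _ _ a k1 k2 (L ++ P)) => //.
  + by rewrite perm_sym (perm_catCA [:: _]) perm_cat // perm_sym.
  + by rewrite perm_sym (perm_catCA [:: _; _]) perm_cat // perm_sym.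
Qed.

Lemma embedded_split a (ks : seq nat) L : ks != [::] -> all (leq 1) ks ->
  embedded ((a, sumn ks) :: L) ([seq (a, k) | k <- ks] ++ L).
Proof.
elim: ks L => [//|k [|k' ks] IH] L _ /=.
  by rewrite addn0 => _; apply: embedded_perm.
move=> /andP[k0 /andP[k'0 ks0]].
apply: embedded_trans (_ : embedded ((a, k) :: (a, sumn (k' :: ks)) :: L) _).
  apply: embedded_op; apply: (@MultiplicitySplitting _ _ _ a k (sumn (k' :: ks)) L) => //.
  by rewrite /= addn_gt0 k'0.
by apply: (embedded_catl [:: (a, k)]); apply: IH; rewrite //= k'0.
Qed.

Lemma embedded_combine (ns : seq (multinom l)) k L : ns != [::] ->
  embedded ([seq (n, k) | n <- ns] ++ L) ((\big[@mnm_add l/@mnm0 l]_(n <- ns) n, k) :: L).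
Proof.
elim: ns L => [//|n [|n' ns] IH] L _.
  by rewrite big_seq1; apply: embedded_perm.
apply: embedded_trans (_ : embedded ((n, k) :: (\big[@mnm_add l/@mnm0 l]_(n <- n' :: ns) n, k) :: L) _).
  by apply: (embedded_catl [:: (n, k)]); apply: IH.
apply: embedded_op.
apply: (@DegreeCombining _ _ _ n (\big[@mnm_add l/@mnm0 l]_(n <- n' :: ns) n) k L) => //.
by rewrite [in X in perm_eq X _]big_cons.
Qed.

Lemma fproductE M : M = [seq (fdeg j, fmul j) | j <- enum 'I_(size M)].
Proof.
rewrite -[LHS](map_tnth_enum (in_tuple M)); apply: eq_map => j.
exact: surjective_pairing.
Qed.

(** First split n_i into c_ij copies of multiplicity k_j for all j, then combine
    the copies with the same j; in between, the same list is read by rows and by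
    columns, which is a permutation. *)
Lemma refinement_embedded N M c : admissible N -> admissible M -> refinement N M c -> embedded N M.
Proof.
move=> Np Mp [cN cM].
pose ks i := flatten [seq nseq (c i j) (fmul j) | j <- enum 'I_(size M)].
pose ns j := flatten [seq nseq (c i j) (fdeg i) | i <- enum 'I_(size N)].
have ks_sum i : sumn (ks i) = fmul i.
  rewrite cN /ks sumn_flatten sumnE 2!big_map big_enum /=.
  by apply: eq_bigr => j _; rewrite sumn_nseq mulnC.
have ks_pos i : all (leq 1) (ks i).
  apply/allP => k /flattenP[_ /mapP[j _ ->]] /nseqP[-> _].
  by have [] := Mp j.
have ks_nil i : ks i != [::].
  by have [k0 _] := Np i; apply: contraTneq k0 => E; rewrite -ks_sum E.
have ns_sum j : \big[@mnm_add l/@mnm0 l]_(n <- ns j) n = fdeg j.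
  rewrite cM /ns big_flatten /= big_map big_enum /=.
  apply: eq_bigr => i _; elim: (c i j) => [|k IH]; first by rewrite big_nil.
  by rewrite /= big_cons IH mulmS.
have ns_nil j : ns j != [::].
  by have [_ n0] := Mp j; apply: contraNneq n0 => E; rewrite -ns_sum E big_nil.
have step1 (r : seq 'I_(size N)) :
    embedded [seq (fdeg i, fmul i) | i <- r]
             (flatten [seq [seq (fdeg i, k) | k <- ks i] | i <- r]).
  elim: r => [|i r IH]; first exact: embedded_perm.
  rewrite /= -[in X in embedded X _]ks_sum.
  by apply: embedded_trans (embedded_split _ _ _ _) (embedded_catl _ IH).
have step2 (r : seq 'I_(size M)) :
    embedded (flatten [seq [seq (n, fmul j) | n <- ns j] | j <- r])
             [seq (fdeg j, fmul j) | j <- r].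
  elim: r => [|j r IH]; first exact: embedded_perm.
  rewrite /= -[in X in embedded _ X]ns_sum.
  apply: embedded_trans (embedded_catl _ IH) _.
  exact: embedded_combine.
rewrite [N]fproductE [M]fproductE.
apply: embedded_trans (step1 _) _; apply: embedded_trans _ (step2 _).
apply: embedded_perm; apply/permP => P.
have countE (I : Type) (T : Type) (Q : pred T) (r : seq I) (F : I -> seq T) :
    count Q (flatten [seq F i | i <- r]) = (\sum_(i <- r) count Q (F i))%N.
  by rewrite count_flatten sumnE !big_map.
rewrite !countE !big_enum /=.
under eq_bigr => i _.
  rewrite count_map countE big_enum /=.
  under eq_bigr do rewrite count_nseq /=.
  over.
under [RHS]eq_bigr => i _.
  rewrite count_map countE big_enum /=.
  under eq_bigr do rewrite count_nseq /=.
  over.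
by rewrite exchange_big.
Qed.

End EmbeddingChains.

(** A permutation of the image list is induced by a permutation of the list. *)
Lemma perm_map_lift (S T : eqType) (F : S -> T) s t :
  perm_eq (map F s) t -> exists2 s', perm_eq s s' & map F s' = t.
Proof.
case: s => [|x0 s].
  by rewrite perm_sym => /perm_nilP ->; exists [::].
rewrite perm_sym => /(perm_iotaP (F x0))[Is PI ->].
exists [seq nth x0 (x0 :: s) i | i <- Is].
  by rewrite perm_sym; apply/(perm_iotaP x0); exists Is => //; move: PI; rewrite size_map.
rewrite -map_comp; apply/eq_in_map => i; rewrite (perm_mem PI) mem_iota size_map => /= H.
by rewrite -(nth_map x0 (F x0) F).
Qed.

Section ExactProducts.
Context {R : realType} {l : nat}.
Local Notation K := (Cplx R).
Local Notation mp := (mpoly l (Cplx R)).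
Implicit Types (M N L : fproduct l) (f : mp).

(** The relaxation of the stratum of M that drops irreducibility and coprimality
    of the factors; it turns out to be the closure of the stratum.  The factors are
    listed up to permutation, as the components of M are. *)
Definition exact_product M f := exists (alpha : K) (s : seq (mp * nat)),
  [/\ alpha != 0, {in s, forall x, x.1 != 0},
      perm_eq [seq (multideg x.1, x.2) | x <- s] M
    & f = alpha *: \prod_(x <- s) x.1 ^+ x.2].

(** Degree combining multiplies two factors with the same exponent, and
    multiplicity splitting repeats a factor. *)
Lemma exact_product_embed N M f : embedded N M -> exact_product N f -> exact_product M f.
Proof.
elim=> {N M} [N M NM|N M N' op _ IH] [al [s [al0 s0 sN Ef]]].
  by exists al, s; split=> //; apply: perm_trans NM.
apply: IH; case: op => [a b k L H1 H2|a k1 k2 L k10 k20 H1 H2].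
- have [[|x [|y t]] // st [Ea Ek Eb Ek' EL]] := perm_map_lift (perm_trans sN H1).
  have s0' z : z \in [:: x, y & t] -> z.1 != 0 by rewrite -(perm_mem st); apply: s0.
  have x0 : x.1 != 0 by apply: s0'; rewrite mem_head.
  have y0 : y.1 != 0 by apply: s0'; rewrite !inE eqxx orbT.
  exists al, ((x.1 * y.1, k) :: t); split=> //.
  + move=> z; rewrite inE => /predU1P[->|zt]; first by rewrite mulf_neq0.
    by apply: s0'; rewrite !inE zt !orbT.
  + by rewrite /= multidegM // Ea Eb EL perm_sym.
  + by rewrite Ef (perm_big _ st) !big_cons /= Ek Ek' exprMn mulrA.
- have [[|x t] // st [Ea Ek EL]] := perm_map_lift (perm_trans sN H1).
  have s0' z : z \in x :: t -> z.1 != 0 by rewrite -(perm_mem st); apply: s0.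
  exists al, ((x.1, k1) :: (x.1, k2) :: t); split=> //.
  + move=> z; rewrite !inE => /predU1P[->|/predU1P[->|zt]]; last 1 first.
    * by apply: s0'; rewrite !inE zt !orbT.
    * by apply: (s0' x); rewrite mem_head.
    * by apply: (s0' x); rewrite mem_head.
  + by rewrite /= Ea EL perm_sym.
  + by rewrite Ef (perm_big _ st) !big_cons /= Ek exprD mulrA.
Qed.

Lemma exact_productP M f : exact_product M f <->
  exists (alpha : K) (h : 'I_(size M) -> mp),
  [/\ alpha != 0, forall j, h j != 0, forall j, multideg (h j) = fdeg j
    & f = alpha *: \prod_j h j ^+ fmul j].
Proof.
split=> [[al [s [al0 s0 sM Ef]]]|[al [h [al0 h0 hM Ef]]]].
- have [t st Et] := perm_map_lift sM.
  have szt : size t = size M by rewrite -Et size_map.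
  have tE (j : 'I_(size M)) : tnth (in_tuple M) j =
      (multideg (nth (0, 0%N) t j).1, (nth (0, 0%N) t j).2).
    rewrite (tnth_nth (mnm0, 0%N)) /=; have := ltn_ord j; move: (nat_of_ord j) => k.
    by rewrite -szt -Et => kt; rewrite (nth_map (0, 0%N)).
  exists al, (fun j => (nth (0, 0%N) t j).1); split=> //.
  + by move=> j; apply: s0; rewrite (perm_mem st) mem_nth // szt.
  + by move=> j; rewrite /fdeg tE.
  + rewrite Ef (perm_big _ st) (big_nth (0, 0%N)) szt big_mkord.
    by congr (_ *: _); apply: eq_bigr => j _; rewrite /fmul tE.
- exists al, [seq (h j, fmul j) | j <- enum 'I_(size M)]; split=> //.
  + by move=> _ /mapP[j _ ->] /=.
  + rewrite -map_comp [in X in perm_eq _ X](fproductE M).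
    by rewrite (eq_map (g := fun j => (fdeg j, fmul j))) // => j /=; rewrite hM.
  + by rewrite big_map big_enum.
Qed.

Lemma factstruct_admissible M : is_factstruct R M -> admissible M.
Proof.
move=> [g [al [h [g0 al0 k0 [hI _ _]]]]] j; split; first exact: k0.
have [hj E] := hI j; rewrite /fdeg -E; exact: irreducible_deg_neq0.
Qed.

End ExactProducts.

Section PrimeExponents.
Variable D : idomainType.

Lemma divisor_prime_prod n (f : 'I_n -> D) (a : 'I_n -> nat) u h :
  (forall i, prime_elt (f i)) -> u \is a GRing.unit ->
  divides h (u * \prod_i f i ^+ a i) ->
  exists2 v, v \is a GRing.unit & exists c, h = v * \prod_i f i ^+ c i.
Proof.
move=> fP Uu [g]; have [N] := ubnP (\sum_i a i).
elim: N => // N IH in a g h *; rewrite ltnS => aN E.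
have [a0|] := pselect (forall i, a i = 0%N).
  exists h; last by exists (fun=> 0%N); rewrite big1 ?mulr1 // => i _; rewrite expr0.
  apply: (divides_unit Uu); exists g.
  by rewrite -E big1 ?mulr1 // => i _; rewrite a0 expr0.
move=> /existsNP[i /eqP]; rewrite -lt0n => ai.
pose a' j := (a j - (j == i))%N.
have aE j : a j = ((j == i) + a' j)%N by rewrite /a'; case: eqP => [->|]; lia.
have prodE : \prod_j f j ^+ a j = f i * \prod_j f j ^+ a' j.
  under eq_bigr do rewrite aE exprD.
  rewrite big_split /=; congr (_ * _).
  by rewrite (bigD1 i) //= eqxx expr1 big1 ?mulr1 // => j /negPf ->.
have sumE : (\sum_j a j = (\sum_j a' j).+1)%N.
  under eq_bigr do rewrite aE.
  by rewrite big_split /= (bigD1 i) //= eqxx big1 ?addn0 // => j /negPf ->.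
have a'N : (\sum_j a' j < N)%N by rewrite -sumE.
have [f0 _ fi] := fP i.
have : divides (f i) (g * h).
  by rewrite -E prodE mulrCA; apply: divides_mulr; apply: divides_refl.
case/fi => -[x Ex].
- apply: (IH a' x) => //; apply: (mulfI f0).
  by rewrite mulrCA -prodE E Ex; ring.
- have [|v Uv [c Ec]] := IH a' g x a'N.
    by apply: (mulfI f0); rewrite mulrCA -prodE E Ex; ring.
  exists v => //; exists (fun j => (j == i) + c j)%N; rewrite Ex Ec.
  under [in RHS]eq_bigr do rewrite exprD.
  rewrite big_split /= [X in _ = v * (X * _)](bigD1 i) //= eqxx expr1.
  rewrite [X in f i * X]big1 => [|j /negPf ->//]; ring.
Qed.

Lemma prime_prod_exp_inj n (f : 'I_n -> D) (a b : 'I_n -> nat) u v :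
  (forall i, prime_elt (f i)) -> (forall i j, i != j -> ~ divides (f i) (f j)) ->
  u \is a GRing.unit -> v \is a GRing.unit ->
  u * \prod_i f i ^+ a i = v * \prod_i f i ^+ b i -> a =1 b.
Proof.
move=> fP fN; have H (c d : 'I_n -> nat) x y : x \is a GRing.unit -> y \is a GRing.unit ->
    x * \prod_i f i ^+ c i = y * \prod_i f i ^+ d i -> forall i, (c i <= d i)%N.
  move=> Ux Uy E i; rewrite leqNgt; apply/negP => lt; have [f0 nU fi] := fP i.
  have [w Ew] : divides (f i) (y * \prod_(j | j != i) f j ^+ d j).
    exists (x * \prod_(j | j != i) f j ^+ c j * f i ^+ (c i - d i).-1).
    apply: (@mulfI _ (f i ^+ d i)); first by rewrite expf_neq0.
    have split e : \prod_j f j ^+ e j = f i ^+ e i * \prod_(j | j != i) f j ^+ e j.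
      by rewrite (bigD1 i).
    rewrite mulrCA -split -E split.
    have -> : c i = ((c i - d i).-1.+1 + d i)%N by lia.
    by rewrite addnK exprD exprS; ring.
  have : divides (f i) (y * \prod_(j | j != i) f j ^+ d j) by exists w.
  case/fi => [/(divides_unit Uy)|]; first by rewrite (negPf nU).
  rewrite -big_filter => /(prime_divides_prod (fP i))[j].
  rewrite mem_filter => /andP[ji _] /(prime_divides_exp (fP i)).
  by apply: fN; rewrite eq_sym.
move=> Uu Uv E i; apply/eqP; rewrite eqn_leq.
by rewrite (H _ _ _ _ Uu Uv E) (H _ _ _ _ Uv Uu (esym E)).
Qed.

End PrimeExponents.

(** * Comparing an exact product with the irreducible factorization *)

Section Factorizations.
Context {R : realType} {l : nat}.
Local Notation K := (Cplx R).
Local Notation mp := (mpoly l (Cplx R)).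
Implicit Types (M N L : fproduct l) (f g h : mp).

Lemma mpolyC_unit (c : K) : c != 0 -> mpolyC l c \is a GRing.unit.
Proof. by move=> c0; apply/unit_mpolyP; exists c. Qed.

Lemma mpolyC_prod (I : finType) (c : I -> K) (e : I -> nat) :
  \prod_i mpolyC l (c i) ^+ e i = mpolyC l (\prod_i c i ^+ e i).
Proof. by rewrite rmorph_prod; apply: eq_bigr => i _; rewrite rmorphXn. Qed.

Lemma factorization_prime N f al (g : 'I_(size N) -> mp) : is_factorization (M := N) f al g ->
  forall j, prime_elt (g j).
Proof. by move=> [gI _ _] j; apply: irreducible_prime; have [] := gI j. Qed.

Lemma factorization_coprime N f al (g : 'I_(size N) -> mp) : is_factorization (M := N) f al g ->
  forall i j, i != j -> ~ divides (g i) (g j).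
Proof.
move=> [gI gC _] i j ij; have [gi _] := gI i; have [gj _] := gI j.
by apply/(coprime_irreducible gi gj); apply: gC.
Qed.

(** Each h_j divides f, hence is a scalar times a product of powers of the
    irreducible factors; the equations on the exponents and on the degrees are
    uniqueness of factorization and additivity of the degree. *)
Lemma factorization_refinement N M f al be (g : 'I_(size N) -> mp) (h : 'I_(size M) -> mp) :
  f != 0 -> is_factorization (M := N) f al g ->
  admissible M -> (forall j, h j != 0) -> (forall j, multideg (h j) = fdeg j) ->
  f = be *: \prod_j h j ^+ fmul j ->
  exists c, refinement N M c /\
  exists2 v : 'I_(size M) -> K, forall j, v j != 0
    & forall j, h j = v j *: \prod_i g i ^+ c i j.
Proof.
move=> f0 fg Ma h0 hd Ef; have gP := factorization_prime fg.
have gN := factorization_coprime fg; case: fg => gI _ Eg.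
have al0 : al != 0 by apply: contraNneq f0 => E; rewrite Eg E scale0r.
have be0 : be != 0 by apply: contraNneq f0 => E; rewrite Ef E scale0r.
have hc j : exists vc : K * ('I_(size N) -> nat),
    vc.1 != 0 /\ h j = vc.1 *: \prod_i g i ^+ vc.2 i.
  have : divides (h j) (mpolyC l al * \prod_i g i ^+ fmul i).
    rewrite mul_mpolyC -Eg Ef -mul_mpolyC (bigD1 j) //=.
    apply: divides_mull; apply: divides_mulr; have [k0 _] := Ma j.
    by rewrite -(prednK k0) exprS; apply: divides_mulr; apply: divides_refl.
  move=> /(divisor_prime_prod gP (mpolyC_unit al0))[w /unit_mpolyP[v v0 ->] [c Ec]].
  by exists (v, c); rewrite -mul_mpolyC.
have [vc vcP] := choice hc.
exists (fun i j => (vc j).2 i); split; last first.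
  by exists (fun j => (vc j).1) => j; have [] := vcP j.
split=> [i|j]; last first.
  have [v0 Eh] := vcP j; rewrite -hd Eh multidegZ // multideg_prod => [|i _].
    apply: eq_bigr => i _; have [/irreducible_neq0 gi0 Ei] := gI i.
    by rewrite multidegX // Ei.
  by rewrite expf_neq0 //; have [/irreducible_neq0] := gI i.
pose w := be * \prod_j (vc j).1 ^+ fmul j.
have w0 : w != 0.
  by rewrite mulf_neq0 // prod_exp_neq0 // => j; have [] := vcP j.
suff : (fun i : 'I_(size N) => fmul i) =1 (fun i => \sum_j (vc j).2 i * fmul j)%N by apply.
apply: (prime_prod_exp_inj gP gN (mpolyC_unit al0) (mpolyC_unit w0)).
rewrite mul_mpolyC -Eg Ef -mul_mpolyC /w mpolyCM -mulrA; congr (_ * _).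
rewrite -mpolyC_prod.
under eq_bigr => j _.
  rewrite (vcP j).2 -mul_mpolyC exprMn -prodrXl.
  under [X in _ * X]eq_bigr do rewrite -exprM.
  over.
rewrite big_split /= exchange_big /=; congr (_ * _).
by apply: eq_bigr => k _; rewrite prodrXr.
Qed.

(** If a decomposition of the degree involved a single variable, then so would
    the polynomial itself, and it would have a root and a linear factor. *)
Lemma irreducible_no_univariate_split g : irreducible g -> no_univariate_split (multideg g).
Proof.
move=> gI a b a0 b0 Em; apply: contrapT => H.
have nz (n : multinom l) : n != mnm0 -> exists i, (0 < n i)%N.
  move=> n0; apply: contrapT => /forallNP Hn; case/eqP: n0; apply/mnmP => i.
  by rewrite mnm0E; apply/eqP; rewrite -leqn0 leqNgt; apply/negP/Hn.
have [p ap] := nz a a0; have [q bq] := nz b b0.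
have Epq : p = q by apply/eqP/negPn/negP => pq; apply: H; exists p, q.
have other i : i != p -> multideg g i = 0%N.
  move=> ip; have ai : a i = 0%N.
    apply/eqP; rewrite -leqn0 leqNgt; apply/negP => ai; apply: H.
    by exists i, q; split; rewrite -?Epq // Epq.
  have bi : b i = 0%N.
    apply/eqP; rewrite -leqn0 leqNgt; apply/negP => bi; apply: H.
    by exists p, i; rewrite eq_sym.
  by rewrite Em mnmDE ai bi.
have deg2 : (2 <= multideg g p)%N by rewrite Em mnmDE; move: bq; rewrite -Epq; lia.
have [g0 _ gU] := gI.
pose X : mp := mpolyX K (mnm1 p).
have XE k : X ^+ k = mpolyX K (mnm_muln (mnm1 p) k) by rewrite /X mpolyXn.
pose P := \poly_(k < (multideg g p).+1) mcoeff (mnm_muln (mnm1 p) k) g.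
have mono a' : mcoeff a' g != 0 -> a' = mnm_muln (mnm1 p) (a' p).
  move=> /degle_multideg da; apply/mnmP => i; rewrite mulmnE mnm1E.
  have [->|] := eqVneq p i; first by rewrite mul1n.
  by rewrite eq_sym => /other E; have := da i; rewrite E; lia.
have gE : g = horner_alg X P.
  rewrite /P poly_def raddf_sum /=.
  apply/mpolyP => a'; rewrite raddf_sum /=.
  under eq_bigr => k _.
    rewrite linearZ /= rmorphXn /= horner_algX XE mulr_algl mcoeffZ mcoeffX.
    over.
  have [E|na] := eqVneq (mcoeff a' g) 0.
    rewrite E big1 // => k _; case: eqP => [Ek|_]; last by rewrite mulr0.
    by rewrite Ek E mul0r.
  have lt : (a' p < (multideg g p).+1)%N by rewrite ltnS; apply: degle_multideg.
  rewrite (bigD1 (Ordinal lt)) //= -mono // eqxx mulr1 big1 ?addr0 // => k kne.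
  case: eqP => [Ek|_]; last by rewrite mulr0.
  case/eqP: kne; apply: val_inj; rewrite /= -Ek mulmnE mnm1E eqxx mul1n //.
have sP : size P != 1%N.
  apply/eqP => /eqP/size_poly1P[c c0 Ec].
  have [a' a'g a'p] := multideg_attained p g0.
  move: a'g; rewrite gE Ec horner_algC -mul_mpolyC mulr1 mcoeffC.
  have [E|_] := eqVneq a' mnm0; last by rewrite mulr0 eqxx.
  by move: a'p deg2; rewrite E mnm0E => <-.
have [z] := closed_rootP P sP.
move=> /factor_theorem[Q EQ].
have gQ : g = horner_alg X Q * (X - mpolyC l z).
  rewrite [LHS]gE EQ rmorphM /= rmorphB /= horner_algX horner_algC.
  by rewrite -mul_mpolyC mulr1.
have Xp0 : mnm1 p != mnm0 :> multinom l.
  by apply/eqP => /mnmP/(_ p); rewrite mnm1E eqxx mnm0E.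
have [] := gU _ _ gQ => /unit_mpolyP[c c0 Ec].
  have [a' a'g a'p] := multideg_attained p g0.
  move: a'g; rewrite gQ Ec mcoeffCM mcoeffB mcoeffX mcoeffC.
  have [E|_] := eqVneq (mnm1 p) a'; first by move: a'p deg2; rewrite -E mnm1E eqxx => <-.
  have [E|_] := eqVneq a' mnm0; first by move: a'p deg2; rewrite E mnm0E => <-.
  by rewrite mulr0 subr0 mulr0 eqxx.
have /(congr1 (mcoeff (mnm1 p))) := Ec.
rewrite mcoeffB mcoeffX eqxx !mcoeffC (negPf Xp0) !mulr0 subr0.
by move/eqP; rewrite oner_eq0.
Qed.

Lemma factstruct_no_univariate_split M : is_factstruct R M ->
  forall j : 'I_(size M), no_univariate_split (fdeg j).
Proof.
move=> [g [al [h [_ _ _ [hI _ _]]]]] j; have [/irreducible_no_univariate_split] := hI j.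
by move=> + E; rewrite E.
Qed.

Lemma factset_exact M f : factset R M f -> exact_product M f.
Proof.
move=> [f0 _ [al [g [gI _ Ef]]]]; apply/exact_productP; exists al, g; split=> //.
- by apply: contraNneq f0 => E; rewrite Ef E scale0r.
- by move=> j; apply: irreducible_neq0; have [] := gI j.
- by move=> j; have [] := gI j.
Qed.

Lemma factset_factstruct M f : admissible M -> factset R M f -> is_factstruct R M.
Proof.
move=> Ma [f0 _ [al [g fg]]]; exists f, al, g; split=> //.
  by case: fg => _ _ Ef; apply: contraNneq f0 => E; rewrite Ef E scale0r.
by move=> j; have [] := Ma j.
Qed.

(** The key to openness, local surjectivity and strictness: products with as many
    parameters as the irreducible factorization are that factorization up to order
    and scalars. *)
Lemma factorization_rigid N M f al be (g : 'I_(size N) -> mp) (h : 'I_(size M) -> mp) :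
  f != 0 -> admissible N -> is_factorization (M := N) f al g ->
  admissible M -> (forall j : 'I_(size M), no_univariate_split (fdeg j)) ->
  (forall j, h j != 0) -> (forall j, multideg (h j) = fdeg j) ->
  f = be *: \prod_j h j ^+ fmul j -> fparam N = fparam M ->
  exists s : 'I_(size M) -> 'I_(size N),
  [/\ bijective s, forall j, fdeg j = fdeg (s j), forall j, fmul j = fmul (s j)
    & exists2 v : 'I_(size M) -> K, forall j, v j != 0 & forall j, h j = v j *: g (s j)].
Proof.
move=> f0 Na fg Ma Mi h0 hd Ef EP.
have [c [cP [v v0 vE]]] := factorization_refinement f0 fg Ma h0 hd Ef.
have [s [sb cE sd sm]] := refinement_rigid Na Ma Mi cP EP.
exists s; split=> //; exists v => // j; rewrite vE (bigD1 (s j)) //= cE eqxx expr1.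
by rewrite big1 ?mulr1 // => i /negPf ne; rewrite cE ne.
Qed.

Lemma exact_product_fparam N M f : admissible N -> admissible M ->
  factset R N f -> exact_product M f -> (fparam N <= fparam M)%N.
Proof.
move=> Na Ma [f0 _ [al [g fg]]] /exact_productP[be [h [be0 h0 hd Ef]]].
have [c [cP _]] := factorization_refinement f0 fg Ma h0 hd Ef.
exact: refinement_fparam cP.
Qed.

Lemma exact_product_embedded N M f : admissible N -> admissible M ->
  factset R N f -> exact_product M f -> embedded N M.
Proof.
move=> Na Ma [f0 _ [al [g fg]]] /exact_productP[be [h [be0 h0 hd Ef]]].
have [c [cP _]] := factorization_refinement f0 fg Ma h0 hd Ef.
exact: refinement_embedded cP.
Qed.

Lemma exact_product_same N M f : admissible N -> admissible M ->
  (forall j : 'I_(size M), no_univariate_split (fdeg j)) ->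
  factset R N f -> exact_product M f -> fparam N = fparam M -> perm_eq N M.
Proof.
move=> Na Ma Mi [f0 _ [al [g fg]]] /exact_productP[be [h [be0 h0 hd Ef]]] EP.
have [s [sb sd sm _]] := factorization_rigid f0 Na fg Ma Mi h0 hd Ef EP.
exact: perm_eq_reindex sb sd sm.
Qed.

Lemma normalized_irreducible_eq g h (c : K) : g != 0 ->
  mcoeff (mlead g) g = 1 -> mcoeff (mlead h) h = 1 -> h = c *: g -> h = g.
Proof.
move=> g0 lg lh E; have c0 : c != 0.
  apply/eqP => E0; move/eqP: lh.
  by rewrite E E0 scale0r mlead0 mcoeff0 eq_sym oner_eq0.
have lE : mlead (c *: g) = mlead g by apply: mleadZ_proper; rewrite lg mulr1.
by move: lh; rewrite E lE mcoeffZ lg mulr1 => ->; rewrite scale1r.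
Qed.

(** Scaling the prime factors to leading coefficient 1 makes associates equal, so
    that multiplicities are plain numbers of occurrences. *)
Lemma exists_factorization f : f != 0 ->
  exists M, [/\ admissible M, degF M = multideg f & factset R M f].
Proof.
move=> f0; have [u /unit_mpolyP[a a0 ->] [s sP Ef]] := factorial_mpoly f0.
pose nrm (p : mp) := (mcoeff (mlead p) p)^-1 *: p.
pose t := [seq nrm p | p <- s].
have lead0 p : prime_elt p -> mcoeff (mlead p) p != 0 by case=> p0 _ _; rewrite mleadc_eq0.
have tI p : p \in t -> irreducible p /\ mcoeff (mlead p) p = 1.
  move=> /mapP[q qs ->]; have qP := sP q qs; split.
    by apply: irreducible_scale; [rewrite invr_eq0 lead0|exact: prime_irreducible].
  rewrite /nrm mleadZ_proper ?mcoeffZ ?mulVf ?lead0 ?oner_neq0 //.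
have [b b0 Eb] : exists2 b : K, b != 0 & f = b *: \prod_(p <- t) p.
  exists (a * \prod_(p <- s) mcoeff (mlead p) p).
    rewrite mulf_neq0 // prodf_seq_neq0; apply/allP => p ps /=; exact/lead0/sP.
  rewrite Ef mul_mpolyC -scalerA; congr (_ *: _).
  rewrite -mul_mpolyC rmorph_prod big_map -big_split /=.
  apply: eq_big_seq => p ps; rewrite /nrm mul_mpolyC scalerA divff ?scale1r //.
  exact/lead0/sP.
pose M := [seq (multideg p, count_mem p t) | p <- undup t].
have szM : size M = size (undup t) by rewrite size_map.
pose g (j : 'I_(size M)) := nth 0 (undup t) j.
have gt j : g j \in undup t by rewrite mem_nth // -szM.
have ME (j : 'I_(size M)) : tnth (in_tuple M) j = (multideg (g j), count_mem (g j) t).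
  by rewrite (tnth_nth (mnm0, 0%N)) /= (nth_map 0) // -szM.
have gI j : irreducible (g j) by apply: (tI _ _).1; rewrite -mem_undup.
have fg : is_factorization (M := M) f b g.
  split.
  - by move=> j; rewrite ME.
  - move=> i j ij; apply/coprime_irreducible => // dv.
    have [c c0 Ec] := irreducible_divides (gI i) (gI j) dv.
    have git := gt i; have gjt := gt j; rewrite !mem_undup in git gjt.
    have := normalized_irreducible_eq (irreducible_neq0 (gI i)) (tI _ git).2 (tI _ gjt).2 Ec.
    move=> /eqP; rewrite nth_uniq ?undup_uniq -?szM // => /eqP/val_inj E.
    by rewrite E eqxx in ij.
  - rewrite Eb; congr (_ *: _).
    rewrite -(big_undup_iterop_count _ _ xpredT) (big_nth 0) -szM big_mkord.
    by apply: eq_bigr => j _; rewrite ME.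
have Ma : admissible M.
  move=> j; rewrite /fmul /fdeg ME /=; split; last exact: irreducible_deg_neq0.
  by rewrite -has_count has_pred1 -mem_undup.
have dM : degF M = multideg f.
  case: fg => _ _ ->; rewrite multidegZ // multideg_prod => [|j _]; last first.
    by rewrite expf_neq0 // irreducible_neq0.
  rewrite degFE; apply: eq_bigr => j _.
  by rewrite multidegX ?irreducible_neq0 // /fdeg /fmul !ME.
by exists M; split=> //; split; [|rewrite dM|exists b, g].
Qed.

Lemma exact_product_multideg M f : exact_product M f -> f != 0 /\ multideg f = degF M.
Proof.
move=> /exact_productP[be [h [be0 h0 hd ->]]].
have p0 : \prod_j h j ^+ fmul j != 0.
  exact: prod_exp_neq0.
split; first by rewrite scaler_eq0 negb_or be0.
rewrite multidegZ // multideg_prod => [|j _]; last by rewrite expf_neq0.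
by rewrite degFE; apply: eq_bigr => j _; rewrite multidegX // hd.
Qed.

(** The criterion by which parameters near those of a point of the stratum are
    seen to give irreducible factors again. *)
Lemma exact_product_factset N M f al (h : 'I_(size M) -> mp) :
  admissible N -> admissible M ->
  (forall j : 'I_(size M), no_univariate_split (fdeg j)) ->
  factset R N f -> fparam N = fparam M ->
  (forall j, h j != 0) -> (forall j, multideg (h j) = fdeg j) ->
  f = al *: \prod_j h j ^+ fmul j -> is_factorization (M := M) f al h.
Proof.
move=> Na Ma Mi [f0 _ [be [g fg]]] EP h0 hd Ef.
have [s [sb sd sm [v v0 vE]]] := factorization_rigid f0 Na fg Ma Mi h0 hd Ef EP.
have gN := factorization_coprime fg; have [gI gC _] := fg.
have hI j : irreducible (h j).
  by rewrite vE; apply: irreducible_scale => //; have [] := gI (s j).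
split=> // i j ij; apply/coprime_irreducible => //.
have := gN (s i) (s j); rewrite (inj_eq (bij_inj sb)) => /(_ ij) ndv [x]; rewrite !vE => E.
apply: ndv; exists (mpolyC l ((v j)^-1 * v i) * x).
rewrite -mulrA mul_mpolyC -scalerA scalerAr -E scalerA mulVf ?scale1r //.
Qed.

End Factorizations.

(** * Limits, coordinate by coordinate and coefficient by coefficient *)

Section RowVectorLimits.
Context {K : numFieldType}.

Lemma rV_cvg (T : Type) (G : set_system T) {FG : Filter G} n (v : T -> 'rV[K]_n) (w : 'rV[K]_n) :
  (forall j, v t ord0 j @[t --> G] --> w ord0 j) -> v @ G --> w.
Proof.
move=> H A [P PN PA]; rewrite /= /nbhs /=.
have : \forall t \near G, forall j, P ord0 j (v t ord0 j).
  by apply: filter_forall => j; apply: (H j); apply: PN.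
by apply: filterS => t Pt; apply: PA => i j; rewrite ord1.
Qed.

Lemma rV_cvg_coord (T : Type) (G : set_system T) {FG : Filter G} n (v : T -> 'rV[K]_n) (w : 'rV[K]_n) :
  v @ G --> w -> forall j, v t ord0 j @[t --> G] --> w ord0 j.
Proof.
by move=> H j; apply: (cvg_comp v (fun w : 'rV[K]_n => w ord0 j) H); apply: coord_continuous.
Qed.

Lemma cvg_sum_fin (T : Type) (G : set_system T) {FG : Filter G} (I : Type) (r : seq I) (P : pred I)
  (u : I -> T -> K) (z : I -> K) :
  (forall i, u i @ G --> z i) ->
  \sum_(i <- r | P i) u i t @[t --> G] --> \sum_(i <- r | P i) z i.
Proof.
move=> H; elim: r => [|i r IH].
  by under eq_fun do rewrite big_nil; rewrite big_nil; apply: cvg_cst.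
have [Pi|nPi] := boolP (P i); last first.
  rewrite big_cons (negPf nPi).
  by rewrite (_ : (fun t => _) = fun t => \sum_(j <- r | P j) u j t) //;
    apply/funext => t; rewrite big_cons (negPf nPi).
rewrite big_cons Pi (_ : (fun t => _) = u i \+ fun t => \sum_(j <- r | P j) u j t).
  by apply: cvgD; [exact: H|exact: IH].
by apply/funext => t; rewrite big_cons Pi.
Qed.

Lemma cvg_dnbhs_id (x : K) : t @[t --> x^'] --> x.
Proof. exact: nbhs_dnbhs. Qed.

Lemma cvg_dnbhs_scale (c : K) : t * c @[t --> (0 : K)^'] --> (0 : K).
Proof.
have : t * c @[t --> (0 : K)^'] --> 0 * c.
  by apply: cvgM; [exact: cvg_dnbhs_id|exact: cvg_cst].
by rewrite mul0r.
Qed.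

Lemma dnbhs_neq (b : K) : \forall t \near (0 : K)^', t != b.
Proof.
have [->|b0] := eqVneq b 0; first exact: nbhs_dnbhs_neq.
have /cvgrPdist_lt/(_ `|b|) : id @ (0 : K)^' --> (0 : K) by exact: cvg_dnbhs_id.
rewrite normr_gt0 => /(_ b0); apply: filterS => t; rewrite sub0r normrN.
by apply: contraTneq => ->; rewrite ltxx.
Qed.

Lemma dnbhs_small (e : K) : 0 < e -> \forall t \near (0 : K)^', `|t| < e.
Proof.
move=> e0; have /cvgrPdist_lt/(_ e e0) : id @ (0 : K)^' --> (0 : K) by exact: cvg_dnbhs_id.
by apply: filterS => t; rewrite sub0r normrN.
Qed.

Lemma nbhs_norm_lt n (w : 'rV[K]_n) (e : K) : 0 < e -> nbhs w [set v | `|w - v| < e].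
Proof.
move=> e0; have /cvgrPdist_lt/(_ e e0) : id @ nbhs w --> w by exact: cvg_id.
exact.
Qed.

End RowVectorLimits.

Section UltrafilterLimits.
Context {R : realType}.
Local Notation K := (Cplx R).

Lemma ultra_map (T U : Type) (f : T -> U) (G : set_system T) :
  UltraFilter G -> UltraFilter (f @ G).
Proof.
move=> GU; split; first exact: fmap_proper_filter.
move=> H HF sGH; rewrite predeqE => A; split; last exact: sGH.
move=> HA; have [//|nA] := in_ultra_setVsetC (f @^-1` A) GU.
have : H (A `&` ~` A) by apply: filterI => //; apply: sGH.
by rewrite setICr => /filter_ex[].
Qed.

Lemma ultra_cvg_real (T : Type) (G : set_system T) (r : T -> R) :
  UltraFilter G -> (forall t, `|r t| <= 1) -> exists x : R, r @ G --> x.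
Proof.
move=> GU rb; have := @segment_compact R (-1) 1.
rewrite compact_ultra => /(_ (r @ G) (ultra_map r GU)) H.
have [|x [_ Hx]] := H; last by exists x.
apply: (@filterE T G) => t; rewrite /= in_itv /=.
by rewrite -ler_norml; exact: rb.
Qed.

Lemma normC_le (a b : R) : `|Complex a b : K| <= (`|a| + `|b|)%:C%C.
Proof.
rewrite normc_def /= lecR -[leRHS]ger0_norm ?addr_ge0 // -sqrtr_sqr.
rewrite ler_wsqrtr // sqrrD !real_normK ?num_real //.
by rewrite addrAC lerDl mulrn_wge0 // mulr_ge0.
Qed.

(** The compactness of the closed unit disk in the form in which it is used
    below, obtained from that of a real interval for the real and imaginary
    parts. *)
Lemma ultra_cvg_complex (T : Type) (G : set_system T) (u : T -> K) :
  UltraFilter G -> (forall t, `|u t| <= 1) -> exists z : K, u @ G --> z.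
Proof.
move=> GU ub.
have sq1 t : (complex.Re (u t)) ^+ 2 + (complex.Im (u t)) ^+ 2 <= 1.
  have := ub t; rewrite normc_def -[1]/(1%:C%C) lecR => H.
  rewrite -[leLHS]sqr_sqrtr ?addr_ge0 ?sqr_ge0 //.
  by rewrite expr_le1 ?sqrtr_ge0.
have le1 (a : R) : a ^+ 2 <= 1 -> `|a| <= 1.
  by move=> H; rewrite -(@expr_le1 _ 2) // real_normK ?num_real.
have rb t : `|complex.Re (u t)| <= 1.
  by apply: le1; apply: le_trans (sq1 t); rewrite lerDl sqr_ge0.
have ib t : `|complex.Im (u t)| <= 1.
  by apply: le1; apply: le_trans (sq1 t); rewrite lerDr sqr_ge0.
have [x xP] := ultra_cvg_real GU rb; have [y yP] := ultra_cvg_real GU ib.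
exists (Complex x y); apply/cvgrPdist_lt => e e0.
have [d Ed] : exists d : R, e = d%:C%C.
  by exists (complex.Re e); rewrite RRe_real // gtr0_real.
have d0 : 0 < d by rewrite -(ltcR 0) -Ed.
have d2 : 0 < d / 2 by rewrite divr_gt0.
move/cvgrPdist_lt/(_ _ d2) : xP => xP; move/cvgrPdist_lt/(_ _ d2) : yP => yP.
apply: filterS2 xP yP => t xt yt; rewrite Ed.
have -> : Complex x y - u t = Complex (x - complex.Re (u t)) (y - complex.Im (u t)).
  by case: (u t).
apply: le_lt_trans (normC_le _ _) _.
by rewrite ltcR [d]splitr ltrD.
Qed.

End UltrafilterLimits.

Section CoefficientwiseLimits.
Context {R : realType} {l : nat}.
Local Notation K := (Cplx R).
Local Notation mp := (mpoly l (Cplx R)).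
Implicit Types (m n : multinom l) (f g h : mp).

(** Polynomials of unbounded degree carry no topology here; limits of products
    are controlled because a coefficient of a product depends on finitely many
    coefficients of the factors. *)
Definition mcvg (T : Type) (G : set_system T) (F : T -> mp) (h : mp) :=
  forall a, mcoeff a (F t) @[t --> G] --> mcoeff a h.

Section Filter.
Context (T : Type) (G : set_system T) {FG : Filter G}.

Lemma mcvg_cst h : mcvg G (fun=> h) h.
Proof. by move=> a; apply: cvg_cst. Qed.

Lemma mcvgD F1 F2 h1 h2 : mcvg G F1 h1 -> mcvg G F2 h2 ->
  mcvg G (fun t => F1 t + F2 t) (h1 + h2).
Proof.
move=> H1 H2 a; rewrite mcoeffD; under eq_fun do rewrite mcoeffD.
by apply: cvgD; [exact: H1|exact: H2].
Qed.

Lemma mcvgM F1 F2 h1 h2 : mcvg G F1 h1 -> mcvg G F2 h2 ->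
  mcvg G (fun t => F1 t * F2 t) (h1 * h2).
Proof.
move=> H1 H2 a; rewrite mcoeffM; under eq_fun do rewrite mcoeffM.
by apply: cvg_sum_fin => k; apply: cvgM; [exact: H1|exact: H2].
Qed.

Lemma mcvgX F h k : mcvg G F h -> mcvg G (fun t => F t ^+ k) (h ^+ k).
Proof.
move=> H; elim: k => [|k IH].
  by rewrite expr0; under eq_fun do rewrite expr0; apply: mcvg_cst.
by rewrite exprS; under eq_fun do rewrite exprS; apply: mcvgM.
Qed.

Lemma mcvg_prod (I : Type) (r : seq I) (F : I -> T -> mp) (h : I -> mp) :
  (forall i, mcvg G (F i) (h i)) ->
  mcvg G (fun t => \prod_(i <- r) F i t) (\prod_(i <- r) h i).
Proof.
move=> H; elim: r => [|i r IH].
  by rewrite big_nil; under eq_fun do rewrite big_nil; apply: mcvg_cst.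
rewrite big_cons (_ : (fun t => _) = fun t => F i t * \prod_(j <- r) F j t).
  exact: (mcvgM (H i) IH).
by apply/funext => t; rewrite big_cons.
Qed.

Lemma mcvgZ (u : T -> K) (z : K) F h : u @ G --> z -> mcvg G F h ->
  mcvg G (fun t => u t *: F t) (z *: h).
Proof.
move=> Hu HF a; rewrite mcoeffZ; under eq_fun do rewrite mcoeffZ.
by apply: cvgM; [exact: Hu|exact: HF].
Qed.

Lemma coefv_cvg m F h : mcvg G F h -> coefv m (F t) @[t --> G] --> coefv m h.
Proof.
by move=> H; apply: rV_cvg => j; rewrite mxE; under eq_fun do rewrite mxE; apply: H.
Qed.

End Filter.

Lemma mcvg_unique (T : Type) (G : set_system T) {FG : ProperFilter G} F h1 h2 :
  mcvg G F h1 -> mcvg G F h2 -> h1 = h2.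
Proof.
move=> H1 H2; apply/mpolyP => a.
exact: (@norm_cvg_unique _ _ _ _ _ _ (H1 a) (H2 a)).
Qed.

(** The inverse of [coefv m] on polynomials of degree at most m. *)
Definition polv m (v : 'rV[K]_(dimP m)) : mp :=
  \sum_(j < dimP m) v ord0 j *: mpolyX K (box_mnm (enum_val j)).

Lemma box_mnm_inj m : injective (@box_mnm l m).
Proof.
move=> b c /mnmP E; apply/ffunP => i; apply: val_inj.
by have := E i; rewrite !mnmE.
Qed.

Lemma box_mnm_surj m (a : multinom l) : (forall i, (a i <= m i)%N) ->
  exists j : 'I_(dimP m), box_mnm (enum_val j) = a.
Proof.
move=> H; exists (enum_rank ([ffun i => inord (a i)] : box m)).
by rewrite enum_rankK; apply/mnmP => i; rewrite mnmE ffunE inordK // ltnS.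
Qed.

Lemma box_mnm_le m (j : 'I_(dimP m)) i : (box_mnm (enum_val j) i <= m i)%N.
Proof. by rewrite mnmE -ltnS. Qed.

Lemma mcoeff_polv m v j : mcoeff (box_mnm (enum_val j)) (@polv m v) = v ord0 j.
Proof.
rewrite /polv raddf_sum /= (bigD1 j) //= mcoeffZ mcoeffX eqxx mulr1 big1 ?addr0 // => k kj.
rewrite mcoeffZ mcoeffX (inj_eq (@box_mnm_inj m)) (inj_eq enum_val_inj).
by rewrite (negPf kj) mulr0.
Qed.

Lemma mcoeff_polv_out m v (a : multinom l) : ~ (forall i, (a i <= m i)%N) -> mcoeff a (@polv m v) = 0.
Proof.
move=> H; rewrite /polv raddf_sum /= big1 // => j _; rewrite mcoeffZ mcoeffX.
by case: eqP => [E|_]; rewrite ?mulr0 //; case: H => i; rewrite -E box_mnm_le.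
Qed.

Lemma degle_polv m v : degle (@polv m v) m.
Proof.
move=> a; apply: contra_neqP => H; apply: mcoeff_polv_out => H'; apply: H.
by move=> i; apply: H'.
Qed.

Lemma polvK m : cancel (@polv m) (coefv m).
Proof. by move=> v; apply/rowP => j; rewrite mxE mcoeff_polv. Qed.

Lemma coefvK m f : degle f m -> polv (coefv m f) = f.
Proof.
move=> H; apply/mpolyP => a; have [le|nle] := pselect (forall i, (a i <= m i)%N).
  by have [j <-] := box_mnm_surj le; rewrite mcoeff_polv mxE.
rewrite mcoeff_polv_out //; apply/esym/eqP/negPn/negP => /H; exact: nle.
Qed.

Lemma polv_cvg (T : Type) (G : set_system T) {FG : Filter G} m v w :
  v @ G --> w -> mcvg G (fun t => @polv m (v t)) (polv w).
Proof.
move=> H a; have [le|nle] := pselect (forall i, (a i <= m i)%N).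
  have [j <-] := box_mnm_surj le; rewrite mcoeff_polv.
  by under eq_fun do rewrite mcoeff_polv; apply: rV_cvg_coord.
rewrite mcoeff_polv_out //; under eq_fun do rewrite mcoeff_polv_out //.
exact: cvg_cst.
Qed.

End CoefficientwiseLimits.

(** * Limits of factorizations *)

Local Opaque Cplx.

Section LimitsOfProducts.
Context {R : realType} {l : nat}.
Local Notation K := (Cplx R).
Local Notation mp := (mpoly l (Cplx R)).
Implicit Types (m n : multinom l) (M N : fproduct l) (f g h : mp).

Lemma cvg_near_eq (T : Type) (U : topologicalType) (G : set_system T) {FG : Filter G} (u v : T -> U) (z : U) :
  (\forall t \near G, u t = v t) -> u @ G --> z -> v @ G --> z.
Proof. by move=> H; apply: cvg_trans; apply: near_eq_cvg; apply: filterS H. Qed.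

Lemma ultra_cvg_near (T : Type) (G : set_system T) (u : T -> K) :
  UltraFilter G -> (\forall t \near G, `|u t| <= 1) -> exists z : K, u @ G --> z.
Proof.
move=> GU ub; pose v t := if `|u t| <= 1 then u t else 0.
have vb t : `|v t| <= 1 by rewrite /v; case: ifP => // _; rewrite normr0.
have [z zP] := ultra_cvg_complex GU vb; exists z; apply: cvg_near_eq zP.
by apply: filterS ub => t; rewrite /v => ->.
Qed.

Lemma max_coefficient g : g != 0 ->
  exists a, mcoeff a g != 0 /\ forall b, `|mcoeff b g| <= `|mcoeff a g|.
Proof.
move=> g0; have H (s : seq (multinom l)) : s != [::] ->
    exists2 a, a \in s & forall b, b \in s -> `|mcoeff b g| <= `|mcoeff a g|.
  elim: s => [//|a [|b s] IH] _.
    by exists a => [|b]; [exact: mem_head|rewrite inE => /eqP ->].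
  have [|c cs cM] := IH; first by [].
  have [le|lt] := real_leP (normr_real (mcoeff a g)) (normr_real (mcoeff c g)).
    exists c; first by rewrite inE cs orbT.
    by move=> d; rewrite inE => /predU1P[->|/cM].
  exists a; first by rewrite mem_head.
  move=> d; rewrite inE => /predU1P[->|/cM H]; [exact: lexx|exact: le_trans H (ltW lt)].
have [|a ag aM] := H (msupp g); first by rewrite msupp_eq0.
exists a; split=> [|b]; first by rewrite -mcoeff_msupp.
have [/aM|] := boolP (b \in msupp g); first exact.
by rewrite mcoeff_msupp negbK => /eqP ->; rewrite normr0 normr_ge0.
Qed.

Lemma cvg_near_neq0 (T : Type) (G : set_system T) {FG : Filter G} (u : T -> K) (z : K) :
  u @ G --> z -> z != 0 -> \forall t \near G, u t != 0.
Proof.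
move=> /cvgrPdist_lt uz z0; have := uz `|z|; rewrite normr_gt0 => /(_ z0).
by apply: filterS => t; apply: contraTneq => ->; rewrite subr0 ltxx.
Qed.

(** The factors are scaled to have largest coefficient 1.  Their limits have a
    coefficient of modulus 1 since a monomial of bounded degree ranges over a finite
    set.  The scalars converge because the product of the limits is nonzero, and the
    degrees of the limits cannot drop because their weighted sum is the degree of
    f. *)
Lemma limit_of_products (T : Type) (G : set_system T) M (F : T -> mp)
    (al : T -> K) (g : T -> 'I_(size M) -> mp) f :
  UltraFilter G -> admissible M ->
  (\forall t \near G, F t = al t *: \prod_j g t j ^+ fmul j) ->
  (\forall t \near G, forall j, g t j != 0 /\ degle (g t j) (fdeg j)) ->
  mcvg G F f -> f != 0 -> multideg f = degF M ->
  exists (be : K) (h : 'I_(size M) -> mp) (lam : T -> 'I_(size M) -> K),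
  [/\ forall j, h j != 0, forall j, multideg (h j) = fdeg j,
      f = be *: \prod_j h j ^+ fmul j
    & [/\ \forall t \near G, forall j, lam t j != 0,
        forall j, mcvg G (fun t => lam t j *: g t j) (h j)
      & al t / \prod_j lam t j ^+ fmul j @[t --> G] --> be]].
Proof.
move=> GU Ma FE gP Ff f0 fd.
have [lam lamP] : exists lam : T -> 'I_(size M) -> K, forall t j, g t j != 0 ->
    lam t j != 0 /\ exists a, mcoeff a (lam t j *: g t j) = 1 /\
    forall b, `|mcoeff b (lam t j *: g t j)| <= 1.
  suff H (tj : T * 'I_(size M)) : exists c : K, g tj.1 tj.2 != 0 -> c != 0 /\
      exists a, mcoeff a (c *: g tj.1 tj.2) = 1 /\
      forall b, `|mcoeff b (c *: g tj.1 tj.2)| <= 1.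
    by have [lam lamP] := choice H; exists (fun t j => lam (t, j)) => t j; apply: (lamP (t, j)).
  have [->|/max_coefficient[a [a0 aM]]] := eqVneq (g tj.1 tj.2) 0; first by exists 0.
  exists (mcoeff a (g tj.1 tj.2))^-1 => _; rewrite invr_eq0 a0; split=> //.
  exists a; rewrite mcoeffZ mulVf //; split=> // b.
  rewrite mcoeffZ normrM normfV ler_pdivrMl ?normr_gt0 // mulr1; exact: aM.
have good : \forall t \near G, forall j, [/\ lam t j != 0, degle (lam t j *: g t j) (fdeg j)
    & exists a, mcoeff a (lam t j *: g t j) = 1 /\ forall b, `|mcoeff b (lam t j *: g t j)| <= 1].
  apply: filterS gP => t gP j; have [g0 gd] := gP j; have [l0 aP] := lamP t j g0.
  by split=> // a; rewrite mcoeffZ mulf_eq0 negb_or l0; apply: gd.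
have limz (jb : 'I_(size M) * multinom l) : exists z : K,
    mcoeff jb.2 (lam t jb.1 *: g t jb.1) @[t --> G] --> z.
  apply: ultra_cvg_near => //; apply: filterS good => t /(_ jb.1)[_ _ [a [_ bP]]].
  exact: bP.
have [z zP] := choice limz.
(* The limit factors, assembled from the limits of the coefficients. *)
pose h j : mp := polv (\row_(i < dimP (fdeg j)) z (j, box_mnm (enum_val i))).
have hP j : mcvg G (fun t => lam t j *: g t j) (h j).
  move=> b; have [le|nle] := pselect (forall i, (b i <= fdeg j i)%N).
    have [i <-] := box_mnm_surj le; rewrite mcoeff_polv mxE.
    exact: (zP (j, box_mnm (enum_val i))).
  rewrite mcoeff_polv_out //; apply: cvg_near_eq (cvg_cst _).
  apply: filterS good => t /(_ j)[_ dg _]; apply/esym/eqP/negPn/negP => /dg; exact: nle.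
have h0 j : h j != 0.
  apply/eqP => E.
  have small : \forall t \near G, forall i : 'I_(dimP (fdeg j)),
      `|mcoeff (box_mnm (enum_val i)) (lam t j *: g t j)| < 1.
    apply: filter_forall => i; have := hP j (box_mnm (enum_val i)).
    rewrite E mcoeff0 => /cvgrPdist_lt/(_ 1 ltr01).
    by apply: filterS => t; rewrite sub0r normrN.
  have [t [/(_ j)[_ dg [a [a1 _]]] ts]] := filter_ex (filterI good small).
  have [i Ei] : exists i : 'I_(dimP (fdeg j)), box_mnm (enum_val i) = a.
    by apply: box_mnm_surj; apply: dg; rewrite a1 oner_eq0.
  by have := ts i; rewrite Ei a1 normr1 ltxx.
pose H := \prod_j h j ^+ fmul j.
pose Ht t := \prod_j (lam t j *: g t j) ^+ fmul j.
pose bt t := al t / \prod_j lam t j ^+ fmul j.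
have HtH : mcvg G Ht H.
  apply: (mcvg_prod (F := fun j t => (lam t j *: g t j) ^+ fmul j)) => j.
  exact: mcvgX (hP j).
have H0 : H != 0 by exact: prod_exp_neq0.
have lprod0 : \forall t \near G, \prod_j lam t j ^+ fmul j != 0.
  by apply: filterS good => t gt; apply: prod_exp_neq0 => j; have [] := gt j.
have FbH : \forall t \near G, F t = bt t *: Ht t.
  apply: filterS2 FE lprod0 => t -> lp0; rewrite /bt /Ht.
  rewrite [in RHS](eq_bigr (fun j => lam t j ^+ fmul j *: g t j ^+ fmul j)) => [|j _].
    by rewrite scaler_prod scalerA divfK.
  exact: exprZn.
have [a [aH _]] := max_coefficient H0.
have btE : \forall t \near G, mcoeff a (F t) / mcoeff a (Ht t) = bt t.
  have nz : \forall t \near G, mcoeff a (Ht t) != 0 by apply: cvg_near_neq0 (HtH a) aH.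
  by apply: filterS (filterI FbH nz) => t [-> nzt]; rewrite mcoeffZ mulfK.
have btl : bt t @[t --> G] --> mcoeff a f / mcoeff a H.
  apply: cvg_near_eq btE _; apply: cvgM; first exact: (Ff a).
  by apply: cvgV; [exact: aH|exact: (HtH a)].
have fE : f = (mcoeff a f / mcoeff a H) *: H.
  apply: (mcvg_unique (G := G) Ff).
  have Hb := mcvgZ btl HtH; move=> b; apply: cvg_near_eq (Hb _ b).
  by apply: filterS FbH => t ->.
have hle j i : (multideg (h j) i <= fdeg j i)%N by apply: multideg_le; apply: degle_polv.
have hd j : multideg (h j) = fdeg j.
  have fH : multideg f = \big[@mnm_add l/@mnm0 l]_j mnm_muln (multideg (h j)) (fmul j).
    rewrite fE multidegZ; last first.
      by apply: contraNneq f0 => E; rewrite fE E scale0r.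
    rewrite multideg_prod => [|k _]; last by rewrite expf_neq0.
    by apply: eq_bigr => k _; rewrite multidegX.
  apply/mnmP => i; apply/eqP; rewrite eqn_leq hle leqNgt; apply/negP => lt.
  have : (\sum_k multideg (h k) i * fmul k < \sum_(k < size M) fdeg k i * fmul k)%N.
    have split (u : 'I_(size M) -> nat) : (\sum_k u k = u j + \sum_(k | k != j) u k)%N.
      by rewrite (bigD1 j).
    rewrite (split (fun k => multideg (h k) i * fmul k)%N) (split (fun k => fdeg k i * fmul k)%N).
    have lt1 : (multideg (h j) i * fmul j < fdeg j i * fmul j)%N.
      by have [k0 _] := Ma j; rewrite ltn_pmul2r.
    have le2 : (\sum_(k | k != j) multideg (h k) i * fmul k <=
                \sum_(k | k != j) fdeg k i * fmul k)%N.
      by apply: leq_sum => k _; rewrite leq_mul2r hle orbT.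
    by lia.
  have := congr1 (fun m : multinom l => m i) fd; rewrite /= fH degFE !mnm_sumE.
  under eq_bigr do rewrite mulmnE; under [RHS]eq_bigr do rewrite mulmnE.
  by move=> ->; rewrite ltnn.
exists (mcoeff a f / mcoeff a H), h, lam; split=> //; split=> //.
by apply: filterS good => t gt j; have [] := gt j.
Qed.

End LimitsOfProducts.

(** * Specialization of factorization structures *)

Lemma ultra_of_closure (T : topologicalType) (A : set T) (p : T) :
  closure A p -> exists G : set_system T, [/\ UltraFilter G, G A & G --> p].
Proof.
move=> cA; have PF : ProperFilter (within A (nbhs p)) by exact: within_nbhs_proper.
have [G [GU sG]] := ultraFilterLemma PF; exists G; split=> //.
  by apply: sG; rewrite /within /=; apply: filterE.
by move=> B pB; apply: sG; rewrite /within /=; apply: filterS pB.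
Qed.

Lemma not_closure_near (T : topologicalType) (A : set T) (p : T) :
  ~ closure A p -> \forall t \near p, ~ A t.
Proof.
move=> /existsNP[B /not_implyP[pB nAB]]; apply: filterS pB => t Bt At.
by apply: nAB; exists t.
Qed.

Section Specialization.
Context {R : realType} {l : nat}.
Local Notation K := (Cplx R).
Local Notation mp := (mpoly l (Cplx R)).
Implicit Types (m n : multinom l) (M N : fproduct l) (f g h : mp).

(** The degree is attained in each variable by a coefficient that stays nonzero,
    and it cannot increase. *)
Lemma multideg_near (T : Type) (G : set_system T) {FG : Filter G} (F : T -> mp) f m :
  mcvg G F f -> f != 0 -> multideg f = m -> (\forall t \near G, degle (F t) m) ->
  \forall t \near G, F t != 0 /\ multideg (F t) = m.
Proof.
move=> Ff f0 fm dF; have [b [b0 _]] := max_coefficient f0.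
have H0 : \forall t \near G, F t != 0.
  have : \forall t \near G, mcoeff b (F t) != 0 by apply: cvg_near_neq0 (Ff b) b0.
  by apply: filterS => t; apply: contraNneq => ->; rewrite mcoeff0.
have H1 : \forall t \near G, forall i, (m i <= multideg (F t) i)%N.
  apply: filter_forall => i; have [a a0 ai] := multideg_attained i f0.
  rewrite -fm -ai.
  have : \forall t \near G, mcoeff a (F t) != 0 by apply: cvg_near_neq0 (Ff a) a0.
  by apply: filterS => t /degle_multideg.
apply: filterS (filterI (filterI H0 H1) dF) => t [[Ft0 le1] le2]; split=> //.
apply/mnmP => i; apply/eqP; rewrite eqn_leq le1 andbT.
exact: multideg_le.
Qed.

Lemma exact_product_of_limit (T : Type) (G : set_system T) (F : T -> mp) M f :
  UltraFilter G -> admissible M -> (\forall t \near G, factset R M (F t)) ->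
  mcvg G F f -> f != 0 -> multideg f = degF M -> exact_product M f.
Proof.
move=> GU Ma FM Ff f0 fM.
have H t : exists ag : K * ('I_(size M) -> mp), factset R M (F t) ->
    is_factorization (M := M) (F t) ag.1 ag.2.
  have [[_ _ [al [g fg]]]|nf] := pselect (factset R M (F t)); first by exists (al, g).
  by exists (0, fun=> 0).
have [ag agP] := choice H.
have H1 : \forall t \near G, F t = (ag t).1 *: \prod_j (ag t).2 j ^+ fmul j.
  by apply: filterS FM => t /agP[].
have H2 : \forall t \near G, forall j, (ag t).2 j != 0 /\ degle ((ag t).2 j) (fdeg j).
  apply: filterS FM => t /agP[gI _ _] j; have [gj gd] := gI j.
  by split; [exact: irreducible_neq0|rewrite /fdeg -gd; exact: degle_multideg].
have [be [h [lam [h0 hd Ef _]]]] := limit_of_products GU Ma H1 H2 Ff f0 fM.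
apply/exact_productP; exists be, h; split=> //.
by apply: contraNneq f0 => E; rewrite Ef E scale0r.
Qed.

Lemma factset_degle M f : factset R M f -> degle f (degF M).
Proof. by move=> [_ <- _]; apply: degle_multideg. Qed.

Lemma coefv_factsetE m M (v : 'rV[K]_(dimP m)) : degF M = m ->
  (coefv m @` factset R M) v <-> factset R M (polv v).
Proof.
move=> dM; subst m; split=> [[g gM <-]|H]; last by exists (polv v) => //; exact: polvK.
by rewrite coefvK //; apply: factset_degle.
Qed.

Lemma closure_exact_product m M f : admissible M -> degF M = m -> f != 0 -> multideg f = m ->
  closure (coefv m @` factset R M) (coefv m f) -> exact_product M f.
Proof.
move=> Ma dM f0 fm /ultra_of_closure[G [GU GA Gf]].
apply: (@exact_product_of_limit _ G (@polv R l m)) => //; last by rewrite dM.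
  by apply: filterS GA => v /(coefv_factsetE _ dM).
by rewrite -[f](@coefvK _ _ m); [exact: polv_cvg|rewrite -fm; exact: degle_multideg].
Qed.

Lemma admissible_size M : admissible M -> (size M <= mdeg (degF M))%N /\
  forall j : 'I_(size M), (fmul j <= mdeg (degF M))%N /\ forall i, (fdeg j i <= degF M i)%N.
Proof.
move=> Ma; have dE : mdeg (degF M) = (\sum_(j < size M) mdeg (fdeg j) * fmul j)%N.
  rewrite degFE mdeg_sum; apply: eq_bigr => j _.
  exact: mdegMn.
have ge1 (j : 'I_(size M)) : (0 < mdeg (fdeg j))%N by rewrite lt0n mdeg_eq0; have [] := Ma j.
split.
  rewrite dE -[leqLHS]card_ord -sum1_card; apply: leq_sum => j _.
  by rewrite muln_gt0 ge1; have [] := Ma j.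
move=> j; split; first by rewrite dE (bigD1 j) //=; have := ge1 j; nia.
move=> i; rewrite degFE mnm_sumE (bigD1 j) //= mulmnE.
by have [] := Ma j; nia.
Qed.

(** There are finitely many structures of degree m, and each of them occurs
    arbitrarily close to f only if f is an exact product over it. *)
Lemma specialization_near m f : f != 0 -> multideg f = m ->
  \forall v \near coefv m f, exists M, [/\ admissible M, degF M = m,
    factset R M (polv v) & exact_product M f].
Proof.
move=> f0 fm; pose B := mdeg m.
pose dec (c : {bseq B of (box m * 'I_B.+1)%type}) : fproduct l :=
  [seq (box_mnm bk.1, val bk.2) | bk <- c].
have decP M : admissible M -> degF M = m -> exists c, dec c = M.
  move=> Ma dM; have [sM MP] := admissible_size Ma; rewrite dM in sM MP.
  pose e (p : multinom l * nat) : box m * 'I_B.+1 := ([ffun i => inord (p.1 i)], inord p.2).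
  have sz : (size (map e M) <= B)%N by rewrite size_map.
  exists (Bseq sz); rewrite /dec /= -map_comp -[RHS]map_id.
  apply/eq_in_map => p pM /=.
  have [j ->] : exists j : 'I_(size M), p = tnth (in_tuple M) j by apply/(tnthP (in_tuple M)).
  have [k1 d1] := MP j; rewrite [RHS]surjective_pairing; congr (_, _).
    by apply/mnmP => i; rewrite mnmE ffunE inordK // ltnS; apply: d1.
  by rewrite /= inordK.
have near1 : \forall v \near coefv m f, forall c, admissible (dec c) -> degF (dec c) = m ->
    factset R (dec c) (polv v) -> exact_product (dec c) f.
  apply: (@filter_forall 'rV[K]_(dimP m) _ (fun c v => admissible (dec c) ->
    degF (dec c) = m -> factset R (dec c) (polv v) -> exact_product (dec c) f) (nbhs (coefv m f)) _) => c.
  have [ex|nex] := pselect (exact_product (dec c) f).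
    by apply: filterE => v _ _ _.
  have [Ma|] := pselect (admissible (dec c)); last by move=> nA; apply: filterE => v /nA.
  have [dM|] := pselect (degF (dec c) = m); last by move=> nd; apply: filterE => v _ /nd.
  have ncl : ~ closure (coefv m @` factset R (dec c)) (coefv m f).
    by move=> H; apply: nex; apply: (closure_exact_product Ma dM f0 fm).
  move/not_closure_near : ncl; apply: filterS => v nv _ _ vf.
  by exfalso; apply: nv; apply/(coefv_factsetE _ dM).
have near2 : \forall v \near coefv m f, polv v != 0 /\ multideg (polv v) = m.
  apply: (@multideg_near _ (nbhs (coefv m f)) _ (@polv R l m) f m _ f0 fm).
    have fK : polv (coefv m f) = f by apply: coefvK; rewrite -fm; exact: degle_multideg.
    by have := polv_cvg (@cvg_id _ (nbhs (coefv m f))); rewrite fK; apply.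
  by apply: filterE => v; apply: degle_polv.
apply: filterS2 near1 near2 => v H [v0 vm].
have [M [Ma dM vM]] := exists_factorization v0; rewrite vm in dM.
have [c Ec] := decP M Ma dM; exists M; split=> //.
by rewrite -Ec; apply: H; rewrite Ec.
Qed.

End Specialization.

(** * Tangent vectors and the dimension of a submanifold *)

Section Tangents.
Context {K : numFieldType}.

Lemma mulmx_cvg (T : Type) (G : set_system T) {FG : Filter G} n p (B : 'M[K]_(n, p))
  (u : T -> 'rV[K]_n) (z : 'rV[K]_n) : u @ G --> z -> u t *m B @[t --> G] --> z *m B.
Proof.
move=> uz; apply: rV_cvg => j; rewrite mxE; under eq_fun do rewrite mxE.
by apply: cvg_sum_fin => i; apply: cvgM; [exact: rV_cvg_coord uz i|exact: cvg_cst].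
Qed.

Lemma mulmx_lipschitz n p (B : 'M[K]_(n, p)) :
  exists2 k : K, 0 < k & forall x : 'rV[K]_n, `|x *m B| <= k * `|x|.
Proof.
apply: (@linear_lipschitz _ _ _ (mulmxr B)) => x.
by apply: (@mulmx_cvg _ (nbhs x) _ n p B id x); exact: cvg_id.
Qed.

Lemma diff_estimate (d n : nat) (phi : 'rV[K]_d -> 'rV[K]_n) x (e : K) :
  differentiable phi x -> 0 < e ->
  \forall h \near (0 : 'rV[K]_d), `|phi (x + h) - phi x - 'd phi x h| <= e * `|h|.
Proof.
move=> /diff_locallyxC H e0.
have /eqaddoP : (fun h => phi (x + h)) = (fun h => phi x + 'd phi x h) +o_ (0 : 'rV[K]_d) id.
  by apply/funext => h; exact: H.
move=> /(_ _ e0); apply: filterS => h.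
by rewrite /= opprD addrA.
Qed.

(** Velocities at p of curves in S through p, with no regularity required away
    from p.  The definition does not mention charts, so it compares the dimensions
    of different charts. *)
Definition tangent n (S : set 'rV[K]_n) (p w : 'rV[K]_n) : Prop :=
  exists c : K -> 'rV[K]_n, (\forall t \near 0^', S (c t)) /\
    t^-1 *: (c t - p) @[t --> 0^'] --> w.

(** If c is a curve in S, its image y under the continuous inverse of the chart
    tends to the base point, and injectivity of the differential A bounds y by a
    multiple of c - p; hence the error of the linear approximation is o(t) and the
    velocity of c lies in the row space of A.  Differentiability at the base point
    is enough for this. *)
Lemma submanifold_tangent n d (S : set 'rV[K]_n) p :
  submanifold_of_dim d S -> S p ->
  exists2 A : 'M[K]_(d, n), row_free A & forall w, tangent S p w <-> (w <= A)%MS.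
Proof.
move=> SM Sp; have [U [V [phi [psi [[oU Up] oV dphi phiV [psiK psiC]]]]]] := SM p Sp.
have : (S `&` U) p by [].
rewrite -phiV => -[x0 Vx0 phix0].
have [df inj] := dphi x0 Vx0.
pose A : 'M[K]_(d, n) := lin1_mx ('d phi x0).
have AE u : 'd phi x0 u = u *m A by rewrite mul_rV_lin1.
have Afree : row_free A.
  rewrite -kermx_eq0; apply/eqP/row_matrixP => i; rewrite row0.
  apply: inj; rewrite linear0 AE; apply/sub_kermxP; exact: row_sub.
have [B AB] := row_freeP Afree.
exists A => // w; split=> [[c [Sc cw]]|/submxP[u ->]]; last first.
  exists (fun t => phi (x0 + t *: u)); split.
    have : \forall t \near (0 : K)^', V (x0 + t *: u).
      have x0u : x0 + t *: u @[t --> (0 : K)] --> x0.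
        rewrite -[X in _ --> X]addr0 -(scale0r u).
        apply: (@cvgD _ _ _ (nbhs (0 : K)) _ (fun=> x0) (fun t => t *: u)).
          exact: cvg_cst.
        by apply: (@cvgZr_tmp K _ K (nbhs (0 : K)) _ id 0 u); exact: cvg_id.
      have : \forall t \near (0 : K), V (x0 + t *: u).
        by apply: x0u; apply: open_nbhs_nbhs.
      exact: nbhs_dnbhs.
    apply: filterS => t Vt; have : (S `&` U) (phi (x0 + t *: u)) by rewrite -phiV; exists (x0 + t *: u).
    by case.
  rewrite -AE -deriveE //.
  have H : derivable phi x0 u by exact: diff_derivable.
  have -> : (fun t => t^-1 *: (phi (x0 + t *: u) - p)) =
            (fun h => h^-1 *: ((phi \o shift x0) (h *: u) - phi x0)).
    by apply/funext => t; rewrite /= [x0 + _]addrC phix0.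
  exact: H.
pose z t := t^-1 *: (c t - p).
have zE : \forall t \near 0^', c t - p = t *: z t.
  apply: filterS (nbhs_dnbhs_neq (0 : K)) => t t0.
  by rewrite /z scalerA divff // scale1r.
have cp : c t @[t --> 0^'] --> p.
  have H : p + t *: z t @[t --> 0^'] --> p + 0 *: w.
    apply: (@cvgD _ _ _ (0 : K)^' _ (fun=> p) (fun t => t *: z t)); first exact: cvg_cst.
    by apply: cvgZ => //; apply: cvg_trans (@nbhs_dnbhs _ _); exact: cvg_id.
  move: H; rewrite scale0r addr0 => H.
  apply: cvg_trans H; apply: near_eq_cvg; apply: filterS zE => t <-.
  by rewrite addrC subrK.
have cU : \forall t \near 0^', (S `&` U) (c t).
  by apply: filterI => //; apply: cp; apply: open_nbhs_nbhs.
pose y t := psi (c t) - x0.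
have yV : \forall t \near 0^', phi (x0 + y t) = c t.
  apply: filterS cU => t; rewrite -phiV => -[x Vx E].
  by rewrite /y -E psiK // addrC subrK.
have y0 : y t @[t --> 0^'] --> (0 : 'rV[K]_d).
  have /subspace_continuousP/(_ p (conj Sp Up)) psip := psiC.
  have -> : (0 : 'rV[K]_d) = psi p - x0 by rewrite -phix0 psiK // subrr.
  apply: (@cvgB _ _ _ (0 : K)^' _ (psi \o c) (fun=> x0)); last exact: cvg_cst.
  apply: cvg_comp psip => P; rewrite /within /= => /cp.
  by move=> H; apply: filterS2 cU H => t SU; apply.
have [k k0 Bk] := mulmx_lipschitz B.
have [k' k'0 Qk] := mulmx_lipschitz (1%:M - B *m A).
pose r t := c t - p - y t *m A.
have rE (e : K) : 0 < e -> \forall t \near 0^', `|r t| <= e * `|y t|.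
  move=> e0; have := y0 _ (diff_estimate df e0).
  apply: filterS2 yV => t H; rewrite /= H phix0 AE; exact.
have zB : z t *m B @[t --> 0^'] --> w *m B by exact: mulmx_cvg cw.
have zb : \forall t \near 0^', `|z t *m B| <= `|w *m B| + 1.
  move/cvgrPdist_le: zB => /(_ 1 ltr01); apply: filterS => t H.
  rewrite -[z t *m B](subrK (w *m B)) addrC; apply: le_trans (ler_normD _ _) _.
  by rewrite lerD2l distrC.
have yb : \forall t \near 0^', `|y t| <= (`|w *m B| + 1) * 2 * `|t|.
  have e0 : 0 < (2 * k)^-1 by rewrite invr_gt0 mulr_gt0.
  apply: filterS2 (filterI zE zb) (rE _ e0) => t [zt zbt] rt.
  have yE : y t = (t *: z t) *m B - r t *m B.
    by rewrite /r mulmxBl -mulmxA AB mulmx1 zt opprB addrC subrK.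
  have rB : `|r t *m B| <= `|y t| / 2.
    apply: le_trans (Bk _) _; apply: le_trans (ler_wpM2l (ltW k0) rt) _.
    have kn0 : k != 0 by rewrite gt_eqF.
    have -> : k * ((2 * k)^-1 * `|y t|) = `|y t| / 2 by field.
    exact: lexx.
  have : `|y t| <= `|t| * (`|w *m B| + 1) + `|y t| / 2.
    rewrite {1}yE; apply: le_trans (ler_normB _ _) _; apply: lerD => //.
    by rewrite -scalemxAl normrZ ler_wpM2l.
  rewrite -lerBlDr {1}[`|y t|]splitr addrK ler_pdivrMr //.
  by have -> : (`|w *m B| + 1) * 2 * `|t| = `|t| * (`|w *m B| + 1) * 2 by ring.
have Q0 : w *m (1%:M - B *m A) = 0.
  have zQ : z t *m (1%:M - B *m A) @[t --> 0^'] --> w *m (1%:M - B *m A).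
    exact: mulmx_cvg cw.
  apply: (cvg_unique _ zQ) => //.
  apply/cvgrPdist_le => e e0.
  pose C := (`|w *m B| + 1) * 2.
  have C0 : 0 < C by rewrite mulr_gt0 // ltr_wpDl.
  have d0 : 0 < e / (k' * C) by rewrite divr_gt0 // mulr_gt0.
  apply: filterS2 (filterI (filterI zE yb) (nbhs_dnbhs_neq (0 : K))) (rE _ d0) => t [[zt ybt] t0] rt.
  rewrite sub0r normrN.
  have -> : z t *m (1%:M - B *m A) = t^-1 *: (r t *m (1%:M - B *m A)).
    rewrite /r mulmxBl -[y t *m A *m _]mulmxA [A *m _]mulmxBr mulmx1 mulmxA AB mul1mx.
    by rewrite subrr mulmx0 subr0 scalemxAl.
  rewrite normrZ normfV ler_pdivrMl ?normr_gt0 //.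
  apply: le_trans (Qk _) _; apply: le_trans (ler_wpM2l (ltW k'0) rt) _.
  apply: le_trans (ler_wpM2l (ltW k'0) (ler_wpM2l (ltW d0) ybt)) _.
  have kn0 : k' != 0 by rewrite gt_eqF.
  have Cn0 : C != 0 by rewrite gt_eqF.
  have -> : k' * (e / (k' * C) * (C * `|t|)) = `|t| * e by field; rewrite ?kn0 ?Cn0.
  exact: lexx.
apply/submxP; exists (w *m B); move/eqP: Q0.
by rewrite mulmxBr mulmx1 subr_eq0 mulmxA => /eqP.
Qed.

Lemma submanifold_dim_le n d (S : set 'rV[K]_n) p :
  submanifold_of_dim d S -> S p -> (d <= n)%N.
Proof.
move=> /submanifold_tangent SM /SM[A /eqP fA _].
by rewrite -fA rank_leq_col.
Qed.

Lemma submanifold_dim_unique n d d' (S : set 'rV[K]_n) p :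
  submanifold_of_dim d S -> submanifold_of_dim d' S -> S p -> d = d'.
Proof.
move=> SM SM' Sp; have [A fA tA] := submanifold_tangent SM Sp.
have [B fB tB] := submanifold_tangent SM' Sp.
have le1 : (A <= B)%MS by apply/row_subP => i; apply/tB/tA; exact: row_sub.
have le2 : (B <= A)%MS by apply/row_subP => i; apply/tA/tB; exact: row_sub.
rewrite -(eqP fA) -(eqP fB); apply/eqP; rewrite eqn_leq.
by rewrite !mxrankS.
Qed.

Lemma codim_unique n c (S : set 'rV[K]_n) p : S p -> has_codim S c -> codim S = c.
Proof.
move=> Sp [d SM dc]; rewrite /codim.
have : [set c | has_codim S c] (xget 0%N [set c | has_codim S c]).
  by apply: (xgetPex 0%N); exists c, d.
move=> [d' SM' dc'].
have E := submanifold_dim_unique SM SM' Sp.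
by apply: (@addnI d); rewrite dc {1}E.
Qed.

Lemma submanifold_open_full n d (S : set 'rV[K]_n) p :
  submanifold_of_dim d S -> S p -> nbhs p S -> d = n.
Proof.
move=> SM Sp pS; have [A fA tA] := submanifold_tangent SM Sp.
have all_tan (w : 'rV[K]_n) : (w <= A)%MS.
  apply/tA; exists (fun t => p + t *: w); split.
    apply: (@nbhs_dnbhs _ (0 : K)).
    have : p + t *: w @[t --> (0 : K)] --> p + 0 *: w.
      apply: (@cvgD _ _ _ (nbhs (0 : K)) _ (fun=> p) (fun t => t *: w)).
        exact: cvg_cst.
      by apply: (@cvgZr_tmp K _ K (nbhs (0 : K)) _ id 0 w); exact: cvg_id.
    by rewrite scale0r addr0 => /(_ S pS).
  apply: (cvg_near_eq (u := fun=> w)); last exact: cvg_cst.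
  apply: filterS (nbhs_dnbhs_neq (0 : K)) => t t0.
  by rewrite addrAC subrr add0r scalerA mulVf // scale1r.
have le1 : (1%:M <= A)%MS by apply/row_subP => i; exact: all_tan.
apply/eqP; rewrite eqn_leq (submanifold_dim_le SM Sp).
by have := mxrankS le1; rewrite mxrank1 (eqP fA).
Qed.

End Tangents.

(** * Local parametrization of a stratum *)

Section DegreeBounds.
Context {R : realType} {l : nat}.
Local Notation mp := (mpoly l (Cplx R)).
Implicit Types (f g : mp) (m n : multinom l).

Lemma degleM f g m n : degle f m -> degle g n -> degle (f * g) (mnm_add m n).
Proof.
move=> fm gn; have [->|f0] := eqVneq f 0; first by move=> a; rewrite mul0r mcoeff0 eqxx.
have [->|g0] := eqVneq g 0; first by move=> a; rewrite mulr0 mcoeff0 eqxx.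
move=> a /degle_multideg H i; apply: leq_trans (H i) _.
by rewrite multidegM // !mnmDE leq_add // multideg_le.
Qed.

Lemma degleX f m k : degle f m -> degle (f ^+ k) (mnm_muln m k).
Proof.
move=> fm; elim: k => [|k IH]; last by rewrite exprS mulmS; apply: degleM.
rewrite expr0 => a /degle_multideg H i.
by apply: leq_trans (H i) _; rewrite -[1]/(mpolyC l 1) multidegC mnm0E.
Qed.

Lemma degle_prod (I : Type) (r : seq I) (F : I -> mp) (n : I -> multinom l) :
  (forall i, degle (F i) (n i)) ->
  degle (\prod_(i <- r) F i) (\big[@mnm_add l/@mnm0 l]_(i <- r) n i).
Proof.
move=> H; elim: r => [|i r IH]; last by rewrite !big_cons; apply: degleM.
rewrite !big_nil => a /degle_multideg Ha i.
by apply: leq_trans (Ha i) _; rewrite -[1]/(mpolyC l 1) multidegC mnm0E.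
Qed.

Lemma degleZ (c : Cplx R) f m : degle f m -> degle (c *: f) m.
Proof. by move=> fm a; rewrite mcoeffZ mulf_eq0 negb_or => /andP[_ /fm]. Qed.

End DegreeBounds.

Section Parametrization.
Context (R : realType) (l : nat) (M : fproduct l).
Local Notation K := (Cplx R).
Local Notation mp := (mpoly l (Cplx R)).
Hypotheses (Ma : admissible M) (Mi : forall j : 'I_(size M), no_univariate_split (fdeg j)).
(* The monomial of each factor whose coefficient is pinned to 1. *)
Variable nu : forall j : 'I_(size M), 'I_(dimP (fdeg j)).
Local Notation m := (degF M).

(** The scalar, and for each factor the coefficients other than the pinned
    one. *)
Definition chart_index : finType := option {j : 'I_(size M) & 'I_(projdim (fdeg j))}.
Local Notation vec := 'rV[K]_#|chart_index|.

Lemma card_chart_index : #|chart_index| = fparam M.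
Proof.
rewrite card_option card_tagged sumnE big_map big_enum /fparam; congr _.+1.
by apply: eq_bigr => j _; rewrite card_ord.
Qed.

Definition chart_coord (x : vec) (o : chart_index) : K := x ord0 (enum_rank o).
Definition chart_scalar (x : vec) : K := chart_coord x None.

(** The value c at the pinned monomial is 1 for the factors themselves, and 0 for
    their directional derivatives. *)
Definition chart_factor (c : K) (x : vec) (j : 'I_(size M)) : mp :=
  polv (\row_(i < dimP (fdeg j))
    if unlift (nu j) i is Some k
    then chart_coord x (Some (Tagged (fun j => 'I_(projdim (fdeg j))) k)) else c).

Definition chart_poly (x : vec) : mp := chart_scalar x *: \prod_j chart_factor 1 x j ^+ fmul j.
Definition chart_map (x : vec) : 'rV[K]_(dimP m) := coefv m (chart_poly x).

Definition pinned (j : 'I_(size M)) : multinom l := box_mnm (enum_val (nu j)).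

Lemma mcoeff_pinned c x j : mcoeff (pinned j) (chart_factor c x j) = c.
Proof. by rewrite mcoeff_polv mxE unlift_none. Qed.

Lemma mcoeff_unpinned c x j k :
  mcoeff (box_mnm (enum_val (lift (nu j) k))) (chart_factor c x j) =
  chart_coord x (Some (Tagged (fun j => 'I_(projdim (fdeg j))) k)).
Proof. by rewrite mcoeff_polv mxE liftK. Qed.

Lemma chart_factor_neq0 x j : chart_factor 1 x j != 0.
Proof. by apply: contra_eq_neq (mcoeff_pinned 1 x j) => ->; rewrite mcoeff0 eq_sym oner_eq0. Qed.

Lemma degle_chart_factor c x j : degle (chart_factor c x j) (fdeg j).
Proof. exact: degle_polv. Qed.

Lemma degle_chart_poly x : degle (chart_poly x) m.
Proof.
rewrite /chart_poly degFE; apply: degleZ; apply: degle_prod => j.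
by apply: degleX; exact: degle_chart_factor.
Qed.

Lemma chart_mapK x : polv (chart_map x) = chart_poly x.
Proof. by apply: coefvK; apply: degle_chart_poly. Qed.

Lemma chart_coord_inj x y : (forall o, chart_coord x o = chart_coord y o) -> x = y.
Proof.
by move=> H; apply/rowP => i; have := H (enum_val i); rewrite /chart_coord enum_valK.
Qed.

Definition chart_point (a : K) (g : 'I_(size M) -> mp) : vec :=
  \row_i match (enum_val i : chart_index) with
         | Some (existT j k) => mcoeff (box_mnm (enum_val (lift (nu j) k))) (g j)
         | None => a end.

Lemma chart_coord_chart_point a g o : chart_coord (chart_point a g) o =
  match o with
  | Some (existT j k) => mcoeff (box_mnm (enum_val (lift (nu j) k))) (g j)
  | None => a end.
Proof. by rewrite /chart_coord mxE enum_rankK. Qed.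

Lemma chart_scalar_chart_point a g : chart_scalar (chart_point a g) = a.
Proof. exact: chart_coord_chart_point. Qed.

Lemma chart_factor_chart_point a g j : degle (g j) (fdeg j) -> mcoeff (pinned j) (g j) = 1 ->
  chart_factor 1 (chart_point a g) j = g j.
Proof.
move=> gd g1; rewrite -[RHS](coefvK gd); congr polv; apply/rowP => i; rewrite !mxE.
by case: unliftP => [k ->|->]; rewrite ?chart_coord_chart_point.
Qed.

Lemma chart_factor_cvg x c j : mcvg (nbhs x) (fun y => chart_factor c y j) (chart_factor c x j).
Proof.
apply: (@polv_cvg R l _ (nbhs x) _); apply: (@rV_cvg _ _ (nbhs x) _) => i; rewrite mxE.
under eq_fun do rewrite mxE.
by case: (unlift _ _) => [k|]; [exact: coord_continuous|exact: cvg_cst].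
Qed.

Lemma chart_poly_cvg x : mcvg (nbhs x) chart_poly (chart_poly x).
Proof.
apply: mcvgZ; first exact: coord_continuous.
apply: (mcvg_prod (F := fun j y => chart_factor 1 y j ^+ fmul j)) => j.
by apply: (@mcvgX R l _ (nbhs x) _); exact: chart_factor_cvg.
Qed.

Lemma chart_map_cvg x : chart_map y @[y --> x] --> chart_map x.
Proof. by apply: (@coefv_cvg R l _ (nbhs x) _); exact: chart_poly_cvg. Qed.

(** The parameters at which the parametrization takes its value in the stratum in
    the intended way, the coordinates being the scalar and the irreducible
    factors. *)
Definition chart_good (x : vec) :=
  chart_scalar x != 0 /\
  is_factorization (M := M) (chart_poly x) (chart_scalar x) (fun j => chart_factor 1 x j).

Lemma chart_good_neq0 x : chart_good x -> chart_poly x != 0.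
Proof.
move=> [a0 _]; rewrite scaler_eq0 negb_or a0 /=.
exact: prod_exp_neq0 (chart_factor_neq0 x).
Qed.

Lemma chart_good_factor_deg x : chart_good x -> forall j, multideg (chart_factor 1 x j) = fdeg j.
Proof. by move=> [_ [gI _ _]] j; have [] := gI j. Qed.

Lemma chart_good_deg x : chart_good x -> multideg (chart_poly x) = m.
Proof.
move=> xg; have [a0 _] := xg; rewrite multidegZ // multideg_prod => [|j _].
  rewrite degFE; apply: eq_bigr => j _.
  by rewrite multidegX ?chart_factor_neq0 // chart_good_factor_deg.
by rewrite expf_neq0 // chart_factor_neq0.
Qed.

Lemma chart_good_factset x : chart_good x -> factset R M (chart_poly x).
Proof.
move=> xg; split; [exact: chart_good_neq0|exact: chart_good_deg|].
by have [_ fg] := xg; exists (chart_scalar x), (fun j => chart_factor 1 x j).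
Qed.

(** A polynomial close to the value at x has a structure M' over which that value
    is an exact product, and is itself an exact product over M; so M and M' have the
    same number of parameters and rigidity applies. *)
Lemma chart_good_near x : chart_good x -> \forall y \near x, chart_good y.
Proof.
move=> xg; have f0 := chart_good_neq0 xg; have fm := chart_good_deg xg.
have fS := chart_good_factset xg.
have H1 : \forall y \near x, exists M', [/\ admissible M', degF M' = m,
    factset R M' (polv (chart_map y)) & exact_product M' (chart_poly x)].
  exact: (@chart_map_cvg x _ (specialization_near f0 fm)).
have H2 : \forall y \near x, forall j, chart_factor 1 y j != 0 /\ multideg (chart_factor 1 y j) = fdeg j.
  apply: (@filter_forall vec _ _ (nbhs x) _) => j.
  apply: (@multideg_near R l _ (nbhs x) _ (fun y => chart_factor 1 y j) (chart_factor 1 x j) (fdeg j)).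
  - exact: chart_factor_cvg.
  - exact: chart_factor_neq0.
  - exact: chart_good_factor_deg.
  - by apply: filterE => y; apply: degle_chart_factor.
have H3 : \forall y \near x, chart_scalar y != 0.
  by apply: (@cvg_near_neq0 R _ (nbhs x) _ _ (chart_scalar x)); [exact: coord_continuous|case: xg].
apply: filterS (filterI (filterI H1 H2) H3) => y [[[M' [M'a dM' yM' xM']] yf] ya].
rewrite chart_mapK in yM'.
have yM : exact_product M (chart_poly y).
  apply/exact_productP; exists (chart_scalar y), (fun j => chart_factor 1 y j).
  by split=> // j; have [] := yf j.
have EP : fparam M' = fparam M.
  apply/eqP; rewrite eqn_leq (exact_product_fparam M'a Ma yM' yM).
  by rewrite (exact_product_fparam Ma M'a fS xM').
split=> //.
apply: (exact_product_factset M'a Ma Mi yM' EP) => // [j|j]; by have [] := yf j.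
Qed.

Lemma scalar_cvg (T : Type) (G : set_system T) {FG : ProperFilter G} (b : T -> K) (H : T -> mp) h (z : K) :
  h != 0 -> mcvg G H h -> mcvg G (fun t => b t *: H t) (z *: h) -> b @ G --> z.
Proof.
move=> h0 Hh bH; have [a [a0 _]] := max_coefficient h0.
have nz : \forall t \near G, mcoeff a (H t) != 0 by apply: cvg_near_neq0 (Hh a) a0.
have E : \forall t \near G, mcoeff a (b t *: H t) / mcoeff a (H t) = b t.
  by apply: filterS nz => t nzt; rewrite mcoeffZ mulfK.
apply: cvg_near_eq E _; have -> : z = mcoeff a (z *: h) / mcoeff a h.
  by rewrite mcoeffZ mulfK.
by apply: cvgM; [exact: (bH a)|apply: cvgV; [exact: a0|exact: (Hh a)]].
Qed.

(** Otherwise points of the stratum that are not values at parameters in O would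
    accumulate at the value at x.  Along an ultrafilter their factors converge to
    the factors at x by rigidity, up to order and scalars; scaled to have pinned
    coefficient 1 they are parameters that tend to x. *)
Lemma chart_map_surj_near x (O : set vec) : chart_good x -> nbhs x O ->
  \forall v \near chart_map x, factset R M (polv v) -> exists2 y, O y & chart_map y = v.
Proof.
move=> xg xO; have f0 := chart_good_neq0 xg; have fm := chart_good_deg xg.
pose Bad : set 'rV[K]_(dimP m) :=
  [set v | factset R M (polv v) /\ ~ exists2 y, O y & chart_map y = v].
suff ncl : ~ closure Bad (chart_map x).
  apply: filterS (not_closure_near ncl) => v nB vM; apply: contrapT => H.
  by apply: nB; split.
move=> /ultra_of_closure[G [GU GB Gx]].
have H (t : 'rV[K]_(dimP m)) : exists ag : K * ('I_(size M) -> mp), factset R M (polv t) ->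
    is_factorization (M := M) (polv t) ag.1 ag.2.
  have [[_ _ [al [g fg]]]|nf] := pselect (factset R M (polv t)); first by exists (al, g).
  by exists (0, fun=> 0).
have [ag agP] := choice H.
have FM : \forall v \near G, factset R M (polv v) by apply: filterS GB => v [].
have H1 : \forall t \near G, polv t = (ag t).1 *: \prod_j (ag t).2 j ^+ fmul j.
  by apply: filterS FM => t /agP[].
have H2 : \forall t \near G, forall j, (ag t).2 j != 0 /\ degle ((ag t).2 j) (fdeg j).
  apply: filterS FM => t /agP[gI _ _] j; have [gj gd] := gI j.
  by split; [exact: irreducible_neq0|rewrite /fdeg -gd; exact: degle_multideg].
have Gf : mcvg G (@polv R l m) (chart_poly x).
  by rewrite -chart_mapK; apply: polv_cvg.
have [be [h [lam [h0 hd Ef [lam0 hP _]]]]] := limit_of_products GU Ma H1 H2 Gf f0 fm.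
have [_ fg] := xg.
(* Undo the permutation s of the factors, then rescale them from largest to
   pinned coefficient 1. *)
have [s [sb sd sm [v v0 vE]]] := factorization_rigid f0 Ma fg Ma Mi h0 hd Ef erefl.
have [t ts st] := sb.
have td i : fdeg (t i) = fdeg i by rewrite sd st.
have tm i : fmul (t i) = fmul i by rewrite sm st.
pose g' (w : 'rV[K]_(dimP m)) i := lam w (t i) *: (ag w).2 (t i).
have g'P i : mcvg G (fun w => g' w i) (v (t i) *: chart_factor 1 x i).
  by have := hP (t i); rewrite vE st.
pose c w i := mcoeff (pinned i) (g' w i).
have cP i : c w i @[w --> G] --> v (t i).
  by have := g'P i (pinned i); rewrite mcoeffZ mcoeff_pinned mulr1.
have c0 : \forall w \near G, forall i, c w i != 0.
  apply: (@filter_forall _ _ _ G _) => i.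
  by apply: cvg_near_neq0 (cP i) (v0 (t i)).
pose g2 w i := (c w i)^-1 *: g' w i.
have g2P i : mcvg G (fun w => g2 w i) (chart_factor 1 x i).
  have -> : chart_factor 1 x i = (v (t i))^-1 *: (v (t i) *: chart_factor 1 x i).
    by rewrite scalerA mulVf ?scale1r.
  by apply: mcvgZ (g'P i); apply: cvgV (cP i); exact: v0.
pose b w := (ag w).1 * \prod_i (c w i / lam w (t i)) ^+ fmul i.
have bE : \forall w \near G, polv w = b w *: \prod_i g2 w i ^+ fmul i.
  apply: filterS (filterI (filterI H1 lam0) c0) => w [[-> lw] cw].
  rewrite (reindex t) /=; last by exists s => i _; [exact: st|exact: ts].
  rewrite /b -scalerA -scaler_prod; congr (_ *: _); apply: eq_bigr => i _.
  rewrite tm -exprZn; congr (_ ^+ _).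
  have cw0 := cw i; have lw0 := lw (t i).
  have one : c w i / lam w (t i) * (c w i)^-1 * lam w (t i) = 1.
    by field; rewrite cw0 lw0.
  by rewrite /g2 /g' !scalerA one scale1r.
have QP : mcvg G (fun w => \prod_i g2 w i ^+ fmul i) (\prod_i chart_factor 1 x i ^+ fmul i).
  apply: (mcvg_prod (F := fun i w => g2 w i ^+ fmul i)) => i.
  exact: mcvgX (g2P i).
have Q0 : \prod_i chart_factor 1 x i ^+ fmul i != 0 by exact: prod_exp_neq0 (chart_factor_neq0 x).
have bP : b w @[w --> G] --> chart_scalar x.
  apply: (scalar_cvg Q0 QP) => a; apply: cvg_near_eq (Gf a).
  by apply: filterS bE => w ->.
pose y w := chart_point (b w) (g2 w).
have yP : y w @[w --> G] --> x.
  apply: rV_cvg => i; under eq_fun do rewrite mxE.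
  have -> : x ord0 i = chart_coord x (enum_val i) by rewrite /chart_coord enum_valK.
  case: (enum_val i) => [[j k]|]; last exact: bP.
  rewrite -(mcoeff_unpinned 1); exact: (g2P j).
have bad : \forall w \near G, O (y w) /\ chart_map (y w) = w.
  have yO : \forall w \near G, O (y w) by apply: yP.
  apply: filterS (filterI (filterI (filterI yO bE) c0) H2) => w [[[Oy wE] cw] gw].
  split=> //; rewrite -[RHS]polvK wE /chart_map /chart_poly chart_scalar_chart_point.
  congr (coefv _ (_ *: _)); apply: eq_bigr => j _; congr (_ ^+ _).
  apply: chart_factor_chart_point; last by rewrite /g2 mcoeffZ mulVf //; exact: cw.
  apply: degleZ; apply: degleZ; rewrite -td; exact: (gw (t j)).2.
have [w [[_ nw] [Oy Ew]]] := filter_ex (filterI GB bad).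
by apply: nw; exists (y w).
Qed.

End Parametrization.

(** * Strata are submanifolds *)

Section DiffCoordinates.
Context {K : numFieldType} {d : nat}.
Local Notation vec := 'rV[K]_d.

Lemma diff_sum_K (I : Type) (r : seq I) (P : pred I) (u : I -> vec -> K) (du : I -> K) x v :
  (forall i, differentiable (u i) x /\ 'd (u i) x v = du i) ->
  differentiable (fun y => \sum_(i <- r | P i) u i y) x /\
  'd (fun y => \sum_(i <- r | P i) u i y) x v = \sum_(i <- r | P i) du i.
Proof.
move=> H; elim: r => [|i r [IH1 IH2]].
  have -> : (fun y => \sum_(i <- [::] | P i) u i y) = cst 0 by apply/funext => y; rewrite big_nil.
  by rewrite big_nil diff_cst; split; [exact: differentiable_cst|].
have [Pi|nPi] := boolP (P i); last first.
  rewrite big_cons (negPf nPi).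
  have -> // : (fun y => \sum_(j <- i :: r | P j) u j y) = (fun y => \sum_(j <- r | P j) u j y).
  by apply/funext => y; rewrite big_cons (negPf nPi).
have -> : (fun y => \sum_(j <- i :: r | P j) u j y) = u i \+ (fun y => \sum_(j <- r | P j) u j y).
  by apply/funext => y; rewrite big_cons Pi.
have [d1 d2] := H i; rewrite big_cons Pi; split; first exact: differentiableD d1 IH1.
by rewrite diffD //= d2 IH2.
Qed.

Lemma diff_coord (i : 'I_d) (x v : vec) :
  'd (fun y : vec => y ord0 i) x v = v ord0 i.
Proof.
pose L := @GRing.Linear.Pack K vec K *%R (fun y : vec => y ord0 i).
have lin : linear (fun y : vec => y ord0 i : K^o) by move=> c y z; rewrite !mxE.
pose F : {linear vec -> K^o} := HB.pack (fun y : vec => y ord0 i : K^o)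
  (GRing.isLinear.Build _ _ _ _ (fun y : vec => y ord0 i : K^o) lin).
by rewrite (@diff_lin _ _ _ F x) //; exact: coord_continuous.
Qed.

Lemma diff_mul_K (u w : vec -> K) x v (du dw : K) :
  differentiable u x /\ 'd u x v = du -> differentiable w x /\ 'd w x v = dw ->
  differentiable (fun y => u y * w y) x /\
  'd (fun y => u y * w y) x v = u x * dw + w x * du.
Proof.
move=> [u1 <-] [w1 <-]; split; first exact: differentiableM u1 w1.
exact: (congr1 (fun L : vec -> K => L v) (diffM u1 w1)).
Qed.

End DiffCoordinates.

Section Jets.
Context {R : realType} {l d : nat}.
Local Notation K := (Cplx R).
Local Notation mp := (mpoly l (Cplx R)).
Local Notation vec := 'rV[K]_d.

(** The value of f at x and its derivative along v are the first two coefficients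
    of a polynomial in an auxiliary variable, so the product rule becomes
    multiplication of polynomials. *)
Definition jet (f : vec -> mp) (x v : vec) (q : {poly mp}) :=
  f x = q`_0 /\ forall a, differentiable (fun y => mcoeff a (f y)) x /\
    'd (fun y => mcoeff a (f y)) x v = mcoeff a q`_1.

Lemma jet_cst (h : mp) x v : jet (fun=> h) x v h%:P.
Proof.
split=> [|a]; first by rewrite coefC.
split; first exact: differentiable_cst.
by rewrite coefC /= mcoeff0 (diff_cst (mcoeff a h)).
Qed.

Lemma jetM (f g : vec -> mp) x v p q : jet f x v p -> jet g x v q ->
  jet (fun y => f y * g y) x v (p * q).
Proof.
move=> [f0 fd] [g0 gd]; split=> [|a]; first by rewrite f0 g0 coef0M.
have -> : (fun y => mcoeff a (f y * g y)) = (fun y => \sum_(k : bmultinom l (mdeg a).+1 *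
    bmultinom l (mdeg a).+1 | a == mnm_add k.1 k.2)
    mcoeff k.1 (f y) * mcoeff k.2 (g y)).
  by apply/funext => y; rewrite mcoeffM.
have -> : mcoeff a (p * q)`_1 =
    \sum_(k : bmultinom l (mdeg a).+1 * bmultinom l (mdeg a).+1 | a == mnm_add k.1 k.2)
    (mcoeff k.1 p`_0 * mcoeff k.2 q`_1 + mcoeff k.2 q`_0 * mcoeff k.1 p`_1).
  rewrite coefM big_ord_recr big_ord1 /= mcoeffD !mcoeffM -big_split /=.
  by apply: eq_bigr => k _; rewrite [X in _ + X]mulrC.
apply: (@diff_sum_K _ _ _ _ _ (fun (k : bmultinom l (mdeg a).+1 *
    bmultinom l (mdeg a).+1) y => mcoeff k.1 (f y) * mcoeff k.2 (g y))
  (fun (k : bmultinom l (mdeg a).+1 * bmultinom l (mdeg a).+1) =>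
    mcoeff k.1 p`_0 * mcoeff k.2 q`_1 + mcoeff k.2 q`_0 * mcoeff k.1 p`_1)) => k.
have := diff_mul_K (fd k.1) (gd k.2).
by rewrite f0 g0; exact.
Qed.

Lemma jetX (f : vec -> mp) x v p k : jet f x v p -> jet (fun y => f y ^+ k) x v (p ^+ k).
Proof.
move=> fp; elim: k => [|k IH].
  by under eq_fun do rewrite expr0; rewrite expr0; apply: jet_cst.
by under eq_fun do rewrite exprS; rewrite exprS; apply: jetM.
Qed.

Lemma jet_prod (I : Type) (r : seq I) (f : I -> vec -> mp) x v (p : I -> {poly mp}) :
  (forall i, jet (f i) x v (p i)) ->
  jet (fun y => \prod_(i <- r) f i y) x v (\prod_(i <- r) p i).
Proof.
move=> H; elim: r => [|i r IH].
  have -> : (fun y => \prod_(i <- [::]) f i y) = (fun=> 1) by apply/funext => y; rewrite big_nil.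
  by rewrite big_nil; apply: jet_cst.
have -> : (fun y => \prod_(j <- i :: r) f j y) = (fun y => f i y * \prod_(j <- r) f j y).
  by apply/funext => y; rewrite big_cons.
by rewrite big_cons; apply: jetM (H i) IH.
Qed.

End Jets.

Section JetAlgebra.
Context {mp : comNzRingType}.

Lemma lin_jet0 (g h : mp) : (g%:P + h%:P * 'X)`_0 = g.
Proof. by rewrite coefD coefC coefMX /= addr0. Qed.

Lemma lin_jet1 (g h : mp) : (g%:P + h%:P * 'X)`_1 = h.
Proof. by rewrite coefD coefC coefMX coefC /= add0r. Qed.

Lemma coef0_exp (q : {poly mp}) k : (q ^+ k)`_0 = q`_0 ^+ k.
Proof.
by elim: k => [|k IH]; [rewrite !expr0 coefC|rewrite !exprS coef0M IH].
Qed.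

Lemma coef0_prod (I : Type) (r : seq I) (P : pred I) (F : I -> {poly mp}) :
  (\prod_(i <- r | P i) F i)`_0 = \prod_(i <- r | P i) (F i)`_0.
Proof.
by apply: (big_morph (fun q : {poly mp} => q`_0)) => [p q|]; [exact: coef0M|rewrite coefC].
Qed.

Lemma coef1_exp (q : {poly mp}) k : (q ^+ k)`_1 = (k%:R * q`_0 ^+ k.-1) * q`_1.
Proof.
elim: k => [|k IH]; first by rewrite expr0 coefC /= !mul0r.
rewrite exprS coefM big_ord_recr big_ord1 /= IH coef0_exp.
case: k {IH} => [|k] /=; first by rewrite !expr0 !mul0r mulr0 add0r !mul1r mulr1.
rewrite exprS [in RHS]mulrSr mulrDl mul1r mulrDl; ring.
Qed.
End JetAlgebra.

Section Chart.
Context (R : realType) (l : nat) (M : fproduct l).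
Local Notation K := (Cplx R).
Local Notation mp := (mpoly l (Cplx R)).
Hypotheses (Ma : admissible M) (Mi : forall j : 'I_(size M), no_univariate_split (fdeg j)).
Variable nu : forall j : 'I_(size M), 'I_(dimP (fdeg j)).
Local Notation m := (degF M).
Local Notation vec := 'rV[K]_#|chart_index M|.
Local Notation pf := (@chart_factor R l M nu).

Lemma chart_factor_jet (x v : vec) j :
  jet (fun y => pf 1 y j) x v ((pf 1 x j)%:P + (pf 0 v j)%:P * 'X).
Proof.
split=> [|a]; first by rewrite lin_jet0.
rewrite lin_jet1; have [le|nle] := pselect (forall i, (a i <= fdeg j i)%N); last first.
  rewrite mcoeff_polv_out //.
  have -> : (fun y => mcoeff a (pf 1 y j)) = cst 0.
    by apply/funext => y; rewrite mcoeff_polv_out.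
  by rewrite diff_cst; split; first exact: differentiable_cst.
have [i <-] := box_mnm_surj le; rewrite mcoeff_polv mxE.
case E : (unlift (nu j) i) => [k|].
  have -> : (fun y => mcoeff (box_mnm (enum_val i)) (pf 1 y j)) =
      (fun y : vec => y ord0 (enum_rank (Some (Tagged (fun j => 'I_(projdim (fdeg j))) k) : chart_index M))).
    by apply/funext => y; rewrite mcoeff_polv mxE E.
  by split; [exact: differentiable_coord|rewrite diff_coord].
have -> : (fun y => mcoeff (box_mnm (enum_val i)) (pf 1 y j)) = cst 1.
  by apply/funext => y; rewrite mcoeff_polv mxE E.
by rewrite diff_cst; split; first exact: differentiable_cst.
Qed.

Definition chart_scalar_jetpoly (x v : vec) : {poly mp} :=
  (mpolyC l (chart_scalar x))%:P + (mpolyC l (chart_scalar v))%:P * 'X.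

Lemma chart_scalar_jet (x v : vec) :
  jet (fun y => mpolyC l (chart_scalar y)) x v (chart_scalar_jetpoly x v).
Proof.
split=> [|a]; first by rewrite lin_jet0.
rewrite lin_jet1 mcoeffC.
have -> : (fun y : vec => mcoeff a (mpolyC l (chart_scalar y))) =
    (fun y : vec => y ord0 (enum_rank (None : chart_index M))) \* cst (a == mnm0)%:R.
  by apply/funext => y; rewrite mcoeffC.
have := @diff_mul_K _ _ (fun y : vec => y ord0 (enum_rank (None : chart_index M)))
  (cst (a == mnm0)%:R) x v (chart_scalar v) 0.
rewrite mulr0 add0r [_ * chart_scalar v]mulrC; apply; last first.
  by rewrite diff_cst; split; first exact: differentiable_cst.
by split; [exact: differentiable_coord|rewrite diff_coord].
Qed.

Definition chart_poly_jetpoly (x v : vec) : {poly mp} :=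
  chart_scalar_jetpoly x v * \prod_j ((pf 1 x j)%:P + (pf 0 v j)%:P * 'X) ^+ fmul j.

Lemma chart_poly_jet (x v : vec) : jet (chart_poly nu) x v (chart_poly_jetpoly x v).
Proof.
have -> : chart_poly nu = (fun y => mpolyC l (chart_scalar y) * \prod_j pf 1 y j ^+ fmul j).
  by apply/funext => y; rewrite mul_mpolyC.
apply: jetM; first exact: chart_scalar_jet.
apply: (@jet_prod R l _ _ _ (fun j y => pf 1 y j ^+ fmul j)) => j.
by apply: jetX; exact: chart_factor_jet.
Qed.

Lemma chart_map_differentiable (x : vec) : differentiable (chart_map nu) x /\
    forall v j, ('d (chart_map nu) x v) ord0 j = mcoeff (box_mnm (enum_val j)) (chart_poly_jetpoly x v)`_1.
Proof.
have dj v j : differentiable (fun y : vec => chart_map nu y ord0 j) x /\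
    'd (fun y : vec => chart_map nu y ord0 j) x v = mcoeff (box_mnm (enum_val j)) (chart_poly_jetpoly x v)`_1.
  have [_ /(_ (box_mnm (enum_val j)))] := chart_poly_jet x v.
  have -> // : (fun y : vec => chart_map nu y ord0 j) =
      (fun y => mcoeff (box_mnm (enum_val j)) (chart_poly nu y)).
  by apply/funext => y; rewrite mxE.
have dm : differentiable (chart_map nu) x.
  have -> : chart_map nu = \sum_(j < dimP m) (fun y : vec => chart_map nu y ord0 j *: delta_mx ord0 j).
    apply/funext => y; rewrite fct_sumE; exact: row_sum_delta.
  apply: differentiable_sum => j; apply: differentiableZl.
  exact: (dj 0 j).1.
split=> // v j; rewrite -(dj v j).2.
have -> : (fun y : vec => chart_map nu y ord0 j) =
    (fun w : 'rV[K]_(dimP m) => w ord0 j) \o chart_map nu by [].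
by rewrite diff_comp //= ?diff_coord //; exact: differentiable_coord.
Qed.

(** In the derivative of alpha g_1^k_1 ... g_r^k_r all terms but one are divisible
    by g_j^k_j.  If it vanishes, then g_j divides the derivative of g_j, which for
    reasons of degree is a multiple of g_j, and is zero because its pinned
    coefficient is. *)
Lemma chart_map_diff_inj (x : vec) : chart_good nu x -> injective ('d (chart_map nu) x).
Proof.
move=> [a0 xg].
suff ker v : 'd (chart_map nu) x v = 0 -> v = 0.
  by move=> u v E; apply/eqP; rewrite -subr_eq0; apply/eqP/ker; rewrite linearB /= E subrr.
move=> dv0; pose q := chart_poly_jetpoly x v.
have q1 : q`_1 = 0.
  apply/mpolyP => a; rewrite mcoeff0; have [le|nle] := pselect (forall i, (a i <= m i)%N).
    have [j <-] := box_mnm_surj le; have [_ /(_ v j)] := chart_map_differentiable x.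
    by rewrite dv0 mxE.
  have [_ /(_ a)[_ <-]] := chart_poly_jet x v.
  have -> : (fun y : vec => mcoeff a (chart_poly nu y)) = cst 0.
    by apply/funext => y; rewrite -chart_mapK mcoeff_polv_out.
  by rewrite diff_cst.
have gP := factorization_prime xg; have gN := factorization_coprime xg.
have d0 j : pf 0 v j = 0.
  pose g := pf 1 x j; pose dl := pf 0 v j.
  pose T := chart_scalar_jetpoly x v * \prod_(i | i != j) ((pf 1 x i)%:P + (pf 0 v i)%:P * 'X) ^+ fmul i.
  have qE : q = (g%:P + dl%:P * 'X) ^+ fmul j * T by rewrite /q /chart_poly_jetpoly (bigD1 j) //= mulrCA.
  have k0 := (Ma j).1.
  have T0 : T`_0 = mpolyC l (chart_scalar x) * \prod_(i | i != j) pf 1 x i ^+ fmul i.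
    rewrite coef0M lin_jet0 coef0_prod; congr (_ * _); apply: eq_bigr => i _.
    by rewrite coef0_exp lin_jet0.
  have g0 : g != 0 by exact: chart_factor_neq0.
  have key : g * T`_1 + (fmul j)%:R * dl * T`_0 = 0.
    move: q1; rewrite qE coefM big_ord_recr big_ord1 /= coef0_exp coef1_exp lin_jet0 lin_jet1.
    rewrite -{1}(prednK k0) exprS subn0 subnn => E.
    apply: (@mulfI _ (g ^+ (fmul j).-1)); first by rewrite expf_neq0.
    by rewrite mulr0; apply: etrans E; ring.
  have gdl : divides g (dl * T`_0).
    have kU : (fmul j)%:R != 0 :> K by rewrite pnatr_eq0 -lt0n.
    exists (- ((fmul j)%:R^-1 *: T`_1)); apply: (scalerI kU).
    rewrite mulNr scalerN -scalerAl scalerA mulfV // scale1r.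
    rewrite scaler_nat -mulr_natl mulrA; apply/eqP.
    by rewrite -addr_eq0 addrC [T`_1 * g]mulrC key.
  have [_ _ gdiv'] := gP j; case: (gdiv' _ _ gdl); last first.
    have [_ _ gdiv] := gP j.
    rewrite T0 => /gdiv[/(divides_unit (mpolyC_unit a0))|]; first by case: (gP j) => _ /negPf ->.
    rewrite -big_filter => H; have [ i iJ ] := prime_divides_prod (gP j) H.
    move: iJ; rewrite mem_filter => /andP[ij _] /(prime_divides_exp (gP j)) dv.
    by case: (gN j i _ dv); rewrite eq_sym.
  move=> [e Ee]; have [//|dl0] := eqVneq dl 0.
  have e0 : e != 0 by apply: contraNneq dl0 => e0; rewrite Ee e0 mul0r.
  have ed : multideg e = mnm0.
    apply/mnmP => i; rewrite mnm0E.
    have : (multideg dl i <= fdeg j i)%N by apply: multideg_le; exact: degle_chart_factor.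
    rewrite Ee multidegM // mnmDE; have [gI _ _] := xg; have [_ ->] := gI j.
    by rewrite -[leqRHS]add0n leq_add2r leqn0 => /eqP.
  have /unit_mpolyP[c c0 Ec] := multideg0_unit e0 ed.
  have := mcoeff_pinned nu 0 v j; rewrite -/dl Ee Ec mcoeffCM mcoeff_pinned mulr1 => c00.
  by rewrite c00 eqxx in c0.
have s0 : chart_scalar v = 0.
  move: q1; rewrite /q /chart_poly_jetpoly coefM big_ord_recr big_ord1 /= lin_jet0 lin_jet1.
  have -> : \prod_j ((pf 1 x j)%:P + (pf 0 v j)%:P * 'X) ^+ fmul j = (\prod_j pf 1 x j ^+ fmul j)%:P.
    by rewrite rmorph_prod; apply: eq_bigr => j _; rewrite d0 mul0r addr0 rmorphXn.
  rewrite !coefC /= mulr0 add0r => /eqP; rewrite mulf_eq0 mpolyC_eq0 => /orP[/eqP //|].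
  by rewrite prodf_seq_eq0 => /hasP[j _ /=]; rewrite expf_eq0 (negPf (chart_factor_neq0 nu x j)) andbF.
apply: chart_coord_inj => -[[j k]|]; last by rewrite /chart_coord mxE; exact: s0.
have := mcoeff_unpinned nu 0 v k; rewrite d0 mcoeff0 => <-.
by rewrite /chart_coord mxE.
Qed.

(** Non-proportionality of two polynomials is witnessed by a nonzero 2 by 2 minor
    of their coefficients, which stays nonzero. *)
Lemma chart_factor_separated (x : vec) : chart_good nu x ->
  \forall yz \near filter_prod (nbhs x) (nbhs x), forall i j, i != j ->
    forall c : K, pf 1 yz.2 j <> c *: pf 1 yz.1 i.
Proof.
move=> [a0 xg]; have gN := factorization_coprime xg.
apply: (@filter_forall _ _ _ (filter_prod (nbhs x) (nbhs x)) _) => i.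
apply: (@filter_forall _ _ _ (filter_prod (nbhs x) (nbhs x)) _) => j.
have [->|ij] := eqVneq i j; first by apply: filterE => yz /negP[].
have [a [b ab]] : exists a b, mcoeff a (pf 1 x i) * mcoeff b (pf 1 x j) -
    mcoeff b (pf 1 x i) * mcoeff a (pf 1 x j) != 0.
  apply: contrapT => /forallNP H; apply: (gN i j ij).
  have [b [b0 _]] := max_coefficient (chart_factor_neq0 nu x i).
  exists (mpolyC l (mcoeff b (pf 1 x j) / mcoeff b (pf 1 x i))).
  apply/mpolyP => a; rewrite mcoeffCM.
  have /forallNP/(_ b)/negP := H a; rewrite negbK subr_eq0 => /eqP E.
  by apply: (mulfI b0); rewrite -E mulrA mulrCA divff // mulr1 mulrC.
have cv (k : 'I_(size M)) (e : multinom l) :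
    mcoeff e (pf 1 yz.1 k) @[yz --> filter_prod (nbhs x) (nbhs x)] --> mcoeff e (pf 1 x k) /\
    mcoeff e (pf 1 yz.2 k) @[yz --> filter_prod (nbhs x) (nbhs x)] --> mcoeff e (pf 1 x k).
  split.
    apply: (cvg_comp (@fst vec vec) (fun y => mcoeff e (pf 1 y k)) cvg_fst).
    exact: chart_factor_cvg.
  apply: (cvg_comp (@snd vec vec) (fun y => mcoeff e (pf 1 y k)) cvg_snd).
  exact: chart_factor_cvg.
have minor : \forall yz \near filter_prod (nbhs x) (nbhs x),
    mcoeff a (pf 1 yz.1 i) * mcoeff b (pf 1 yz.2 j) -
    mcoeff b (pf 1 yz.1 i) * mcoeff a (pf 1 yz.2 j) != 0.
  apply: (cvg_near_neq0 _ ab); apply: cvgB; apply: cvgM.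
  - exact: (cv i a).1.
  - exact: (cv j b).2.
  - exact: (cv i b).1.
  - exact: (cv j a).2.
apply: filterS minor => yz nz _ c E; move: nz; rewrite E !mcoeffZ.
by rewrite mulrCA [X in _ - X]mulrCA [mcoeff b _ * _]mulrC subrr eqxx.
Qed.

(** The two factorizations agree up to order and scalars; the hypothesis excludes
    a change of order, and the pinned coefficients exclude scalars. *)
Lemma chart_map_injective (x y : vec) : chart_good nu x -> chart_good nu y ->
  (forall i j, i != j -> forall c : K, pf 1 y j <> c *: pf 1 x i) ->
  chart_map nu x = chart_map nu y -> x = y.
Proof.
move=> xg yg sep Exy.
have E : chart_poly nu x = chart_poly nu y by rewrite -!chart_mapK Exy.
have [_ xf] := xg.
have [s [_ _ _ [v v0 vE]]] := factorization_rigid (chart_good_neq0 xg) Ma xf Ma Mi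
  (chart_factor_neq0 nu y) (chart_good_factor_deg yg) E erefl.
have sj j : s j = j.
  by apply/eqP/negPn/negP => ne; exact: (sep _ _ ne (v j) (vE j)).
have fE j : pf 1 y j = pf 1 x j.
  have := vE j; rewrite sj => F; have := congr1 (mcoeff (pinned nu j)) F.
  by rewrite mcoeffZ !mcoeff_pinned mulr1 F => <-; rewrite scale1r.
have sE : chart_scalar x = chart_scalar y.
  move: E; rewrite /chart_poly; under [in RHS]eq_bigr do rewrite fE.
  set Q := \prod_j _ => E; have Q0 : Q != 0 by exact: prod_exp_neq0 (chart_factor_neq0 nu x).
  apply/eqP; rewrite -subr_eq0; apply/eqP; move/eqP: E.
  by rewrite -subr_eq0 -scalerBl scaler_eq0 (negPf Q0) orbF => /eqP.
apply: chart_coord_inj => -[[j k]|]; last exact: sE.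
by rewrite -!(mcoeff_unpinned nu 1) fE.
Qed.

End Chart.

Section StrataAreManifolds.
Context {R : realType} {l : nat}.
Local Notation K := (Cplx R).
Local Notation mp := (mpoly l (Cplx R)).
Implicit Types (M : fproduct l) (F : mp).

Lemma chart_through M F : admissible M -> (forall j : 'I_(size M), no_univariate_split (fdeg j)) ->
  factset R M F ->
  exists (nu : forall j : 'I_(size M), 'I_(dimP (fdeg j))) (x : 'rV[K]_#|chart_index M|),
    chart_good nu x /\ chart_poly nu x = F.
Proof.
move=> Ma Mi FM; have [F0 _ [al [g fg]]] := FM; have [gI gC Eg] := fg.
have g0 j : g j != 0 by apply: irreducible_neq0; have [] := gI j.
have gd j : multideg (g j) = fdeg j by have [] := gI j.
have H (j : 'I_(size M)) : {i : 'I_(dimP (fdeg j)) | mcoeff (box_mnm (enum_val i)) (g j) != 0}.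
  apply: cid; have [a [a0 _]] := max_coefficient (g0 j).
  have [|i Ei] := @box_mnm_surj l (fdeg j) a; first by rewrite -gd; exact: degle_multideg.
  by exists i; rewrite Ei.
pose nu j := sval (H j).
pose c j := mcoeff (pinned nu j) (g j).
have c0 j : c j != 0 by exact: (svalP (H j)).
pose g1 j := (c j)^-1 *: g j.
pose x := chart_point nu (al * \prod_j c j ^+ fmul j) g1.
have pE j : chart_factor nu 1 x j = g1 j.
  apply: chart_factor_chart_point.
    by rewrite -gd; apply: degleZ; exact: degle_multideg.
  by rewrite mcoeffZ mulVf // c0.
have EF : chart_poly nu x = F.
  rewrite /chart_poly chart_scalar_chart_point Eg -scalerA -scaler_prod; congr (_ *: _).
  apply: eq_bigr => j _; rewrite pE -exprZn; congr (_ ^+ _).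
  by rewrite /g1 scalerA divff ?scale1r.
have al0 : al != 0 by apply: contraNneq F0 => E; rewrite Eg E scale0r.
exists nu, x; split; last exact: EF.
split.
  by rewrite chart_scalar_chart_point mulf_neq0 // prod_exp_neq0.
rewrite EF; apply: (exact_product_factset Ma Ma Mi FM) => //.
- by move=> j; exact: chart_factor_neq0.
- by move=> j; rewrite pE multidegZ ?invr_eq0.
Qed.

(** The inverse chart is continuous because the local surjectivity of the
    parametrization holds at all good parameters, not only at the base point. *)
Lemma factset_submanifold M : admissible M ->
  (forall j : 'I_(size M), no_univariate_split (fdeg j)) ->
  submanifold_of_dim (fparam M) (coefv (degF M) @` factset R M).
Proof.
move=> Ma Mi; rewrite -card_chart_index => _ [F FM <-].
have [nu [x0 [x0g EF]]] := chart_through Ma Mi FM.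
pose S := coefv (degF M) @` factset R M.
have Sgood x : chart_good nu x -> S (chart_map nu x).
  by move=> xg; exists (chart_poly nu x) => //; exact: chart_good_factset.
have [[Q1 Q2] [/= xQ1 xQ2] sepQ] := chart_factor_separated x0g.
pose V0 := ((chart_good nu) `&` (Q1 `&` Q2))°.
have xV0 : nbhs x0 V0.
  apply: nbhs_interior; apply: filterI; first exact: chart_good_near.
  exact: filterI.
have V0P x : V0 x -> [/\ chart_good nu x, Q1 x & Q2 x].
  by move=> /interior_subset[? []].
have inj0 x y : V0 x -> V0 y -> chart_map nu x = chart_map nu y -> x = y.
  move=> /V0P[xg xq _] /V0P[yg _ yq]; apply: (chart_map_injective Ma Mi xg yg).
  by apply: (sepQ (x, y)); split.
pose W := [set v | factset R M (polv v) -> exists2 y, V0 y & chart_map nu y = v].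
have pW : nbhs (chart_map nu x0) W by exact: chart_map_surj_near.
pose U := W°.
pose V := V0 `&` (chart_map nu @^-1` U).
have oU : open U by exact: open_interior.
have Up : U (chart_map nu x0) by exact: nbhs_singleton (nbhs_interior pW).
have oV : open V.
  apply: openI; first exact: open_interior.
  by move/continuousP: (@chart_map_cvg R l M nu); apply.
have phiV : chart_map nu @` V = S `&` U.
  apply/seteqP; split=> [_ [x [xV0' xU] <-]|v [Sv Uv]].
    by split=> //; apply: Sgood; have [] := V0P _ xV0'.
  have Wv := interior_subset Uv.
  have [y yV0 Ey] := Wv ((coefv_factsetE v erefl).1 Sv).
  exists y; last exact: Ey.
  by split; [exact: yV0|rewrite /preimage /mkset Ey].
pose psi v := xget x0 [set x | V x /\ chart_map nu x = v].
have psiK x : V x -> psi (chart_map nu x) = x.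
  move=> Vx; have [Vy Ey] : [set y | V y /\ chart_map nu y = chart_map nu x] (psi (chart_map nu x)).
    by apply: (xgetPex x0); exists x.
  exact: inj0 Vy.1 Vx.1 Ey.
exists U, V, (chart_map nu), psi; split.
- by split; [exact: oU|rewrite -EF; exact: Up].
- exact: oV.
- move=> x [/V0P[xg _ _] _]; split; first by have [] := chart_map_differentiable nu x.
  exact: chart_map_diff_inj.
- exact: phiV.
- split; first exact: psiK.
  apply/subspace_continuousP => v SUv; rewrite -phiV.
  move: SUv; rewrite -phiV => -[x1 Vx1 <-]; rewrite /from_subspace (psiK _ Vx1) => P x1P.
  have x1g : chart_good nu x1 by have [] := V0P _ Vx1.1.
  have PV : nbhs x1 (P `&` V) by apply: filterI x1P _; exact: open_nbhs_nbhs (conj oV Vx1).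
  have near_v := chart_map_surj_near Ma Mi x1g PV.
  suff : \forall w \near chart_map nu x1, (chart_map nu @` V) w -> P (psi w) by apply.
  apply: filterS near_v => w H [x Vx Ex].
  have wM : factset R M (polv w).
    by rewrite -Ex chart_mapK; apply: chart_good_factset; have [] := V0P _ Vx.1.
  have [y [Py Vy] Ey] := H wM.
  by rewrite -Ey (psiK _ Vy).
Qed.

Lemma factset_codim M : is_factstruct R M ->
  (codim (coefv (degF M) @` factset R M) + fparam M = dimP (degF M))%N.
Proof.
move=> FM; have Ma := factstruct_admissible FM.
have Mi := factstruct_no_univariate_split FM.
have SM := factset_submanifold Ma Mi.
have [f [al [g [f0 al0 k0 fg]]]] := FM.
have fM : factset R M f.
  split=> //; last by exists al, g.
  have [gI _ ->] := fg; rewrite multidegZ // multideg_prod => [|j _].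
    rewrite degFE; apply: eq_bigr => j _; have [gj gd] := gI j.
    by rewrite multidegX ?irreducible_neq0 // gd.
  by rewrite expf_neq0 // irreducible_neq0 //; have [] := gI j.
have Sp : (coefv (degF M) @` factset R M) (coefv (degF M) f) by exists f.
have le := submanifold_dim_le SM Sp.
have -> : codim (coefv (degF M) @` factset R M) = (dimP (degF M) - fparam M)%N.
  by apply: (codim_unique Sp); exists (fparam M) => //; rewrite subnKC.
by rewrite subnK.
Qed.

End StrataAreManifolds.

(** * Density of the stratum among exact products *)

Section SingleFactor.
Context {R : realType} {l : nat}.
Local Notation K := (Cplx R).
Local Notation mp := (mpoly l (Cplx R)).
Implicit Types (M N : fproduct l) (f g h p : mp) (n : multinom l).

Definition single n : fproduct l := [:: (n, 1%N)].

Lemma single_fdeg n (j : 'I_(size (single n))) : fdeg j = n.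
Proof. by rewrite /fdeg (tnth_nth (n, 1%N)); case: j => -[]. Qed.

Lemma single_fmul n (j : 'I_(size (single n))) : fmul j = 1%N.
Proof. by rewrite /fmul (tnth_nth (n, 1%N)); case: j => -[]. Qed.

Lemma single_degF n : degF (single n) = n.
Proof. by rewrite /degF big_seq1 mulm1n. Qed.

Lemma single_admissible n : n != mnm0 -> admissible (single n).
Proof. by move=> n0 j; rewrite single_fdeg single_fmul. Qed.

Lemma single_fparam n : fparam (single n) = dimP n.
Proof.
rewrite /fparam dimP_projdim; congr _.+1.
by rewrite big_ord1 single_fdeg.
Qed.

Lemma exact_product_single f n : f != 0 -> multideg f = n -> exact_product (single n) f.
Proof.
move=> f0 fn; exists 1, [:: (f, 1%N)]; split.
- exact: oner_neq0.
- by move=> x; rewrite inE => /eqP ->.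
- by rewrite /= fn.
- by rewrite big_seq1 expr1 scale1r.
Qed.

Lemma factset_single f n : factset R (single n) f <-> irreducible f /\ multideg f = n.
Proof.
split=> [[f0 fn [al [g [gI _ Ef]]]]|[fI fn]].
  have al0 : al != 0 by apply: contraNneq f0 => E; rewrite Ef E scale0r.
  split; last by rewrite fn single_degF.
  rewrite Ef big_ord1 -/(fmul _) single_fmul expr1; apply: irreducible_scale => //.
  by have [] := gI ord0.
split; [exact: irreducible_neq0|by rewrite single_degF|].
exists 1, (fun=> f); split=> [j|i j|].
- by split=> //; rewrite -/(fdeg j) single_fdeg.
- by rewrite (ord1 i) (ord1 j) eqxx.
- by rewrite big_ord1 -/(fmul _) single_fmul expr1 scale1r.
Qed.

(** Rigidity applied to the structure n^1: every polynomial of degree n is an exact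
    product over it, and its stratum consists of the irreducible polynomials. *)
Lemma full_fparam_irreducible N f n : n != mnm0 -> no_univariate_split n -> admissible N ->
  factset R N f -> multideg f = n -> fparam N = dimP n -> irreducible f.
Proof.
move=> n0 ni Na fN fn EN; have [f0 _ _] := fN.
have E : perm_eq N (single n).
  apply: (exact_product_same Na (single_admissible n0) _ fN (exact_product_single f0 fn)).
    by move=> j; rewrite single_fdeg.
  by rewrite single_fparam.
have EN' : N = single n by apply: perm_small_eq E.
by rewrite EN' in fN; have [] := (factset_single f n).1 fN.
Qed.

Lemma irreducible_near n g : irreducible g -> multideg g = n ->
  \forall v \near coefv n g, irreducible (polv v) /\ multideg (polv v) = n.
Proof.
move=> gI gn; have n0 : n != mnm0 by rewrite -gn; exact: irreducible_deg_neq0.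
have ni : no_univariate_split n by rewrite -gn; exact: irreducible_no_univariate_split.
have gS : factset R (single n) g by apply/factset_single.
apply: filterS (specialization_near (irreducible_neq0 gI) gn) => v [M [Ma dM vM gM]].
have vn : multideg (polv v) = n by have [_ -> _] := vM.
have [v0 _ _] := vM.
split=> //; apply: (full_fparam_irreducible n0 ni Ma vM vn).
rewrite -single_fparam; apply/eqP; rewrite eqn_leq.
rewrite (exact_product_fparam Ma (single_admissible n0) vM (exact_product_single v0 vn)).
exact: exact_product_fparam (single_admissible n0) Ma gS gM.
Qed.

(** Near a polynomial of O whose structure N has the largest possible number of
    parameters, all polynomials have structure N.  So the stratum of N contains an
    open set, and its dimension is that of the whole space. *)
Lemma irreducible_dense n h (O : set 'rV[K]_(dimP n)) :
  n != mnm0 -> no_univariate_split n -> h != 0 -> multideg h = n -> nbhs (coefv n h) O ->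
  exists g, [/\ irreducible g, multideg g = n & nbhs (coefv n g) O].
Proof.
move=> n0 ni h0 hn hO.
have hd f : multideg f = n -> polv (coefv n f) = f.
  by move=> fn; apply: coefvK; rewrite -fn; exact: degle_multideg.
(* The numbers of parameters of the structures met in O; they are at most
   dimP n, so there is a largest one. *)
pose P d := exists N f, [/\ admissible N, degF N = n, factset R N f,
  nbhs (coefv n f) O & fparam N = d].
have Pn f : f != 0 -> multideg f = n -> nbhs (coefv n f) O ->
    exists N, [/\ admissible N, degF N = n, factset R N f & P (fparam N)].
  move=> f0 fn fO; have [N [Na dN fN]] := exists_factorization f0.
  by rewrite fn in dN; exists N; split; [exact: Na|exact: dN|exact: fN|exists N, f].
have Pb N f : admissible N -> degF N = n -> factset R N f -> (fparam N <= dimP n)%N.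
  move=> Na dN fN; have [f0 fn _] := fN; rewrite dN in fn; rewrite -single_fparam.
  exact: exact_product_fparam Na (single_admissible n0) fN (exact_product_single f0 fn).
have exP : exists d, `[< P d >].
  by have [N [_ _ _ PN]] := Pn h h0 hn hO; exists (fparam N); apply/asboolP.
have bdP d : `[< P d >] -> (d <= dimP n)%N.
  by move=> /asboolP[N [f [Na dN fN _ <-]]]; exact: Pb fN.
case: (ex_maxnP exP bdP) => d /asboolP[N [f [Na dN fN fO Ed]]] dmax.
have [f0 fn _] := fN; rewrite dN in fn.
exists f; split=> //.
apply: (full_fparam_irreducible n0 ni Na fN fn).
have Ni := factstruct_no_univariate_split (factset_factstruct Na fN).
have allN : \forall w \near coefv n f, (coefv n @` factset R N) w.
  have near1 := specialization_near f0 fn.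
  have near2 : \forall w \near coefv n f, nbhs w O by exact: nbhs_interior.
  apply: filterS2 near1 near2 => w [M' [M'a dM' wM' fM']] wO.
  have [w0 wn _] := wM'; rewrite dM' in wn.
  have EP : fparam M' = fparam N.
    apply/eqP; rewrite eqn_leq (exact_product_fparam Na M'a fN fM') andbT Ed.
    apply: dmax; apply/asboolP; exists M', (polv w).
    by split; [exact: M'a|exact: dM'|exact: wM'|rewrite polvK; exact: wO|].
  have M'i := factstruct_no_univariate_split (factset_factstruct M'a wM').
  have NM' : perm_eq N M' by apply: (exact_product_same Na M'a M'i fN fM').
  have wN : exact_product N (polv w).
    apply: exact_product_embed (factset_exact wM').
    by apply: embedded_perm; rewrite perm_sym.
  apply/(coefv_factsetE _ dN); split; [exact: w0|by rewrite dN|].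
  have [be [g [be0 g0 gd Eg]]] := (exact_productP _ _).1 wN.
  by exists be, g; apply: (exact_product_factset M'a Na Ni wM' EP).
have SM : submanifold_of_dim (fparam N) (coefv n @` factset R N).
  by case: _ / dN; exact: factset_submanifold.
by apply: (submanifold_open_full SM _ allN); exists f.
Qed.

(** The difference of two multiples of p is a constant only if they are equal. *)
Lemma constant_shift_proportional g p : multideg p != mnm0 ->
  exists b : K, forall t, t != b -> forall c : K, g + mpolyC l t <> c *: p.
Proof.
move=> pn; have [[b [c E]]|none] := pselect (exists (b : K) (c : K), g + mpolyC l b = c *: p); last first.
  by exists 0 => t _ c E; apply: none; exists t, c.
exists b => t tb c' E'.
have EE : (c' - c) *: p = mpolyC l (t - b).
  by rewrite scalerBl -E -E' mpolyCB opprD addrACA subrr add0r.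
have [cc|cc] := eqVneq (c' - c) 0.
  move: EE; rewrite cc scale0r => /esym/eqP; rewrite mpolyC_eq0 subr_eq0.
  by rewrite (negPf tb).
by case/eqP: pn; rewrite -(multidegZ p cc) EE multidegC.
Qed.

(** A small constant shift keeps the polynomial irreducible, and all but finitely
    many shifts avoid the multiples of the elements of ps. *)
Lemma irreducible_dense_distinct n h (O : set 'rV[K]_(dimP n)) (ps : seq mp) :
  n != mnm0 -> no_univariate_split n -> h != 0 -> multideg h = n -> nbhs (coefv n h) O ->
  (forall p, p \in ps -> irreducible p) ->
  exists g, [/\ irreducible g, multideg g = n, O (coefv n g)
    & forall p, p \in ps -> forall c : K, g <> c *: p].
Proof.
move=> n0 ni h0 hn hO psI.
have [g [gI gn gO]] := irreducible_dense n0 ni h0 hn hO.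
have shift : mcvg (0 : K)^' (fun t => g + mpolyC l t) g.
  rewrite -[X in mcvg _ _ X]addr0; apply: mcvgD; first exact: mcvg_cst.
  move=> a; rewrite mcoeff0; under eq_fun do rewrite mcoeffC.
  exact: cvg_dnbhs_scale.
have shiftv : coefv n (g + mpolyC l t) @[t --> (0 : K)^'] --> coefv n g by exact: coefv_cvg.
have dg t : degle (g + mpolyC l t) n.
  move=> a; rewrite mcoeffD mcoeffC; have [->|a0] := eqVneq a mnm0.
    by move=> _ i; rewrite mnm0E.
  by rewrite mulr0 addr0 -gn => /degle_multideg.
have near1 : \forall t \near (0 : K)^', irreducible (g + mpolyC l t) /\ multideg (g + mpolyC l t) = n.
  have near0 : \forall t \near (0 : K)^', irreducible (polv (coefv n (g + mpolyC l t))) /\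
      multideg (polv (coefv n (g + mpolyC l t))) = n.
    exact: (shiftv _ (irreducible_near gI gn)).
  by apply: filterS near0 => t; rewrite (coefvK (dg t)).
have near2 : \forall t \near (0 : K)^', O (coefv n (g + mpolyC l t)) by exact: shiftv.
have near3 : \forall t \near (0 : K)^', forall p, p \in ps -> forall c : K, g + mpolyC l t <> c *: p.
  elim: ps psI => [|p ps IH] psI; first by apply: filterE => t p; rewrite in_nil.
  have [b bP] := constant_shift_proportional g (irreducible_deg_neq0 (psI p (mem_head _ _))).
  have nb : \forall t \near (0 : K)^', t != b by exact: dnbhs_neq.
  have IH' := IH (fun q qs => psI q (mem_behead (s := p :: ps) qs)).
  apply: filterS2 nb IH' => t tb H q; rewrite inE => /predU1P[->|]; [exact: bP|exact: H].
have [t [[[tI tn] tO] tp]] := filter_ex (filterI (filterI near1 near2) near3).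
by exists (g + mpolyC l t).
Qed.

End SingleFactor.

Section Density.
Context {R : realType} {l : nat}.
Local Notation K := (Cplx R).
Local Notation mp := (mpoly l (Cplx R)).
Implicit Types (M N : fproduct l) (f g h p : mp) (n : multinom l).

Lemma approximate_factors M (h : 'I_(size M) -> mp)
    (O : forall j : 'I_(size M), set 'rV[K]_(dimP (fdeg j))) :
  admissible M -> (forall j : 'I_(size M), no_univariate_split (fdeg j)) ->
  (forall j, h j != 0) -> (forall j, multideg (h j) = fdeg j) ->
  (forall j, nbhs (coefv (fdeg j) (h j)) (O j)) ->
  exists g : 'I_(size M) -> mp,
    (forall j, [/\ irreducible (g j), multideg (g j) = fdeg j & O j (coefv (fdeg j) (g j))]) /\
    forall i j, i != j -> forall c : K, g i <> c *: g j.
Proof.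
move=> Ma Mi h0 hd hO.
suff H (r : seq 'I_(size M)) : uniq r -> exists g : 'I_(size M) -> mp,
    (forall j, j \in r -> [/\ irreducible (g j), multideg (g j) = fdeg j & O j (coefv (fdeg j) (g j))]) /\
    forall i j, i \in r -> j \in r -> i != j -> forall c : K, g i <> c *: g j.
  have [g [gP gN]] := H _ (enum_uniq 'I_(size M)).
  by exists g; split=> [j|i j]; [apply: gP|apply: gN]; rewrite mem_enum.
elim: r => [|k r IH] /=; first by exists (fun=> 0).
move=> /andP[kr ur]; have [g [gP gN]] := IH ur.
have [|p [pI pn pO pN]] := irreducible_dense_distinct (Ma k).2 (Mi k) (h0 k) (hd k) (hO k)
  (ps := [seq g j | j <- r]).
  by move=> _ /mapP[j jr ->]; have [] := gP j jr.
exists (fun j => if j == k then p else g j); split=> [j|i j].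
  rewrite inE => /predU1P[->|jr]; first by rewrite eqxx.
  by have [E|_] := eqVneq j k; [rewrite -E jr in kr|exact: gP].
have [->|ik] := eqVneq i k; have [->|jk] := eqVneq j k.
- by move=> _ _ /negP[]; rewrite ?eqxx.
- rewrite !inE (negPf jk) /= => _ jr _ c; apply: pN; exact: map_f.
- rewrite !inE (negPf ik) /= => ir _ _ c E.
  have c0 : c != 0.
    apply/eqP => c0; have [/irreducible_neq0/eqP + _ _] := gP i ir; apply.
    by rewrite E c0 scale0r.
  by apply: (pN (g i) (map_f _ ir) c^-1); rewrite E scalerA mulVf // scale1r.
- rewrite !inE (negPf ik) (negPf jk) /=; exact: gN.
Qed.

(** The approximations are indexed by the punctured neighbourhoods of 0 in the
    field itself, with |t| as the admitted error. *)
Lemma exact_product_closure m M f : admissible M ->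
  (forall j : 'I_(size M), no_univariate_split (fdeg j)) -> degF M = m ->
  exact_product M f -> closure (coefv m @` factset R M) (coefv m f).
Proof.
move=> Ma Mi dM /exact_productP[al [h [al0 h0 hd Ef]]].
have H (t : K) : exists g : 'I_(size M) -> mp, t != 0 ->
    (forall j, [/\ irreducible (g j), multideg (g j) = fdeg j
      & `|coefv (fdeg j) (h j) - coefv (fdeg j) (g j)| < `|t|]) /\
    forall i j, i != j -> forall c : K, g i <> c *: g j.
  have [->|t0] := eqVneq t 0; first by exists (fun=> 0); case/negP.
  have hO (j : 'I_(size M)) : nbhs (coefv (fdeg j) (h j))
      [set v | `|coefv (fdeg j) (h j) - v| < `|t|].
    by apply: nbhs_norm_lt; rewrite normr_gt0.
  have [g gP] := approximate_factors Ma Mi h0 hd hO.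
  by exists g.
have [g gP] := choice H.
pose F t := al *: \prod_j g t j ^+ fmul j.
have gh j : mcvg (0 : K)^' (fun t => g t j) (h j).
  have c : coefv (fdeg j) (g t j) @[t --> (0 : K)^'] --> coefv (fdeg j) (h j).
    apply/cvgrPdist_lt => e e0.
    have small : \forall t \near (0 : K)^', `|t| < e by exact: dnbhs_small.
    apply: filterS2 small (dnbhs_neq (0 : K)) => t te t0.
    by have [/(_ j)[_ _ lt] _] := gP t t0; exact: lt_trans lt te.
  have P : mcvg (0 : K)^' (fun t => polv (coefv (fdeg j) (g t j)))
      (polv (coefv (fdeg j) (h j))) by exact: polv_cvg c.
  rewrite coefvK in P; last by rewrite -hd; exact: degle_multideg.
  move=> a; apply: cvg_near_eq (P a); apply: filterS (dnbhs_neq 0) => t t0.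
  have [/(_ j)[_ gd _] _] := gP t t0.
  by rewrite coefvK // -gd; exact: degle_multideg.
have FM : \forall t \near (0 : K)^', factset R M (F t).
  apply: filterS (dnbhs_neq (0 : K)) => t t0; have [gt gN] := gP t t0.
  have FE : exact_product M (F t).
    apply/exact_productP; exists al, (g t); split=> // j; have [gI gd _] := gt j => //.
    exact: irreducible_neq0.
  have [F0 Fd] := exact_product_multideg FE.
  split=> //; exists al, (g t); split=> // [j|i j ij]; first by have [] := gt j.
  have [gi _ _] := gt i; have [gj _ _] := gt j.
  apply/(coprime_irreducible gi gj) => /(irreducible_divides gi gj)[c _ E].
  by apply: (gN j i _ c E); rewrite eq_sym.
have FF : mcvg (0 : K)^' F f.
  rewrite Ef; apply: mcvgZ; first exact: cvg_cst.
  apply: (mcvg_prod (F := fun j t => g t j ^+ fmul j)) => j.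
  exact: mcvgX (gh j).
move=> B fB; have FB : \forall t \near (0 : K)^', B (coefv m (F t)) by apply: (coefv_cvg FF).
have [t [tM tB]] := filter_ex (filterI FM FB).
by exists (coefv m (F t)); split=> //; exists (F t).
Qed.

End Density.

Theorem theorem4p1 (R : realType) (l : nat) (N : fproduct l)
    (f : mpoly l (Cplx R)) (hN : is_factstruct R N) (hf : factset R N f)
    (M : fproduct l) (hM : is_factstruct R M)
    (m : multinom l) (hMm : degF M = m) (hNm : degF N = m) :
  (closure (coefv m @` factset R M) (coefv m f) <-> embedded N M) /\
  (embedded N M -> ~ same_fproduct N M ->
    (codim (coefv m @` factset R M) < codim (coefv m @` factset R N))%N).
Proof.
have Na := factstruct_admissible hN; have Ma := factstruct_admissible hM.
have Mi := factstruct_no_univariate_split hM.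
have [f0 fm _] := hf; rewrite hNm in fm.
have exactM : embedded N M -> exact_product M f.
  by move=> NM; apply: exact_product_embed NM (factset_exact hf).
split; first split.
- by move=> /(closure_exact_product Ma hMm f0 fm); exact: exact_product_embedded.
- by move=> /exactM; exact: exact_product_closure.
move=> /exactM fM nNM.
have le := exact_product_fparam Na Ma hf fM.
have ne : fparam N != fparam M.
  apply/eqP => E; apply: nNM; exact: exact_product_same Na Ma Mi hf fM E.
have cM : (codim (coefv m @` factset R M) + fparam M = dimP m)%N.
  by case: _ / hMm; exact: factset_codim.
have cN : (codim (coefv m @` factset R N) + fparam N = dimP m)%N.
  by case: _ / hNm; exact: factset_codim.
by lia.
Qed.
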